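(* Let $q\equiv1\pmod 3$, $d_1+2d_2\equiv0\pmod 3$ and $1>\varepsilon>0$. For positive integers $j,k$ define $$M_{j,k}(q,(d_1,d_2))=\frac{1}{|\mathcal H^{(d_1,d_2)}|'}\ \sum_{C\in\mathcal H^{(d_1,d_2)}}^{\prime}\left(\frac{-\mathrm{Tr}(\mathrm{Frob}_C|_{H^1_{\chi_3}})}{\sqrt{q+1}}\right)^j\left(\frac{-\mathrm{Tr}(\mathrm{Frob}_C|_{H^1_{\overline{\chi}_3}})}{\sqrt{q+1}}\right)^k.$$ Let $X_1,\dots,X_{q+1}$ be i.i.d. random variables, each taking the value $0$ with probability $2/(q+2)$ and each of the values $1,\omega,\omega^2$ with probability $q/(3(q+2))$. Then $$M_{j,k}(q,(d_1,d_2))=\mathbb E\left(\left(\frac1{\sqrt{q+1}}\sum_{i=1}^{q+1}X_i\right)^j\left(\frac1{\sqrt{q+1}}\sum_{i=1}^{q+1}\overline{X_i}\right)^k\right)\left(1+O\left(q^{-(1-\varepsilon)d_2+\varepsilon(j+k)}+q^{-d_1/2+j+k}\right)\right).$$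
   Context: $\mathbb F_q$ is the finite field with $q\equiv1\pmod 3$ elements; $\omega\in\mathbb C$ is a primitive third root of unity; $\chi_3$ is a fixed cubic (order 3) character of $\mathbb F_q^*$, extended by $\chi_3(0)=0$. For integers $a,b\ge0$ let $\widehat{\mathcal F}_{(a,b)}$ be the set of $F=\alpha F_1F_2^2\in\mathbb F_q[X]$ with $\alpha\in\mathbb F_q^*$ and $F_1,F_2$ monic, square-free, coprime, $\deg F_1=a$, $\deg F_2=b$, and let $\widehat{\mathcal F}_{[d_1,d_2]}=\widehat{\mathcal F}_{(d_1,d_2)}\cup\widehat{\mathcal F}_{(d_1-1,d_2)}\cup\widehat{\mathcal F}_{(d_1,d_2-1)}$. For $d_1+2d_2\equiv0\pmod 3$, $\mathcal H^{(d_1,d_2)}$ is the irreducible component of the moduli space of cyclic trigonal curves (cyclic degree 3 covers of $\mathbb P^1$) of genus $g=d_1+d_2-2$ whose $\mathbb F_q$-points are the $\mathbb F_q$-isomorphism classes of smooth projective curves $C$ with an affine model $Y^3=F(X)$, $F\in\widehat{\mathcal F}_{[d_1,d_2]}$. Each such curve is endowed with its order 3 automorphism (given on the model by $(X,Y)\mapsto(X,\zeta Y)$ for a fixed primitive cube root of unity $\zeta\in\mathbb F_q$), and isomorphisms and automorphisms are understood to be compatible with it. The prime on a sum or cardinality means each $C$ is counted with weight $1/|\mathrm{Aut}(C)|$ (automorphisms over $\mathbb F_q$). The order 3 automorphism splits the first cohomology $H^1$ of $C$ into subspaces $H^1_{\chi_3}$ and $H^1_{\overline{\chi}_3}$, on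 which it acts via $\chi_3$ and $\overline{\chi}_3$ respectively, and which are preserved by Frobenius. Concretely, if $C$ has model $Y^3=F(X)$ with $F\in\widehat{\mathcal F}_{[d_1,d_2]}$, then $\mathrm{Tr}(\mathrm{Frob}_C|_{H^1_{\chi_3}})=-\sum_{x\in\mathbb P^1(\mathbb F_q)}\chi_3(F(x))$, where $F(\infty)$ is the leading coefficient of $F$ if $F\in\widehat{\mathcal F}_{(d_1,d_2)}$ and $F(\infty)=0$ if $F\in\widehat{\mathcal F}_{(d_1-1,d_2)}\cup\widehat{\mathcal F}_{(d_1,d_2-1)}$; and $\mathrm{Tr}(\mathrm{Frob}_C|_{H^1_{\overline\chi_3}})$ is its complex conjugate. The implied constant is independent of $q$, $d_1$, $d_2$ (it may depend on $\varepsilon$, $j$, $k$). *)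

(* Defs.v *)
From HB Require Import structures.
From mathcomp Require Import all_boot all_order all_algebra.
From mathcomp Require Import qpoly fraction complex finmap.
From mathcomp Require Import all_classical all_reals all_analysis.

Set Implicit Arguments.
Unset Strict Implicit.
Unset Printing Implicit Defensive.

Import Order.TTheory GRing.Theory Num.Theory.
Import numFieldNormedType.Exports.

Local Open Scope classical_set_scope.
Local Open Scope ring_scope.
Local Open Scope complex_scope.

Section Models.
Variable Fq : finFieldType.
Implicit Types f g : {poly Fq}.

Definition squarefree_poly f := forall p, p ^+ 2 %| f -> size p = 1%N.

Definition Fhat (a b : nat) : set {poly Fq} :=
  [set f | exists (alpha : Fq) (f1 f2 : {poly Fq}),
     [/\ f = alpha *: (f1 * f2 ^+ 2), alpha != 0,
         [/\ f1 \is monic, squarefree_poly f1 & size f1 = a.+1],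
         [/\ f2 \is monic, squarefree_poly f2 & size f2 = b.+1]
       & coprimep f1 f2]].

(* The families of bidegree (d1 - 1, d2) and (d1, d2 - 1) are empty when the
   decreased degree would be negative. *)
Definition Fhat_br (d1 d2 : nat) : set {poly Fq} :=
  Fhat d1 d2
  `|` [set f | (0 < d1)%N /\ Fhat d1.-1 d2 f]
  `|` [set f | (0 < d2)%N /\ Fhat d1 d2.-1 f].

(* A smooth projective curve over Fq is given by its function field, here
   Fq(X)[Y] / (Y^3 - f(X)), in which the class of Y is 'qX. *)
Definition ratfun : fieldType := {fraction {poly Fq}}.

Definition ratC (c : Fq) : ratfun := FracField.tofrac c%:P.

Definition trigonal_poly f : {poly ratfun} := 'X^3 - (FracField.tofrac f : ratfun)%:P.

Definition function_field f := {poly %/ trigonal_poly f}.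

(* The order 3 automorphism Y |-> zeta Y. *)
Definition trigonal_aut (zeta : Fq) f (u : function_field f) :
    function_field f :=
  in_qpoly (trigonal_poly f) (polyn u \Po (ratC zeta *: 'X)).

Definition curve_iso (zeta : Fq) f g
    (phi : function_field f -> function_field g) : Prop :=
  [/\ bijective phi, zmod_morphism phi, monoid_morphism phi,
      forall c : Fq, phi (qpolyC _ (ratC c)) = qpolyC _ (ratC c)
    & forall u, phi (trigonal_aut zeta u) = trigonal_aut zeta (phi u)].

Definition isomorphic_curves (zeta : Fq) f g : Prop :=
  exists phi : function_field f -> function_field g, curve_iso zeta phi.

Definition card_curve_Aut (zeta : Fq) f : nat :=
  #|` fset_set [set phi : function_field f -> function_field f |
                 curve_iso zeta phi]|.

(* An isomorphism class of curves is represented by the set of all its models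
   in Fhat_br d1 d2. *)
Definition curve_class (zeta : Fq) (d1 d2 : nat) f : set {poly Fq} :=
  [set g | Fhat_br d1 d2 g /\ isomorphic_curves zeta f g].

Definition trigonal_moduli (zeta : Fq) (d1 d2 : nat) : set (set {poly Fq}) :=
  [set curve_class zeta d1 d2 f | f in Fhat_br d1 d2].

Definition model (C : set {poly Fq}) : {poly Fq} := xget 0 C.

(* P^1(Fq) is option Fq, None being the point at infinity. *)
Definition value_P1 (d1 d2 : nat) f (x : option Fq) : Fq :=
  if x is Some a then f.[a]
  else if f \in Fhat d1 d2 then lead_coef f else 0.

End Models.

Section Moments.
Variables (R : realType) (Fq : finFieldType).

(* A character of Fq^* of order exactly 3, extended by 0. *)
Definition cubic_character (chi : Fq -> R[i]) : Prop :=
  [/\ chi 0 = 0, chi 1 = 1, {morph chi : x y / x * y},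
      forall x, x != 0 -> chi x ^+ 3 = 1
    & exists2 x, x != 0 & chi x != 1].

Variables (zeta : Fq) (chi : Fq -> R[i]) (d1 d2 : nat).

Definition weighted_sum (h : set {poly Fq} -> R[i]) : R[i] :=
  \sum_(C \in trigonal_moduli zeta d1 d2)
     h C / (card_curve_Aut zeta (model C))%:R.

Definition weighted_card : R[i] := weighted_sum (fun=> 1).

(* The trace of Frobenius on the chi-part of H^1, by its point-count formula. *)
Definition trace_chi (C : set {poly Fq}) : R[i] :=
  - \sum_(x : option Fq) chi (value_P1 d1 d2 (model C) x).

Definition trace_chibar (C : set {poly Fq}) : R[i] := (trace_chi C)^*.

Definition sqrt_q1 : R[i] := (Num.sqrt (#|Fq|.+1)%:R : R)%:C.

Definition moment (j k : nat) : R[i] :=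
  weighted_card^-1 *
  weighted_sum (fun C => (- trace_chi C / sqrt_q1) ^+ j *
                         (- trace_chibar C / sqrt_q1) ^+ k).

End Moments.

Section ComplexRandomVariables.
Context {d : measure_display} {T : measurableType d} {R : realType}.
Variable P : probability T R.

Definition complex_to_pair (z : R[i]) :
    measurableTypeR R * measurableTypeR R := (complex.Re z, complex.Im z).

Definition complex_rv (Z : T -> R[i]) : Prop :=
  measurable_fun [set: T] (complex_to_pair \o Z).

Definition complex_expectation (Z : T -> R[i]) : R[i] :=
  fine ('E_P[fun t => complex.Re (Z t)])%E
  +i* fine ('E_P[fun t => complex.Im (Z t)])%E.

Definition mutually_independent (n : nat) (X : 'I_n -> T -> R[i]) : Prop :=
  forall (J : {set 'I_n})
         (B : 'I_n -> set (measurableTypeR R * measurableTypeR R)),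
    (forall i, measurable (B i)) ->
    P (\bigcap_(i in [set` J]) [set t | B i (complex_to_pair (X i t))]) =
    (\prod_(i in J) fine (P [set t | B i (complex_to_pair (X i t))]))%:E.

(* The atoms 0, 1, omega, omega^2 have total mass 1, so they carry the law. *)
Definition has_trigonal_law (omega : R[i]) (q : nat) (Z : T -> R[i]) : Prop :=
  P [set t | Z t = 0] = (2 / (q%:R + 2))%:E /\
  forall m : 'I_3, P [set t | Z t = omega ^+ m] =
                   (q%:R / (3 * (q%:R + 2)))%:E.

Definition iid_trigonal (omega : R[i]) (q : nat)
    (X : 'I_q.+1 -> T -> R[i]) : Prop :=
  [/\ forall i, complex_rv (X i), mutually_independent X
    & forall i, has_trigonal_law omega q (X i)].

Definition random_moment (q j k : nat) (X : 'I_q.+1 -> T -> R[i]) : R[i] :=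
  let s : R[i] := (Num.sqrt (q.+1)%:R : R)%:C in
  complex_expectation (fun t =>
    (s^-1 * \sum_(i < q.+1) X i t) ^+ j *
    (s^-1 * \sum_(i < q.+1) (X i t)^*) ^+ k).

End ComplexRandomVariables.

(* Main.v *)
(* A curve isomorphism between two models is a substitution X -> (aX+b)/(cX+d),
   Y -> Y / (l (cX+d)^n), and the parameters (a, b, c, d, l) (with (c, d)
   normalized) act on all models; hence a class weighted by 1/|Aut| contributes
   in proportion to its number of models, and the moment is a plain average over
   the models f = alpha F1 F2^2.  Expanding the powers over tuples of points of
   P^1(F_q) turns this average into averages of products of local characters.
   When at every point the exponents of chi and of its conjugate agree mod 3, one
   counts coprime square-free pairs with prescribed non-vanishing:
   inclusion-exclusion over common irreducible factors gives a factor q/(q+2) per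
   point, with relative error q^(-(1-th)d1) + q^(-(1-th)d2), th = min(eps, 1/2).
   Otherwise some finite point carries a nontrivial character, and a Parseval
   argument over residues modulo prod (X - x_i) bounds the average by
   q^(-d1/2 + (j+k)/4).  The same expansion of the random moment yields exactly
   the factors q/(q+2); it is not too small because at least (q+1)^((j+k)/4)
   pairs of tuples satisfy the congruences (both moments vanish when j and k
   differ mod 3). *)
Require Import Defs.
From HB Require Import structures.
From mathcomp Require Import all_boot all_order all_algebra.
From mathcomp Require Import qpoly fraction complex finmap.
From mathcomp Require Import all_classical all_reals all_analysis.
From mathcomp Require Import ring lra zify.

Set Implicit Arguments.
Unset Strict Implicit.
Unset Printing Implicit Defensive.

Import Order.TTheory GRing.Theory Num.Theory.
Import numFieldNormedType.Exports.

Local Open Scope classical_set_scope.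
Local Open Scope ring_scope.
Local Open Scope complex_scope.

(** * Monic and square-free polynomials *)

(** The obstacle is uniformity: the error must be relative to the random moment, with a constant
    independent of q, d1 and d2. Sums over square-free polynomials are not treated through
    L-functions; an asymptotic formula with error y^n, for y = q^th, is carried from one condition
    to the next by recursions in the degree. As q is 1 mod 3, q >= 4 and y >= 4^th > 1, and this
    fixed lower bound keeps every Euler product bounded. The bound th <= eps serves the d2 term; th
    <= 1/2 lets the d1 term be absorbed in q^(-d1/2 + j + k). The density of coprime square-free
    pairs is never evaluated: it cancels between the sum attached to a pair of tuples and the size
    of the family, for which a lower bound valid in all degrees suffices. The exponent j + k arises
    from the number (q+1)^(j+k) of pairs of tuples. The factor q^((j+k)/4) lost on each
    non-congruent pair is cancelled by the factor of the same size in the lower bound for the random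
    moment before normalization. *)

Section MonicPolynomials.
Variable F : finFieldType.
Implicit Types p g d : {poly F}.

Definition monics n : seq {poly F} :=
  [seq 'X^n + polyn r | r <- enum {: {poly_n F}}].

Lemma mem_monics n p : (p \in monics n) = (p \is monic) && (size p == n.+1).
Proof.
apply/mapP/andP => [[r _ ->]|[pm /eqP sp]].
  have sr : (size r < size ('X^n : {poly F}))%N by rewrite size_polyXn ltnS size_npoly.
  by rewrite monicE lead_coefDl // lead_coefXn eqxx size_polyDl // size_polyXn.
have sr : (size (p - 'X^n)%R <= n)%N.
  apply/leq_sizeP => i ni; rewrite coefB coefXn.
  move: ni; rewrite leq_eqVlt => /orP[/eqP <-|ni].
    by rewrite eqxx; move/monicP: pm; rewrite lead_coefE sp /= => ->; rewrite subrr.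
  by rewrite nth_default ?sp // gtn_eqF ?subr0.
exists (npolyp n (p - 'X^n)); first by rewrite mem_enum.
by rewrite npolypK // addrC subrK.
Qed.

Lemma monics_uniq n : uniq (monics n).
Proof.
rewrite map_inj_uniq ?enum_uniq // => a b /addrI ab; exact: val_inj.
Qed.

Lemma size_monics n : size (monics n) = (#|F| ^ n)%N.
Proof. by rewrite size_map -cardE card_npoly. Qed.

Lemma monicsP n p : reflect (p \is monic /\ size p = n.+1) (p \in monics n).
Proof. by rewrite mem_monics; apply: (iffP andP) => -[-> /eqP]. Qed.

Lemma big_monics_multiples (V : nmodType) n e d (phi : {poly F} -> V) :
  d \in monics e ->
  \sum_(g <- monics n | d %| g) phi g =
  if (e <= n)%N then \sum_(g <- monics (n - e)) phi (d * g) else 0.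
Proof.
move=> /monicsP[dm sd]; have d0 : d != 0 by rewrite monic_neq0.
case: leqP => en; last first.
  rewrite big_seq_cond big1 // => g /andP[/monicsP[gm sg] dg].
  have := dvdp_leq (monic_neq0 gm) dg.
  by rewrite sg sd ltnS leqNgt en.
rewrite -big_filter -[RHS](big_map (fun g => d * g) predT phi).
apply: perm_big; apply: uniq_perm.
- by rewrite filter_uniq // monics_uniq.
- by rewrite map_inj_uniq ?monics_uniq //; apply: mulfI.
move=> g; rewrite mem_filter; apply/andP/mapP => [[dg /monicsP[gm sg]]|[h /monicsP[hm sh] ->]].
  exists (g %/ d); last by rewrite mulrC divpK.
  apply/monicsP; have e1 : d * (g %/ d) = g by rewrite mulrC divpK.
  have qm : g %/ d \is monic by rewrite -(monicMl _ dm) e1.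
  split => //; have := size_monicM dm (monic_neq0 qm); rewrite e1 sg sd.
  have : (0 < size (g %/ d)%R)%N by rewrite size_poly_gt0 monic_neq0.
  by lia.
split; first by rewrite dvdp_mulr.
apply/monicsP; rewrite monicMl // hm size_monicM // ?monic_neq0 // sd sh.
by split=> //; lia.
Qed.

End MonicPolynomials.

(** * Monic irreducible polynomials of bounded degree and divisibility tests by them *)

Section Irreducibles.
Variables (F : finFieldType).
Implicit Types p g d : {poly F}.

(** Inclusion-exclusion and Euler products need a finite index type, hence the cap [N] on the
    degree. It is only required to dominate the degrees of the polynomials being tested. *)
Definition irr (N : nat) : finType :=
  {r : {poly_N.+1 F} | (val r \is monic) && irreducibleb (val r)}.

Definition irrp N (i : irr N) : {poly F} := val (val i).

Definition irrdeg N (i : irr N) := (size (irrp i)).-1.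

Lemma irrp_monic N (i : irr N) : irrp i \is monic.
Proof. by have /andP[] := valP i. Qed.

Lemma irrp_irreducible N (i : irr N) : irreducible_poly (irrp i).
Proof. by have /andP[_ /irreducibleP] := valP i. Qed.

Lemma irrp_neq0 N (i : irr N) : irrp i != 0.
Proof. exact: monic_neq0 (irrp_monic i). Qed.

Lemma irrp_inj N : injective (@irrp N).
Proof. by move=> i j /val_inj /val_inj. Qed.

Lemma irrdegE N (i : irr N) : size (irrp i) = (irrdeg i).+1.
Proof. by rewrite /irrdeg prednK // size_poly_gt0 irrp_neq0. Qed.

Lemma irrdeg_gt0 N (i : irr N) : (0 < irrdeg i)%N.
Proof. by case: (irrp_irreducible i) => + _; rewrite irrdegE. Qed.

Lemma irrdeg_le N (i : irr N) : (irrdeg i <= N)%N.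
Proof. by rewrite -ltnS -irrdegE size_npoly. Qed.

Lemma irrp_mem N (i : irr N) : irrp i \in monics F (irrdeg i).
Proof. by apply/monicsP; rewrite irrp_monic irrdegE. Qed.

Lemma irrp_full N p : p \is monic -> irreducible_poly p -> (size p <= N.+1)%N ->
  exists i : irr N, irrp i = p.
Proof.
move=> pm pirr sp.
have H : (npolyp N.+1 p : {poly F}) = p by rewrite npolypK.
have Q : (val (npolyp N.+1 p) \is monic) && irreducibleb (val (npolyp N.+1 p)).
  by rewrite /= H pm; apply/irreducibleP.
by exists (Sub (npolyp N.+1 p) Q : irr N); rewrite /irrp SubK.
Qed.

Lemma irrp_coprime N (i j : irr N) : i != j -> coprimep (irrp i) (irrp j).
Proof.
move=> ij; rewrite (irreducible_poly_coprime _ (irrp_irreducible i)).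
apply: contraNN ij => dij; apply/eqP/irrp_inj.
case: (irrp_irreducible i) => si _; case: (irrp_irreducible j) => _ /(_ (irrp i)).
rewrite neq_ltn si orbT => /(_ isT dij).
by rewrite (eqp_monic (irrp_monic i) (irrp_monic j)) => /eqP.
Qed.

Lemma irrp_dvdM N (i : irr N) p g :
  (irrp i %| p * g) = (irrp i %| p) || (irrp i %| g).
Proof.
case: (boolP (irrp i %| p)) => [ip|]; first by rewrite dvdp_mulr.
by rewrite -(irreducible_poly_coprime _ (irrp_irreducible i)) => /Gauss_dvdpr ->.
Qed.

Lemma poly_irr_factor p : (1 < size p)%N ->
  exists2 d, d \is monic /\ irreducible_poly d & d %| p.
Proof.
have [n] := ubnP (size p); elim: n p => // n IH p; rewrite ltnS => spn sp.
have p0 : p != 0 by rewrite -size_poly_gt0 (ltn_trans _ sp).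
have [/irreducibleP ip|] := boolP (irreducibleb p).
  exists ((lead_coef p)^-1 *: p); last by rewrite dvdpZl ?invr_eq0 ?lead_coef_eq0.
  have lp : (lead_coef p)^-1 != 0 by rewrite invr_eq0 lead_coef_eq0.
  split; first by rewrite monicE lead_coefZ mulVf // lead_coef_eq0.
  split; first by rewrite size_scale.
  move=> q sq; rewrite dvdpZr // => /(ip.2 _ sq) /eqp_trans; apply.
  by rewrite eqp_sym eqp_scale.
rewrite /irreducibleb sp /= negb_forall => /existsP[q].
rewrite negb_imply -Pdiv.Idomain.dvdpE -ltnNge => /andP[dq sq].
have sq' : (size q < size p)%N.
  by rewrite (leq_ltn_trans (size_npoly q)) // ltn_predL (ltn_trans _ sp).
have [d dP dd] := IH _ (leq_trans sq' spn) sq.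
by exists d => //; apply: dvdp_trans dq.
Qed.

Lemma irrp_factor N p : (1 < size p <= N.+1)%N -> exists i : irr N, irrp i %| p.
Proof.
case/andP=> sp spN; have [d [dm di] dp] := poly_irr_factor sp.
have p0 : p != 0 by rewrite -size_poly_gt0 (ltn_trans _ sp).
have [|i ie] := irrp_full dm di (N := N); last by exists i; rewrite ie.
by rewrite (leq_trans _ spN) // dvdp_leq.
Qed.

Definition irrprod N (J : {set irr N}) : {poly F} := \prod_(i in J) irrp i.

Definition irrsdeg N (J : {set irr N}) := (\sum_(i in J) irrdeg i)%N.

Lemma irrprod_mem N (J : {set irr N}) : irrprod J \in monics F (irrsdeg J).
Proof.
rewrite /irrprod /irrsdeg; elim/big_ind2: _ => [|a b c e|i _].
- by apply/monicsP; rewrite monic1 size_poly1.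
- move=> /monicsP[m1 s1] /monicsP[m2 s2]; apply/monicsP.
  by rewrite monicMr // size_monicM ?monic_neq0 // s1 s2 addSn addnS.
- exact: irrp_mem.
Qed.

Lemma irrprod_dvd N (J : {set irr N}) k p :
  (irrprod J ^+ k %| p) = [forall i in J, irrp i ^+ k %| p].
Proof.
rewrite /irrprod -prodrXl -big_enum /=.
have -> : [forall i in J, irrp i ^+ k %| p] = all (fun i => irrp i ^+ k %| p) (enum J).
  apply/forall_inP/allP => [H i|H i iJ]; first by rewrite mem_enum => /H.
  by apply: H; rewrite mem_enum.
elim: (enum J) (enum_uniq J) => [|i s IH] /=; first by rewrite big_nil dvd1p.
case/andP=> is_ us; rewrite big_cons Gauss_dvdp ?IH //.
rewrite coprimep_expl // big_seq; elim/big_ind: _ => [|a b ha hb|j js].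
- exact: coprimep1.
- by rewrite coprimepMr ha hb.
- by rewrite coprimep_expr // irrp_coprime //; apply: contraNneq is_ => ->.
Qed.

Lemma irrprod_inj N : injective (@irrprod N).
Proof.
suff H (J K : {set irr N}) : irrprod J = irrprod K -> J \subset K.
  by move=> J K JK; apply/eqP; rewrite finset.eqEsubset !H.
move=> JK; apply/fintype.subsetP => i iJ; apply: contraT => iK.
have : irrp i %| irrprod K.
  by rewrite -JK /irrprod (bigD1 i) //= dvdp_mulr.
rewrite /irrprod; elim/big_ind: _ => [|a b ha hb|j jK].
- case: (irrp_irreducible i) => si _.
  by rewrite dvdp1 => /eqP s1; rewrite s1 in si.
- by rewrite irrp_dvdM => /orP[].
- have ij : i != j by apply: contraNneq iK => ->.
  have := irrp_coprime ij.
  by rewrite (irreducible_poly_coprime _ (irrp_irreducible i)) => /negbTE ->.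
Qed.

(* Locked, so that unification does not unfold the classical decision. *)
Definition sqf p : bool := locked `[< squarefree_poly p >].

Lemma sqfP p : reflect (forall d, d ^+ 2 %| p -> size d = 1%N) (sqf p).
Proof. by rewrite /sqf -lock; exact: asboolP. Qed.

Lemma sqf_irrp N p : p != 0 -> (size p <= N.+1)%N ->
  sqf p = [forall i : irr N, ~~ (irrp i ^+ 2 %| p)].
Proof.
move=> p0 spN; apply/sqfP/forallP => [H i|H d dp].
  by apply/negP => /H; case: (irrp_irreducible i) => + _; move=> /[swap] ->.
have d0 : d != 0.
  by apply: contraNneq p0 => d0; move: dp; rewrite d0 expr0n /= dvd0p.
have sd : (0 < size d)%N by rewrite size_poly_gt0.
case: (ltngtP (size d) 1%N) => // [|sd1]; first by rewrite ltnNge sd.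
have dd : d %| p by apply: dvdp_trans dp; rewrite expr2 dvdp_mulr.
have [|i idd] := @irrp_factor N d.
  by rewrite sd1 (leq_trans _ spN) // dvdp_leq.
by have := H i; rewrite (dvdp_trans _ dp) // dvdp_exp2r.
Qed.

Lemma coprimep_irrp N p g : p != 0 -> (size p <= N.+1)%N ->
  coprimep p g = [forall i : irr N, ~~ ((irrp i %| p) && (irrp i %| g))].
Proof.
move=> p0 spN; apply/idP/forallP => [/coprimepP H i|H].
  apply/negP => /andP[/H /[apply]]; rewrite -size_poly_eq1.
  by case: (irrp_irreducible i) => + _; move=> /[swap] /eqP ->.
apply: contraT => ncop.
have g0 : gcdp p g != 0 by rewrite gcdp_eq0 negb_and p0.
have [|i idd] := @irrp_factor N (gcdp p g).
  rewrite (leq_trans _ spN) ?dvdp_leq ?dvdp_gcdl // andbT.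
  by rewrite ltn_neqAle eq_sym size_poly_gt0 g0 andbT; move: ncop; rewrite coprimep_def.
by have := H i; move: idd; rewrite dvdp_gcd => ->.
Qed.

Lemma const_irrp N n p : (n <= N)%N -> p \in monics F n ->
  (n == 0)%N = [forall i : irr N, ~~ (irrp i %| p)].
Proof.
move=> nN /monicsP[pm sp]; apply/eqP/forallP => [n0 i|H].
  apply/negP => /dvdp_leq -/(_ (monic_neq0 pm)).
  by case: (irrp_irreducible i) => s1 _; rewrite sp n0 leqNgt s1.
case: n sp nN => // n sp nN.
by have [|i ip] := @irrp_factor N p; [rewrite sp !ltnS|have := H i; rewrite ip].
Qed.

Lemma sqfM_irrp N (i : irr N) p : p != 0 ->
  sqf (irrp i * p) = sqf p && ~~ (irrp i %| p).
Proof.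
(* The square-free test needs a cap that covers [irrp i * p], so the irreducible is transported to
   [irr F M]. *)
move=> p0; set M := (N + size p)%N.
have sN : (size (irrp i) <= M.+1)%N.
  by rewrite irrdegE ltnS (leq_trans (irrdeg_le i)) // leq_addr.
have [i' ii'] := irrp_full (irrp_monic i) (irrp_irreducible i) sN.
have s1 : (size p <= M.+1)%N by rewrite /M; lia.
have s2 : (size (irrp i * p)%R <= M.+1)%N.
  rewrite size_mul ?irrp_neq0 // irrdegE /= (leq_trans (leq_add (irrdeg_le i) (leqnn _))) //.
rewrite (sqf_irrp (N := M)) ?mulf_neq0 ?irrp_neq0 // (sqf_irrp (N := M)) // -ii'.
apply/forallP/andP => [H|[/forallP H1 H2] j].
  split; last first.
    by have := H i'; rewrite expr2 dvdp_mul2l ?irrp_neq0.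
  apply/forallP => j; apply: contraNN (H j); exact: dvdp_mull.
case: (eqVneq j i') => [->|ji]; first by rewrite expr2 dvdp_mul2l ?irrp_neq0.
rewrite Gauss_dvdpr ?H1 //.
by rewrite coprimep_expl // irrp_coprime.
Qed.

(** The trivial count is enough: at most q^n irreducibles among the q^n monic polynomials of degree
    n. In the applications [f] decays faster than q^(-n). *)
Lemma sum_irrdeg (R : numDomainType) N (f : nat -> R) :
  (forall n, 0 <= f n) ->
  \sum_(i : irr N) f (irrdeg i) <= \sum_(1 <= n < N.+1) #|F|%:R ^+ n * f n.
Proof.
move=> f0.
rewrite (eq_bigr (fun i => \sum_(1 <= n < N.+1 | n == irrdeg i) f n)); last first.
  by move=> i _; rewrite big_nat1_eq irrdeg_gt0 ltnS irrdeg_le.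
rewrite (exchange_big_dep predT) //=; apply: ler_sum => n _.
rewrite sumr_const -[leLHS]mulr_natl ler_wpM2r // -natrX ler_nat -size_monics.
rewrite cardE -(size_map (@irrp N)).
apply: uniq_leq_size.
  by rewrite map_inj_uniq ?enum_uniq //; apply: irrp_inj.
by move=> _ /mapP[i + ->]; rewrite mem_enum => /eqnP ->; exact: irrp_mem.
Qed.

End Irreducibles.

(** * Inclusion-exclusion for square-free sums *)

Lemma natr_forall (K : comNzRingType) (I : finType) (a : pred I) :
  [forall i, a i]%:R = \prod_i (a i)%:R :> K.
Proof.
have [/forallP H|/forallPn[i ni]] := boolP [forall i, a i].
  by rewrite big1 // => i _; rewrite H.
by rewrite (bigD1 i) //= (negbTE ni) mul0r.
Qed.

Lemma inclusion_exclusion (K : comNzRingType) (I : finType) (a : pred I) :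
  [forall i, ~~ a i]%:R =
  \sum_(J : {set I}) (-1) ^+ #|J| * [forall i in J, a i]%:R :> K.
Proof.
rewrite natr_forall.
rewrite (eq_bigr (fun i => - (a i)%:R + 1)); last first.
  by move=> i _; case: (a i); rewrite ?addNr ?oppr0 ?add0r.
rewrite bigA_distr; apply: eq_bigr => J _.
rewrite natr_forall -prodr_const [X in X * _]big_mkcond -big_split /=.
apply: eq_bigr => i _; case: (i \in J) => /=; last by rewrite mulr1.
by rewrite mulN1r.
Qed.

Section SquarefreeSums.
Variables (F : finFieldType) (K : comNzRingType).
Implicit Types (chi psi : {poly F} -> K) (p g : {poly F}).

Definition monic_sum chi n : K := \sum_(g <- monics F n) chi g.

Definition sqf_sum chi n : K := \sum_(g <- monics F n | sqf g) chi g.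

Definition sqf_mult_sum N (J : {set irr F N}) chi n : K :=
  \sum_(g <- monics F n | sqf g && [forall i in J, irrp i %| g]) chi g.

Definition coprime_sum chi psi d1 d2 : K :=
  \sum_(g <- monics F d1 | sqf g)
    \sum_(h <- monics F d2 | sqf h && coprimep g h) chi g * psi h.

Lemma sqf_mult_sum0 N chi n : sqf_mult_sum (finset.set0 : {set irr F N}) chi n = sqf_sum chi n.
Proof.
apply: eq_bigl => g; case: (sqf g) => //=.
by apply/forall_inP => i; rewrite finset.in_set0.
Qed.

(** Write g = p g' with p the new irreducible: g is square-free exactly when g' is and p does not
    divide g', which makes the sum over g' a difference. The set [i |: J] comes back in smaller
    degree, so asymptotics follow by induction on the degree. *)
Lemma sqf_mult_sum_rec N (J : {set irr F N}) i chi n :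
  {morph chi : x y / x * y} -> i \notin J ->
  sqf_mult_sum (i |: J) chi n =
  if (irrdeg i <= n)%N then
    chi (irrp i) * (sqf_mult_sum J chi (n - irrdeg i) -
                    sqf_mult_sum (i |: J) chi (n - irrdeg i))
  else 0.
Proof.
move=> chiM iJ.
have Jcond g : [forall j in i |: J, irrp j %| g] =
    (irrp i %| g) && [forall j in J, irrp j %| g].
  apply/forall_inP/andP => [H|[ig /forall_inP H] j].
    split; first by apply: H; rewrite finset.setU11.
    by apply/forall_inP => j jJ; apply: H; rewrite finset.setU1r.
  by rewrite finset.in_setU1 => /predU1P[->|/H].
transitivity (\sum_(g <- monics F n | irrp i %| g)
    (if sqf g && [forall j in J, irrp j %| g] then chi g else 0)).
  rewrite -big_mkcondr /=; apply: eq_bigl => g.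
  by rewrite Jcond; case: (sqf g); case: (irrp i %| g).
rewrite (big_monics_multiples _ _ (irrp_mem i)); case: ifP => // _.
rewrite mulrBr /sqf_mult_sum !mulr_sumr.
rewrite [X in _ = X - _]big_mkcond [X in _ = _ - X]big_mkcond -sumrB.
rewrite big_seq [RHS]big_seq; apply: eq_bigr => g /monicsP[gm _].
have g0 := monic_neq0 gm.
rewrite Jcond sqfM_irrp // chiM.
have -> : [forall j in J, irrp j %| irrp i * g] = [forall j in J, irrp j %| g].
  apply: eq_forallb_in => j jJ; rewrite irrp_dvdM orb_idl // => ji.
  have ij : j != i by apply: contraNneq iJ => <-.
  have := irrp_coprime ij.
  by rewrite (irreducible_poly_coprime _ (irrp_irreducible j)) ji.
case: (sqf g); case: (irrp i %| g); case: [forall j in J, _] => //=;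
  by rewrite ?subrr ?subr0.
Qed.

(** Inclusion-exclusion over the common irreducible factors decouples the two polynomials. A common
    factor divides the first one, so only [d1] has to lie below the cap. *)
Lemma coprime_sumE N chi psi d1 d2 : (d1 <= N)%N ->
  coprime_sum chi psi d1 d2 =
  \sum_(J : {set irr F N})
    (-1) ^+ #|J| * (sqf_mult_sum J chi d1 * sqf_mult_sum J psi d2).
Proof.
move=> d1N.
transitivity (\sum_(g <- monics F d1 | sqf g) \sum_(h <- monics F d2 | sqf h)
  \sum_(J : {set irr F N}) (-1) ^+ #|J| *
  ((if [forall i in J, irrp i %| g] then chi g else 0) *
   (if [forall i in J, irrp i %| h] then psi h else 0))).
  rewrite /coprime_sum big_seq_cond [RHS]big_seq_cond; apply: eq_bigr => g /andP[/monicsP[gm sg] _].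
  rewrite big_mkcondr; apply: eq_bigr => h _.
  transitivity (chi g * psi h * (coprimep g h)%:R).
    by case: coprimep; rewrite ?mulr1 ?mulr0.
  rewrite (coprimep_irrp (N := N)) ?monic_neq0 ?sg //.
  rewrite (inclusion_exclusion _ (fun i : irr F N => (irrp i %| g) && (irrp i %| h))).
  rewrite mulr_sumr; apply: eq_bigr => J _; rewrite mulrCA; congr (_ * _).
  have -> : [forall i in J, (irrp i %| g) && (irrp i %| h)] =
      [forall i in J, irrp i %| g] && [forall i in J, irrp i %| h].
    apply/forall_inP/andP => [H|[/forall_inP H1 /forall_inP H2] i iJ].
      by split; apply/forall_inP => i /H /andP[].
    by rewrite H1 ?H2.
  by do 2 case: [forall i in J, _]; rewrite /= ?(mulr1, mulr0, mul0r).
under eq_bigr do rewrite exchange_big /=.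
rewrite exchange_big /=. apply: eq_bigr => J _.
rewrite /sqf_mult_sum !big_mkcondr big_distrlr mulr_sumr.
by apply: eq_bigr => g _; rewrite mulr_sumr.
Qed.

(** The identity behind this is that the indicator of square-free g is the sum of mu(d) over d^2
    dividing g, with d the product of the irreducibles in [J]. *)
Lemma sqf_sumE N chi n : (n <= N)%N -> {morph chi : x y / x * y} ->
  sqf_sum chi n =
  \sum_(J : {set irr F N} | (2 * irrsdeg J <= n)%N)
     (-1) ^+ #|J| * chi (irrprod J) ^+ 2 * monic_sum chi (n - 2 * irrsdeg J).
Proof.
move=> nN chiM.
transitivity (\sum_(g <- monics F n) \sum_(J : {set irr F N})
   (-1) ^+ #|J| * (if irrprod J ^+ 2 %| g then chi g else 0)).
  rewrite /sqf_sum big_mkcond big_seq [RHS]big_seq; apply: eq_bigr => g /monicsP[gm sg].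
  transitivity (chi g * (sqf g)%:R); first by case: (sqf g); rewrite ?mulr1 ?mulr0.
  rewrite (sqf_irrp (N := N)) ?monic_neq0 ?sg //.
  rewrite (inclusion_exclusion _ (fun i : irr F N => irrp i ^+ 2 %| g)) mulr_sumr.
  apply: eq_bigr => J _; rewrite irrprod_dvd mulrCA.
  by case: [forall i in J, _]; rewrite /= ?(mulr1, mulr0, mul0r).
rewrite exchange_big [RHS]big_mkcond; apply: eq_bigr => J _ /=.
rewrite -mulr_sumr -big_mkcond /=.
have Dm : irrprod J ^+ 2 \in monics F (2 * irrsdeg J).
  have /monicsP[m1 s1] := irrprod_mem J; apply/monicsP; rewrite monic_exp //.
  by rewrite expr2 size_monicM ?monic_neq0 // s1 addSn /= mul2n -addnn addnS.
rewrite (big_monics_multiples _ _ Dm); case: ifP => _; last by rewrite mulr0.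
rewrite /monic_sum -[RHS]mulrA; congr (_ * _); rewrite mulr_sumr; apply: eq_bigr => g _.
by rewrite chiM expr2 chiM expr2.
Qed.

(** Sum over all monic g of degree n of the relation that mu(d) summed over d dividing g is 1 for g
    = 1 and 0 otherwise. *)
Lemma mobius_sum N n : (n <= N)%N ->
  \sum_(J : {set irr F N} | (irrsdeg J <= n)%N)
     (-1) ^+ #|J| * #|F|%:R ^+ (n - irrsdeg J) = (n == 0)%N%:R :> K.
Proof.
move=> nN.
transitivity (\sum_(g <- monics F n) (n == 0)%N%:R : K); last first.
  rewrite big_const_seq count_predT size_monics iter_addr_0.
  by case: n {nN} => //= n; rewrite mul0rn.
transitivity (\sum_(g <- monics F n) \sum_(J : {set irr F N})
   (-1) ^+ #|J| * (if irrprod J %| g then 1 else 0) : K); last first.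
  rewrite big_seq [RHS]big_seq; apply: eq_bigr => g gm.
  rewrite (const_irrp nN gm) (inclusion_exclusion _ (fun i : irr F N => irrp i %| g)).
  apply: eq_bigr => J _; rewrite -[irrprod J]expr1 irrprod_dvd.
  under eq_forallb_in do rewrite expr1.
  by case: [forall i in J, _].
rewrite exchange_big [LHS]big_mkcond; apply: eq_bigr => J _ /=.
rewrite -mulr_sumr -big_mkcond /= (big_monics_multiples _ _ (irrprod_mem J)).
case: ifP => _; last by rewrite mulr0.
by rewrite big_const_seq count_predT size_monics iter_addr_0 natrX.
Qed.

(** For e at most N this is the coefficient of u^e in 1 - q u, the inverse of the zeta function of
    F[X]. *)
Definition mobius_coef N e : K :=
  \sum_(J : {set irr F N} | irrsdeg J == e) (-1) ^+ #|J|.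

Lemma sum_irrsdeg N n (a : nat -> nat) (f : nat -> K) :
  (forall e, (e <= a e)%N) ->
  \sum_(J : {set irr F N} | (a (irrsdeg J) <= n)%N) (-1) ^+ #|J| * f (irrsdeg J) =
  \sum_(e < n.+1 | (a e <= n)%N) mobius_coef N e * f e.
Proof.
move=> ha.
rewrite (partition_big (fun J : {set irr F N} => inord (irrsdeg J) : 'I_n.+1)
   (fun e : 'I_n.+1 => (a e <= n)%N)) /=; last first.
  move=> J aJ; rewrite inordK // ltnS; exact: leq_trans (ha _) aJ.
apply: eq_bigr => e ae; rewrite /mobius_coef mulr_suml.
apply: eq_big => [J|J /andP[aJ /eqP <-]].
  apply/andP/eqP => [[aJ /eqP <-]|->].
    by rewrite inordK // ltnS (leq_trans (ha _) aJ).
  by rewrite ae inord_val.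
by rewrite inordK // ltnS (leq_trans (ha _) aJ).
Qed.

Lemma mobius_coefE N e : (e <= N)%N ->
  mobius_coef N e = if e is e'.+1 then if e' == 0%N then - #|F|%:R else 0 else 1.
Proof.
have H n : (n <= N)%N ->
    \sum_(e < n.+1) mobius_coef N e * #|F|%:R ^+ (n - e) = (n == 0)%N%:R.
  move=> nN; rewrite -(mobius_sum nN).
  by rewrite (sum_irrsdeg N n (a := id) (fun e => #|F|%:R ^+ (n - e))) //;
     apply: eq_bigl => i; rewrite -ltnS ltn_ord.
have H0 : mobius_coef N 0 = 1.
  by have := H 0 (leq0n _); rewrite big_ord_recl big_ord0 /= mulr1 addr0.
case: e => [//|[|e]] eN.
  have := H 1%N eN; rewrite !big_ord_recl big_ord0 /= H0 mul1r expr1 mulr1 addr0.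
  by move=> /eqP; rewrite addrC addr_eq0 => /eqP.
(* From degree 2 on, the terms before the last sum to q times the relation one degree lower, which
   is 0; hence the last coefficient vanishes. *)
have := H _ eN; rewrite big_ord_recr /= subnn mulr1.
rewrite (eq_bigr (fun i : 'I_e.+2 => (mobius_coef N i * #|F|%:R ^+ (e.+1 - i)) * #|F|%:R)).
  by rewrite -mulr_suml H ?(ltnW eN) // mul0r add0r.
by move=> i _; rewrite -mulrA -exprSr subSn // -ltnS ltn_ord.
Qed.

Lemma sqf_sum1 n :
  sqf_sum (fun=> 1) n = #|F|%:R ^+ n - (if (1 < n)%N then #|F|%:R ^+ n.-1 else 0).
Proof.
rewrite (sqf_sumE (leqnn n)); last by move=> *; rewrite mulr1.
under eq_bigr => J _ do rewrite expr1n mulr1 /monic_sum big_const_seq count_predT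
  size_monics iter_addr_0 natrX.
rewrite (sum_irrsdeg n n (a := fun e => (2 * e)%N) (fun e => #|F|%:R ^+ (n - 2 * e)));
  last by move=> e; lia.
rewrite big_mkcond big_ord_recl /= mobius_coefE // muln0 subn0 mul1r; congr (_ + _).
case: n => [|n]; first by rewrite big_ord0 oppr0.
rewrite big_ord_recl /= mobius_coefE // big1 ?addr0; last first.
  by move=> i _; rewrite mobius_coefE ?ltnS //= mul0r; case: ifP.
have -> : bump 0 0 = 1%N by [].
by case: n => [|n] /=; rewrite ?oppr0 // muln1 mulNr -exprS !subSS subn0.
Qed.

End SquarefreeSums.

(** * Coprime square-free pairs *)

Section Modulus.
Variable R : realType.
Implicit Types z w : R[i].

(** The norm of [R[i]] takes its values in [R[i]]; this is the same number in [R], where the order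
    is total and real arithmetic applies. *)
Definition cmod z : R := complex.Re `|z|.

Lemma cmodE z : (cmod z)%:C = `|z|.
Proof. by rewrite /cmod RRe_real // normr_real. Qed.

Lemma cmod_ge0 z : 0 <= cmod z.
Proof. by rewrite -lecR cmodE; exact: normr_ge0. Qed.

Lemma cmodM z w : cmod (z * w) = cmod z * cmod w.
Proof. by apply: complexI; rewrite rmorphM /= !cmodE normrM. Qed.

Lemma cmodD z w : cmod (z + w) <= cmod z + cmod w.
Proof. by rewrite -lecR rmorphD /= !cmodE ler_normD. Qed.

Lemma cmodN z : cmod (- z) = cmod z.
Proof. by rewrite /cmod normrN. Qed.

Lemma cmodB z w : cmod (z - w) <= cmod z + cmod w.
Proof. by rewrite -[cmod w]cmodN cmodD. Qed.

Lemma cmodBC z w : cmod (z - w) = cmod (w - z).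
Proof. by rewrite -cmodN opprB. Qed.

Lemma cmod_real (x : R) : cmod x%:C = `|x|.
Proof.
by apply: complexI; rewrite cmodE normc_def /= expr0n /= addr0 sqrtr_sqr.
Qed.

Lemma cmod0 : cmod 0 = 0. Proof. by rewrite /cmod normr0. Qed.
Lemma cmod1 : cmod 1 = 1. Proof. by rewrite /cmod normr1. Qed.

Lemma cmod_eq0 z : (cmod z == 0) = (z == 0).
Proof. by rewrite -(inj_eq (@complexI R)) cmodE normr_eq0. Qed.

Lemma cmodX z n : cmod (z ^+ n) = cmod z ^+ n.
Proof. by apply: complexI; rewrite rmorphXn /= !cmodE normrX. Qed.

Lemma cmodV z : cmod z^-1 = (cmod z)^-1.
Proof. by apply: complexI; rewrite fmorphV /= !cmodE normfV. Qed.

Lemma cmod_prod (I : Type) (r : seq I) (P : pred I) (f : I -> R[i]) :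
  cmod (\prod_(i <- r | P i) f i) = \prod_(i <- r | P i) cmod (f i).
Proof. by elim/big_ind2: _ => [|z a w b <- <-|//]; rewrite ?cmod1 ?cmodM. Qed.

Lemma cmod_sum (I : Type) (r : seq I) (P : pred I) (f : I -> R[i]) :
  cmod (\sum_(i <- r | P i) f i) <= \sum_(i <- r | P i) cmod (f i).
Proof.
elim/big_ind2: _ => [|z a w b za wb|//]; first by rewrite cmod0.
by apply: le_trans (cmodD _ _) _; apply: lerD.
Qed.

Lemma cmod_conj z : cmod z^* = cmod z.
Proof. by apply: complexI; rewrite !cmodE normcJ. Qed.

Lemma natrC n : (n%:R : R)%:C = n%:R :> R[i].
Proof. by rewrite rmorph_nat. Qed.

Lemma realcM (x y : R) : (x * y)%:C = x%:C * y%:C :> R[i].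
Proof. exact: rmorphM. Qed.

Lemma realcD (x y : R) : (x + y)%:C = x%:C + y%:C :> R[i].
Proof. exact: rmorphD. Qed.

Lemma realcB (x y : R) : (x - y)%:C = x%:C - y%:C :> R[i].
Proof. exact: rmorphB. Qed.

Lemma realcX (x : R) n : (x ^+ n)%:C = x%:C ^+ n :> R[i].
Proof. exact: rmorphXn. Qed.

End Modulus.

#[local] Hint Extern 0 (is_true (0 <= cmod _)) => apply: cmod_ge0 : core.

Lemma finset_ind (I : finType) (P : {set I} -> Prop) :
  P finset.set0 -> (forall i (J : {set I}), i \notin J -> P J -> P (i |: J)) -> forall J, P J.
Proof.
move=> P0 PS J; have [m] := ubnP #|J|; elim: m J => // m IH J; rewrite ltnS => Jm.
have [->//|[i iJ]] := finset.set_0Vmem J.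
rewrite -(finset.setD1K iJ); apply: PS; first by rewrite !inE eqxx.
by apply: IH; move: Jm; rewrite (cardsD1 i) iJ.
Qed.

(** * Asymptotics of square-free and coprime sums, uniformly in q *)

Section AnalyticBounds.
Variables (R : realType) (F : finFieldType).
Local Notation q := (#|F|%:R : R).
Hypothesis q4 : 4 <= q.
Implicit Types (chi psi : {poly F} -> R[i]).

Definition bounded_character chi :=
  {morph chi : x y / x * y} /\ forall p, cmod (chi p) <= 1.

Let q1 : 1 < q. Proof. by apply: lt_le_trans q4; rewrite ltr1n. Qed.
Let q0 : 0 < q. Proof. exact: lt_trans ltr01 q1. Qed.

Let qX0 n : 0 <= q ^+ n.
Proof. by rewrite exprn_ge0 // ltW. Qed.

Let qX1 d : (0 < d)%N -> 1 < q ^+ d.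
Proof. by move=> d0; rewrite exprn_egt1 // -lt0n. Qed.

(** With z = chi(p) / q^(deg p) this is z / (1 + z): the limiting chi-weighted proportion of
    multiples of p among square-free polynomials. *)
Definition local_density chi N (i : irr F N) : R[i] :=
  chi (irrp i) / ((q ^+ irrdeg i)%:C + chi (irrp i)).

Lemma local_density_den chi N (i : irr F N) : bounded_character chi ->
  q ^+ irrdeg i - 1 <= cmod ((q ^+ irrdeg i)%:C + chi (irrp i)).
Proof.
move=> [_ chi1]; have := cmodB ((q ^+ irrdeg i)%:C + chi (irrp i)) (chi (irrp i)).
rewrite addrK cmod_real ger0_norm // => H.
by rewrite lerBlDr (le_trans H) // lerD2l.
Qed.

(** This is the fixed-point equation that makes the main terms satisfy the recursion
    [sqf_mult_sum_rec] exactly, so that only errors propagate. *)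
Lemma local_density_eq chi N (i : irr F N) : bounded_character chi ->
  local_density chi i * (q ^+ irrdeg i)%:C = chi (irrp i) * (1 - local_density chi i).
Proof.
move=> hchi; have D := local_density_den i hchi.
have : (q ^+ irrdeg i)%:C + chi (irrp i) != 0.
  rewrite -cmod_eq0 gt_eqF // (lt_le_trans _ D) // subr_gt0.
  exact: qX1 (irrdeg_gt0 i).
by rewrite /local_density => D0; field.
Qed.

Lemma cmod_local_density chi N (i : irr F N) : bounded_character chi ->
  cmod (local_density chi i) <= (q ^+ irrdeg i - 1)^-1.
Proof.
move=> hchi; have D := local_density_den i hchi.
have p0 : 0 < q ^+ irrdeg i - 1 by rewrite subr_gt0 qX1 // irrdeg_gt0.
rewrite /local_density cmodM cmodV -[leRHS]mul1r ler_pM ?cmod_ge0 ?invr_ge0 ?cmod_ge0 //.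
  by case: hchi.
by rewrite lef_pV2 ?posrE //; apply: lt_le_trans p0 D.
Qed.

Lemma sqf_mult_sum_approx chi (kap : R[i]) (A y : R) :
  bounded_character chi -> 1 < y -> y <= q -> cmod kap <= A ->
  (forall n, cmod (sqf_sum chi n - kap * (q ^+ n)%:C) <= A * y ^+ n) ->
  forall N (J : {set irr F N}) n,
  cmod (sqf_mult_sum J chi n - kap * \prod_(i in J) local_density chi i * (q ^+ n)%:C)
    <= A * \prod_(i in J) (y ^+ irrdeg i - 1)^-1 * y ^+ n.
Proof.
move=> hchi y1 yq kA H N; elim/finset_ind => [|i J iJ IH] n.
  by rewrite sqf_mult_sum0 !finset.big_set0 !mulr1.
rewrite !finset.big_setU1 //=.
set T := \prod_(j in J) local_density chi j in IH *.
set Y := \prod_(j in J) (y ^+ irrdeg j - 1)^-1 in IH *.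
set t := local_density chi i; set d := irrdeg i.
have d0 : (0 < d)%N := irrdeg_gt0 i.
have yX1 e : (0 < e)%N -> 1 < y ^+ e by move=> e0; rewrite exprn_egt1 // -lt0n.
have y0 : 0 < y := lt_trans ltr01 y1.
have yd0 : 0 < y ^+ d - 1 by rewrite subr_gt0 yX1.
have Y0 : 0 <= Y.
  by apply: prodr_ge0 => j _; rewrite invr_ge0 subr_ge0 ltW // yX1 // irrdeg_gt0.
have A0 : 0 <= A := le_trans (cmod_ge0 _) kA.
have TY : cmod T <= Y.
  rewrite cmod_prod; apply: ler_prod => j _; rewrite cmod_ge0 /=.
  apply: le_trans (cmod_local_density j hchi) _.
  rewrite lef_pV2 ?posrE ?subr_gt0 ?qX1 ?yX1 ?irrdeg_gt0 // lerD2r.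
  by rewrite lerXn2r // nnegrE ltW.
have -> : A * ((y ^+ d - 1)^-1 * Y) = A * Y / (y ^+ d - 1) by ring.
have -> : kap * (t * T) = kap * T * t by ring.
have kTA : cmod (kap * T) <= A * Y by rewrite cmodM ler_pM // cmod_ge0.
have AY0 : 0 <= A * Y by rewrite mulr_ge0.
have [chiM chi1] := hchi.
elim/ltn_ind: n => n IHn.
(* For n < d the sum is empty, and the main term must itself fit in the error: q^n / (q^d - 1) <=
   y^n / (y^d - 1), because y <= q and n < d. *)
rewrite sqf_mult_sum_rec // -/d; case: leqP => dn; last first.
  rewrite sub0r cmodN cmodM (cmodM _ t) cmod_real ger0_norm //.
  rewrite -[leLHS]mulrA -[leRHS]mulrA.
  apply: ler_pM => //; first by rewrite mulr_ge0.
  have qd0 : 0 < q ^+ d - 1 by rewrite subr_gt0 qX1.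
  apply: le_trans (_ : (q ^+ d - 1)^-1 * q ^+ n <= _).
    by rewrite ler_wpM2r // cmod_local_density.
  rewrite mulrC ler_pdivrMr // [_^-1 * _]mulrC mulrAC ler_pdivlMr // !mulrBr !mulr1.
  have yqn : y ^+ n <= q ^+ n by rewrite lerXn2r // nnegrE ltW.
  have yqdn : y ^+ (d - n) <= q ^+ (d - n) by rewrite lerXn2r // nnegrE ltW.
  rewrite lerB // -(subnKC (ltnW dn)) !exprD mulrA [leRHS]mulrA [y ^+ n * q ^+ n]mulrC.
  by rewrite ler_wpM2l // mulr_ge0 // exprn_ge0 // ltW.
have -> : chi (irrp i) * (sqf_mult_sum J chi (n - d) - sqf_mult_sum (i |: J) chi (n - d))
    - kap * T * t * (q ^+ n)%:C =
    chi (irrp i) * ((sqf_mult_sum J chi (n - d) - kap * T * (q ^+ (n - d))%:C) -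
      (sqf_mult_sum (i |: J) chi (n - d) - kap * T * t * (q ^+ (n - d))%:C)).
  have -> : (q ^+ n)%:C = (q ^+ d)%:C * (q ^+ (n - d))%:C.
    by rewrite -rmorphM -exprD subnKC.
  have := local_density_eq i hchi; rewrite -/t -/d => te.
  have -> : kap * T * t * ((q ^+ d)%:C * (q ^+ (n - d))%:C) =
    kap * T * (t * (q ^+ d)%:C) * (q ^+ (n - d))%:C by ring.
  by rewrite te; ring.
rewrite cmodM -[leRHS]mul1r ler_pM ?cmod_ge0 //.
apply: le_trans (cmodB _ _) _.
apply: le_trans (_ : A * Y * y ^+ (n - d) + A * Y / (y ^+ d - 1) * y ^+ (n - d) <= _).
  apply: lerD; first exact: IH.
  by apply: IHn; rewrite ltn_subrL d0 (leq_trans d0 dn).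
have -> : y ^+ n = y ^+ d * y ^+ (n - d) by rewrite -exprD subnKC.
set W := y ^+ (n - d); set Z := y ^+ d in yd0 *.
(* The constant c = 1 / (y^d - 1) is the solution of 1 + c = c y^d. *)
rewrite le_eqVlt; apply/orP; left; apply/eqP; field.
by rewrite gt_eqF.
Qed.

(** The first two factors come from 1 / (q^n - 1) <= (4/3) q^(-n), valid for q >= 4, and 1 / (y^n -
    1) <= y0 / (y0 - 1) * y0^(-n) for y >= y0. The last one bounds the sum of y0^(-n) over n >=
    1. *)
Definition euler_const (y0 : R) := expR (4 / 3 * (y0 / (y0 - 1)) * (y0 - 1)^-1).

Lemma geometric_sum_le (x : R) N : 1 < x ->
  \sum_(1 <= n < N.+1) x^-1 ^+ n <= (x - 1)^-1.
Proof.
move=> x1; have x0 : 0 < x := lt_trans ltr01 x1.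
suff -> : \sum_(1 <= n < N.+1) x^-1 ^+ n = (1 - x^-1 ^+ N) / (x - 1).
  by rewrite ler_pdivrMr ?subr_gt0 // mulVf ?gt_eqF ?subr_gt0 // gerBl exprn_ge0 ?invr_ge0 ?ltW.
elim: N => [|N IH]; first by rewrite big_geq // expr0 subrr mul0r.
rewrite big_nat_recr //= IH exprS.
by field; rewrite !gt_eqF // subr_gt0.
Qed.

(** The q^n irreducibles of degree n consume the decay of the factor at [y2], so convergence rests
    on [y1] alone. Keeping [y0] fixed below [y1] makes the bound independent of q and [N]. *)
Lemma euler_product_le (y0 y1 y2 : R) N : 1 < y0 -> y0 <= y1 -> q <= y2 ->
  \prod_(i : irr F N) (1 + (y1 ^+ irrdeg i - 1)^-1 * (y2 ^+ irrdeg i - 1)^-1)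
    <= euler_const y0.
Proof.
move=> y01 y0y1 qy2.
set f : nat -> R := fun n => 4 / 3 * (y0 / (y0 - 1)) * (y0^-1 ^+ n * q^-1 ^+ n).
have y0_0 : 0 < y0 := lt_trans ltr01 y01.
have f0 n : 0 <= f n.
  have : 0 < y0 - 1 by rewrite subr_gt0.
  by move=> ?; rewrite /f !mulr_ge0 ?exprn_ge0 ?invr_ge0 ?divr_ge0 ?ltW.
have key (x y : R) n : (0 < n)%N -> 1 < x -> x <= y -> 
    (y ^+ n - 1)^-1 <= x / (x - 1) * x^-1 ^+ n.
  move=> n0 x1 xy; have x0 : 0 < x := lt_trans ltr01 x1.
  have yxn : x ^+ n <= y ^+ n by rewrite lerXn2r // nnegrE ltW // (lt_le_trans x0).
  have xn1 : 1 < x ^+ n by rewrite exprn_egt1 // -lt0n.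
  apply: le_trans (_ : (x ^+ n - 1)^-1 <= _).
    by rewrite lef_pV2 ?posrE ?subr_gt0 ?(lt_le_trans xn1) // lerD2r.
  have X0 : 0 < x ^+ n := lt_trans ltr01 xn1.
  have xx : x <= x ^+ n by rewrite -{1}(expr1 x) ler_eXn2l.
  rewrite -[leLHS]mul1r ler_pdivrMr ?subr_gt0 //.
  have -> : x / (x - 1) * x^-1 ^+ n * (x ^+ n - 1) = x * (x ^+ n - 1) / ((x - 1) * x ^+ n).
    by rewrite exprVn; field; rewrite !gt_eqF // subr_gt0.
  rewrite ler_pdivlMr ?mulr_gt0 ?subr_gt0 // mul1r.
  by move: xx; set X := x ^+ n; lra.
apply: le_trans (_ : \prod_(i : irr F N) expR (f (irrdeg i)) <= _).
  apply: ler_prod => i _; have d0 := irrdeg_gt0 i.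
  have yX1 y e : 1 < y -> (0 < e)%N -> 0 < y ^+ e - 1.
    by move=> y1_ e0; rewrite subr_gt0 exprn_egt1 // -lt0n.
  have P1 : 0 <= (y1 ^+ irrdeg i - 1)^-1.
    by rewrite invr_ge0 ltW // yX1 // (lt_le_trans y01).
  have P2 : 0 <= (y2 ^+ irrdeg i - 1)^-1.
    by rewrite invr_ge0 ltW // yX1 // (lt_le_trans q1).
  rewrite addr_ge0 ?mulr_ge0 //=; apply: le_trans (expR_ge1Dx _); rewrite lerD2l.
  have -> : f (irrdeg i) = (y0 / (y0 - 1) * y0^-1 ^+ irrdeg i) * (4 / 3 * q^-1 ^+ irrdeg i).
    by rewrite /f; ring.
  apply: ler_pM => //; first exact: key.
  apply: le_trans (key _ _ _ d0 q1 qy2) _.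
  have q43 : q / (q - 1) <= 4 / 3 by rewrite ler_pdivrMr ?subr_gt0 //; move: q4; set Q : R := q; lra.
  by apply: ler_pM; rewrite ?exprn_ge0 ?invr_ge0 ?divr_ge0 ?subr_ge0 // ltW.
have -> : \prod_(i : irr F N) expR (f (irrdeg i)) = expR (\sum_(i : irr F N) f (irrdeg i)).
  by elim/big_ind2: _ => [|a x b y -> ->|//]; rewrite ?expR0 ?expRD.
rewrite ler_expR; apply: (le_trans (@sum_irrdeg F R N f f0)).
have -> : \sum_(1 <= n < N.+1) #|F|%:R ^+ n * f n =
   4 / 3 * (y0 / (y0 - 1)) * \sum_(1 <= n < N.+1) y0^-1 ^+ n.
  rewrite mulr_sumr; apply: eq_bigr => n _; rewrite /f.
  by rewrite mulrCA [#|F|%:R ^+ n * _]mulrCA -exprMn divff ?gt_eqF // expr1n mulr1.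
have y0_1 : 0 < y0 - 1 by rewrite subr_gt0.
rewrite ler_wpM2l ?geometric_sum_le //.
by rewrite mulr_ge0 // divr_ge0 // ltW.
Qed.

Lemma euler_const_gt0 y0 : 0 < euler_const y0.
Proof. exact: expR_gt0. Qed.

Definition coprime_density chi psi N : R[i] :=
  \prod_(i : irr F N) (1 - local_density chi i * local_density psi i).

Lemma sqf_sum_le chi n : bounded_character chi -> cmod (sqf_sum chi n) <= q ^+ n.
Proof.
move=> [_ chi1]; apply: le_trans (cmod_sum _ _ _) _.
apply: le_trans (_ : \sum_(g <- monics F n | sqf g) 1 <= _).
  by apply: ler_sum => g _; apply: chi1.
rewrite big_mkcond /=; apply: le_trans (_ : \sum_(g <- monics F n) 1 <= _).
  by apply: ler_sum => g _; case: ifP => // _; rewrite ler01.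
by rewrite big_const_seq count_predT size_monics iter_addr_0 natrX.
Qed.

(** For each set [J] the two approximations are multiplied as w1 w2 - m1 m2 = (w1 - m1) w2 + m1 (w2
    - m2). The losses then sum over [J] to an Euler product bounded by [euler_const]. *)
Lemma coprime_sum_approx chi psi (kap1 kap2 : R[i]) (A1 A2 y0 y1 y2 : R) N d1 d2 :
  bounded_character chi -> bounded_character psi ->
  1 < y0 -> y0 <= y1 <= q -> y0 <= y2 <= q -> cmod kap1 <= A1 -> cmod kap2 <= A2 ->
  (forall n, cmod (sqf_sum chi n - kap1 * (q ^+ n)%:C) <= A1 * y1 ^+ n) ->
  (forall n, cmod (sqf_sum psi n - kap2 * (q ^+ n)%:C) <= A2 * y2 ^+ n) ->
  (d1 <= N)%N ->
  cmod (coprime_sum chi psi d1 d2 -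
        kap1 * kap2 * coprime_density chi psi N * (q ^+ (d1 + d2))%:C)
   <= euler_const y0 * (A1 * y1 ^+ d1 * q ^+ d2 + cmod kap1 * q ^+ d1 * (A2 * y2 ^+ d2)).
Proof.
move=> hchi hpsi y01 /andP[y0y1 y1q] /andP[y0y2 y2q] kA1 kA2 H1 H2 d1N.
have y1_1 := lt_le_trans y01 y0y1; have y2_1 := lt_le_trans y01 y0y2.
have E1 := sqf_mult_sum_approx hchi y1_1 y1q kA1 H1.
have E2 := sqf_mult_sum_approx hpsi y2_1 y2q kA2 H2.
(* The approximation with main term 0 and rate q is a plain upper bound, which starts from the
   trivial count. *)
have E3 (J : {set irr F N}) n : cmod (sqf_mult_sum J psi n) <=
    \prod_(i in J) (q ^+ irrdeg i - 1)^-1 * q ^+ n.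
  have := @sqf_mult_sum_approx psi 0 1 q hpsi q1 (lexx _) _ _ N J n.
  rewrite cmod0 !mul0r subr0 mul1r; apply => //.
  by move=> m; rewrite mul0r subr0 mul1r sqf_sum_le.
have TY chi' (J : {set irr F N}) : bounded_character chi' ->
    cmod (\prod_(i in J) local_density chi' i) <= \prod_(i in J) (q ^+ irrdeg i - 1)^-1.
  move=> h; rewrite cmod_prod; apply: ler_prod => j _.
  by rewrite cmod_ge0 cmod_local_density.
(* The product is expanded over the same sets [J], so that the difference can be estimated term by
   term. *)
have -> : coprime_density chi psi N = \sum_(J : {set irr F N}) (-1) ^+ #|J| *
    (\prod_(i in J) local_density chi i * \prod_(i in J) local_density psi i).
  rewrite /coprime_density; under eq_bigr do rewrite addrC.
  rewrite bigA_distr; apply: eq_bigr => J _.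
  rewrite -big_split /= -prodr_const -big_split /= [RHS]big_mkcond /=.
  by apply: eq_bigr => i _; case: ifP; rewrite // mulN1r.
rewrite (coprime_sumE _ _ _ d1N) mulr_sumr mulr_suml -sumrB.
apply: le_trans (cmod_sum _ _ _) _.
set a := A1 * y1 ^+ d1 * q ^+ d2; set b := cmod kap1 * q ^+ d1 * (A2 * y2 ^+ d2).
have A1_0 : 0 <= A1 := le_trans (cmod_ge0 _) kA1.
have A2_0 : 0 <= A2 := le_trans (cmod_ge0 _) kA2.
have y1_0 : 0 < y1 := lt_trans ltr01 y1_1.
have y2_0 : 0 < y2 := lt_trans ltr01 y2_1.
have a0 : 0 <= a by rewrite !mulr_ge0 ?exprn_ge0 // ltW.
have b0 : 0 <= b by rewrite !mulr_ge0 ?cmod_ge0 ?exprn_ge0 // ltW.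
pose U y (J : {set irr F N}) := \prod_(i in J) ((y ^+ irrdeg i - 1)^-1 * (q ^+ irrdeg i - 1)^-1).
have UE y : y0 <= y -> \sum_J U y J <= euler_const y0.
  move=> yy; have := euler_product_le N y01 yy (lexx q).
  under eq_bigr do rewrite addrC.
  rewrite bigA_distr; congr (_ <= _); apply: eq_bigr => J _.
  by rewrite [RHS]big_mkcond.
apply: le_trans (_ : \sum_(J : {set irr F N}) (U y1 J * a + U y2 J * b) <= _); last first.
  by rewrite big_split /= -!mulr_suml mulrDr lerD // ler_wpM2r // UE.
apply: ler_sum => J _.
set w1 := sqf_mult_sum J chi d1; set w2 := sqf_mult_sum J psi d2.
set t1 := \prod_(i in J) local_density chi i; set t2 := \prod_(i in J) local_density psi i.
have -> : (-1) ^+ #|J| * (w1 * w2) -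
    kap1 * kap2 * ((-1) ^+ #|J| * (t1 * t2)) * (q ^+ (d1 + d2))%:C =
    (-1) ^+ #|J| * ((w1 - kap1 * t1 * (q ^+ d1)%:C) * w2 +
      kap1 * t1 * (q ^+ d1)%:C * (w2 - kap2 * t2 * (q ^+ d2)%:C)).
  rewrite exprD rmorphM /=; set e := (-1) ^+ #|J|.
  by set u1 := (q ^+ d1)%:C; set u2 := (q ^+ d2)%:C; ring.
rewrite cmodM cmodX cmodN cmod1 expr1n mul1r.
apply: le_trans (cmodD _ _) _; rewrite !cmodM.
have Y0 y : 1 < y -> 0 <= \prod_(i in J) (y ^+ irrdeg i - 1)^-1.
  move=> y_1; apply: prodr_ge0 => j _; rewrite invr_ge0 subr_ge0 exprn_ege1 // ltW //.
apply: lerD.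
  apply: le_trans (ler_pM (cmod_ge0 _) (cmod_ge0 _) (E1 _ _ _) (E3 _ _)) _.
  rewrite /U big_split /a /=; set u1 := \prod_(i in J) _; set u2 := \prod_(i in J) _.
  set v1 := y1 ^+ d1; set v2 := q ^+ d2.
  by rewrite le_eqVlt; apply/orP; left; apply/eqP; ring.
rewrite cmod_real ger0_norm //.
apply: le_trans (ler_pM _ (cmod_ge0 _) (lexx _) (E2 _ _ _)) _.
  by rewrite !mulr_ge0 ?cmod_ge0 ?exprn_ge0 // ltW.
apply: le_trans (_ : cmod kap1 * (\prod_(i in J) (q ^+ irrdeg i - 1)^-1) * q ^+ d1 *
   (A2 * (\prod_(i in J) (y2 ^+ irrdeg i - 1)^-1) * y2 ^+ d2) <= _).
  rewrite ler_wpM2r //; first by rewrite !mulr_ge0 ?Y0 ?exprn_ge0 // ltW.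
  rewrite ler_wpM2r // ler_wpM2l ?cmod_ge0 //.
  exact: TY.
rewrite /U big_split /b /=; set u1 := \prod_(i in J) _; set u2 := \prod_(i in J) _.
set v1 := q ^+ d1; set v2 := y2 ^+ d2.
by rewrite le_eqVlt; apply/orP; left; apply/eqP; ring.
Qed.

End AnalyticBounds.

(** * Non-vanishing conditions *)

Section Indicators.
Variables (R : realType) (F : finFieldType).
Local Notation q := (#|F|%:R : R).
Hypothesis q4 : 4 <= q.

Implicit Types S : {set F}.

Let q1 : 1 < q. Proof. by apply: lt_le_trans q4; rewrite ltr1n. Qed.
Let q0 : 0 < q. Proof. exact: lt_trans ltr01 q1. Qed.
Let qX0 n : 0 <= q ^+ n.
Proof. by rewrite exprn_ge0 // ltW. Qed.

Definition nonvanishing (S : {set F}) (g : {poly F}) : R[i] :=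
  \prod_(a in S) (g.[a] != 0)%:R.

Lemma nonvanishing_bounded S : bounded_character (nonvanishing S).
Proof.
split=> [g h|g]; rewrite /nonvanishing.
  rewrite -big_split /=; apply: eq_bigr => a _.
  by rewrite hornerM mulf_eq0 negb_or -natrM mulnb.
rewrite cmod_prod; apply: prodr_ile1 => a _.
by case: (_ != _); rewrite ?cmod1 ?cmod0 ?lexx ?ler01.
Qed.

Lemma nonvanishing_setU1 S a g : a \notin S ->
  nonvanishing (a |: S) g = (g.[a] != 0)%:R * nonvanishing S g.
Proof. by move=> aS; rewrite /nonvanishing finset.big_setU1. Qed.

Lemma irrp_XsubC N a : (0 < N)%N -> exists i : irr F N, irrp i = 'X - a%:P.
Proof.
move=> N0; apply: irrp_full; rewrite ?monicXsubC ?size_XsubC //.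
exact: irredp_XsubC.
Qed.

Lemma nonvanishing_XsubC S a : a \notin S -> nonvanishing S ('X - a%:P) = 1.
Proof.
move=> aS; rewrite /nonvanishing big1 // => b bS.
rewrite hornerXsubC subr_eq0; case: eqP => // ba.
by rewrite -ba bS in aS.
Qed.

Lemma local_density_XsubC S N (i : irr F N) a : a \notin S -> irrp i = 'X - a%:P ->
  local_density (nonvanishing S) i = ((q + 1)^-1)%:C.
Proof.
move=> aS ia; rewrite /local_density ia nonvanishing_XsubC //.
by rewrite /irrdeg ia size_XsubC /= mul1r fmorphV rmorphD rmorph1.
Qed.

(** The first factor is 1 / zeta(2) for F[X]; each forbidden zero removes the Euler factor 1 + 1/q
    of a linear polynomial. *)
Definition sqf_density (S : {set F}) : R := (1 - q^-1) * (q / (q + 1)) ^+ #|S|.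

Lemma sqf_density_ge0 S : 0 <= sqf_density S.
Proof.
have r0 : 0 <= q / (q + 1) by rewrite divr_ge0 ?addr_ge0 ?(ltW q0).
have k0 : 0 <= 1 - q^-1 by rewrite subr_ge0 invf_le1 // ltW.
by rewrite /sqf_density mulr_ge0 ?exprn_ge0.
Qed.

Lemma sqf_density_le1 S : sqf_density S <= 1.
Proof.
have r0 : 0 <= q / (q + 1) by rewrite divr_ge0 ?addr_ge0 ?(ltW q0).
have r1 : q / (q + 1) <= 1 by rewrite ler_pdivrMr ?addr_gt0 // mul1r lerDl.
have k0 : 0 <= 1 - q^-1 by rewrite subr_ge0 invf_le1 // ltW.
have k1 : 1 - q^-1 <= 1 by rewrite gerBl invr_ge0 ltW.
by rewrite /sqf_density mulr_ile1 ?exprn_ge0 ?exprn_ile1.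
Qed.

(** Induction on [S]: forbidding the zero a subtracts the multiples of X - a, which multiplies the
    constant by 1 + 1 / (y - 1). For empty [S] the count is explicit and off by at most 1, only in
    degrees 0 and 1. *)
Lemma sqf_sum_nonvanishing S (y : R) : 1 < y -> y <= q -> forall n,
  cmod (sqf_sum (nonvanishing S) n - (sqf_density S)%:C * (q ^+ n)%:C)
    <= (y / (y - 1)) ^+ #|S| * y ^+ n.
Proof.
move=> y1 yq; have y0 : 0 < y := lt_trans ltr01 y1.
have y1' : 0 < y - 1 by rewrite subr_gt0.
have yy : 1 <= y / (y - 1) by rewrite ler_pdivlMr // mul1r gerBl.
elim/finset_ind: S => [|a S aS IH] n.
  rewrite /sqf_density finset.cards0 !expr0 mulr1 mul1r.
  have -> : sqf_sum (nonvanishing finset.set0) n = sqf_sum (fun _ : {poly F} => 1 : R[i]) n :> R[i].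
    by apply: eq_bigr => g _; rewrite /nonvanishing finset.big_set0.
  rewrite sqf_sum1 -natrC -!rmorphXn /= !natrX.
  have -> : (if (1 < n)%N then (q ^+ n.-1)%:C else 0) =
    (if (1 < n)%N then q ^+ n.-1 else 0)%:C by case: ifP.
  rewrite -rmorphM -!rmorphB /= cmod_real.
  have yn1 : 1 <= y ^+ n by rewrite exprn_ege1 // ltW.
  apply: le_trans yn1; case: n => [|[|n]] /=.
  - rewrite !expr0 subr0 mulr1 opprB addrC subrK ger0_norm ?invr_ge0 ?(ltW q0) //.
    by rewrite invf_le1 // ltW.
  - rewrite !expr1 subr0 mulrBl mul1r mulVf ?gt_eqF // opprB addrC subrK.
    by rewrite normr1.
  - rewrite mulrBl mul1r [q^-1 * _]mulrC [q ^+ n.+2]exprSr mulfK ?gt_eqF //.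
    by rewrite subrr normr0 ler01.
have [i ia] := @irrp_XsubC 1 a isT.
have := sqf_mult_sum_approx q4 (nonvanishing_bounded S) y1 yq _ IH (finset.set1 i) n.
rewrite !finset.big_set1 (local_density_XsubC aS ia).
have -> : irrdeg i = 1%N by rewrite /irrdeg ia size_XsubC.
rewrite expr1.
have kA : cmod (sqf_density S)%:C <= (y / (y - 1)) ^+ #|S|.
  rewrite cmod_real ger0_norm ?sqf_density_ge0 //.
  by apply: le_trans (sqf_density_le1 S) _; rewrite exprn_ege1.
move=> /(_ kA) H.
have -> : sqf_sum (nonvanishing (a |: S)) n =
   sqf_sum (nonvanishing S) n - sqf_mult_sum (finset.set1 i) (nonvanishing S) n.
  rewrite /sqf_sum /sqf_mult_sum big_mkcondr -sumrB /=.
  apply: eq_bigr => g _; rewrite nonvanishing_setU1 //.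
  have -> : [forall j in (finset.set1 i), irrp j %| g] = (g.[a] == 0).
    rewrite -[g.[a] == 0]/(root g a) root_factor_theorem -ia.
    apply/forall_inP/idP => [|ig j]; first by apply; rewrite finset.in_set1.
    by rewrite finset.in_set1 => /eqP ->.
  by case: eqP => _ /=; rewrite ?mul0r ?mul1r ?subrr ?subr0.
rewrite finset.cardsU1 aS /= add1n.
have q11 : q + 1 != 0 by rewrite gt_eqF // addr_gt0.
have -> : (sqf_density (a |: S))%:C =
   (sqf_density S)%:C - (sqf_density S)%:C * ((q + 1)^-1)%:C.
  rewrite -rmorphM -rmorphB /= /sqf_density finset.cardsU1 aS /= add1n exprS.
  by congr (_%:C); field; rewrite q11 gt_eqF.
set u := sqf_sum _ _ in IH *; set v := sqf_mult_sum _ _ _ in H *.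
set k := (sqf_density S)%:C in IH H *; set t := ((q + 1)^-1)%:C in H *.
set Q := (q ^+ n)%:C in IH H *.
have -> : u - v - (k - k * t) * Q = (u - k * Q) - (v - k * t * Q) by ring.
apply: le_trans (cmodB _ _) _; apply: le_trans (lerD (IH n) H) _.
rewrite -mulrDl ler_wpM2r ?exprn_ge0 ?(ltW y0) // exprS.
rewrite -{1}[X in X + _]mulr1 -mulrDr mulrC ler_wpM2r ?exprn_ge0 ?divr_ge0 ?(ltW y0) ?(ltW y1') //.
by rewrite le_eqVlt; apply/orP; left; apply/eqP; field; rewrite gt_eqF.
Qed.

Definition sqf_coprime_density N : R[i] :=
  ((sqf_density finset.set0) ^+ 2)%:C *
    coprime_density (nonvanishing finset.set0) (nonvanishing finset.set0) N.

(** A forbidden point contributes (q / (q+1))^2 from the two polynomials and turns the coprimality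
    factor 1 - 1 / (q+1)^2 at X - a into 1. The quotient is q / (q+2), the probability of a nonzero
    value in the random model. *)
Lemma nonvanishing_density S N : (0 < N)%N ->
  (sqf_density S)%:C * (sqf_density S)%:C *
     coprime_density (nonvanishing S) (nonvanishing S) N =
  ((q / (q + 2)) ^+ #|S|)%:C * sqf_coprime_density N.
Proof.
move=> N0; elim/finset_ind: S => [|a S aS IH].
  by rewrite finset.cards0 expr0 rmorph1 mul1r /sqf_coprime_density -rmorphM expr2.
have [i ia] := irrp_XsubC a N0.
rewrite finset.cardsU1 aS /= add1n exprS [X in _ = X * _]realcM -[RHS]mulrA -IH.
rewrite /coprime_density (bigD1 i) //= [in RHS](bigD1 i) //=.
have -> : local_density (nonvanishing (a |: S)) i = 0.
  by rewrite /local_density nonvanishing_setU1 // ia hornerXsubC subrr eqxx !mul0r.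
rewrite (local_density_XsubC aS ia) mul0r subr0 mul1r.
have -> : \prod_(j | j != i) (1 - local_density (nonvanishing (a |: S)) j *
    local_density (nonvanishing (a |: S)) j) =
  \prod_(j | j != i) (1 - local_density (nonvanishing S) j *
    local_density (nonvanishing S) j).
  apply: eq_bigr => j ji; rewrite /local_density nonvanishing_setU1 //.
  have -> : (irrp j).[a] == 0 = false; last by rewrite mul1r.
  rewrite -[_ == 0]/(root (irrp j) a) root_factor_theorem -ia.
  have ij : i != j by rewrite eq_sym.
  have := irrp_coprime ij.
  by rewrite (irreducible_poly_coprime _ (irrp_irreducible i)) => /negbTE.
set G := \prod_(j | j != i) _; rewrite !mulrA; congr (_ * G).
have E : 1 = 1%:C :> R[i] by [].
rewrite E -!realcM -!realcB -!realcM.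
congr (_%:C); rewrite /sqf_density finset.cardsU1 aS /= add1n exprS.
have q11 : q + 1 != 0 by rewrite gt_eqF // addr_gt0.
have q21 : q + 2 != 0 by rewrite gt_eqF // addr_gt0.
by field; rewrite q11 q21 gt_eqF.
Qed.

Lemma nonvanishing_count S N (y0 y : R) d1 d2 :
  1 < y0 -> y0 <= y -> y <= q -> (0 < N)%N -> (d1 <= N)%N ->
  cmod (coprime_sum (nonvanishing S) (nonvanishing S) d1 d2 -
        ((q / (q + 2)) ^+ #|S|)%:C * sqf_coprime_density N * (q ^+ (d1 + d2))%:C)
   <= euler_const y0 * (y0 / (y0 - 1)) ^+ #|S| * (y ^+ d1 * q ^+ d2 + q ^+ d1 * y ^+ d2).
Proof.
move=> y01 y0y yq N0 d1N.
have y0_0 : 0 < y0 := lt_trans ltr01 y01.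
have y1 := lt_le_trans y01 y0y; have y_0 := lt_trans ltr01 y1.
rewrite -nonvanishing_density //.
have H n : cmod (sqf_sum (nonvanishing S) n - (sqf_density S)%:C * (q ^+ n)%:C)
    <= (y0 / (y0 - 1)) ^+ #|S| * y ^+ n.
  apply: le_trans (sqf_sum_nonvanishing S y1 yq n) _.
  rewrite ler_wpM2r ?exprn_ge0 ?(ltW y_0) // lerXn2r ?nnegrE ?divr_ge0 ?subr_ge0 ?(ltW y_0) ?(ltW y1) ?(ltW y0_0) ?(ltW y01) //.
  rewrite ler_pdivrMr ?subr_gt0 // mulrAC ler_pdivlMr ?subr_gt0 //.
  by rewrite !mulrBr !mulr1 [y0 * y]mulrC lerB.
have k1 : cmod (sqf_density S)%:C <= 1.
  by rewrite cmod_real ger0_norm ?sqf_density_ge0 // sqf_density_le1.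
have kA : cmod (sqf_density S)%:C <= (y0 / (y0 - 1)) ^+ #|S|.
  apply: le_trans k1 _; rewrite exprn_ege1 //.
  by rewrite ler_pdivlMr ?subr_gt0 // mul1r gerBl.
have Y : y0 <= y <= q by rewrite y0y.
have hS := nonvanishing_bounded S.
apply: le_trans (coprime_sum_approx q4 _ hS hS y01 Y Y kA kA H H d1N) _.
rewrite -[leRHS]mulrA ler_wpM2l ?(ltW (euler_const_gt0 _)) //.
set A := (_ / _) ^+ _ in kA *; rewrite mulrDr [A * (y ^+ d1 * _)]mulrA lerD2l.
have A0 : 0 <= A := le_trans (cmod_ge0 _) kA.
rewrite [leRHS]mulrCA -[leLHS]mulrA -[leRHS]mul1r ler_wpM2r //.
by rewrite !mulr_ge0 // exprn_ge0 // ltW.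
Qed.

(** The constant is 9/16 - 1/3. Square-free polynomials make up at least 3/4 in each degree, and
    pairs with a common irreducible factor form at most the proportion of the sum of q^(-2 deg p),
    which is at most 1 / (q - 1) <= 1/3. No lower bound on the degrees is needed. *)
Lemma coprime_count_ge d1 d2 :
  11 / 48 * q ^+ (d1 + d2) <=
  complex.Re (coprime_sum (fun _ : {poly F} => 1 : R[i]) (fun _ => 1) d1 d2).
Proof.
pose s n : R := \sum_(g <- monics F n | sqf g) 1.
have sE n : s n = q ^+ n - (if (1 < n)%N then q ^+ n.-1 else 0) by exact: sqf_sum1.
have s34 n : 3 / 4 * q ^+ n <= s n.
  rewrite sE; case: n => [|[|n]] /=; rewrite ?expr0 ?subr0; [lra|by rewrite expr1; move: q0; set Q := q; lra|].
  rewrite [q ^+ n.+2]exprS; have := qX0 n.+1.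
  by move: q4; set Q := q; set P := Q ^+ n.+1; nra.
have sq n : s n <= q ^+ n.
  by rewrite sE gerBl; case: ifP.
have -> : coprime_sum (fun _ : {poly F} => 1 : R[i]) (fun _ => 1) d1 d2 =
    (\sum_(g <- monics F d1 | sqf g) \sum_(h <- monics F d2 | sqf h && coprimep g h) 1 : R)%:C.
  rewrite raddf_sum; apply: eq_bigr => g _; rewrite raddf_sum.
  by apply: eq_bigr => h _; rewrite mulr1.
rewrite /=.
pose m (i : irr F d1) n : R := \sum_(g <- monics F n | irrp i %| g) 1.
have mE i n : m i n = if (irrdeg i <= n)%N then q ^+ (n - irrdeg i) else 0.
  rewrite /m (big_monics_multiples _ _ (irrp_mem i)).
  by case: ifP => // _; rewrite big_const_seq count_predT size_monics iter_addr_0 natrX.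
apply: le_trans (_ : s d1 * s d2 - \sum_(i : irr F d1) m i d1 * m i d2 <= _).
  apply: le_trans (_ : 9 / 16 * q ^+ (d1 + d2) - 1 / 3 * q ^+ (d1 + d2) <= _).
    by have := qX0 (d1 + d2); set P := q ^+ _; lra.
  apply: lerB.
    rewrite exprD; have := ler_pM _ _ (s34 d1) (s34 d2).
    have -> : 9 / 16 * (q ^+ d1 * q ^+ d2) = 3 / 4 * q ^+ d1 * (3 / 4 * q ^+ d2) by field.
    by apply; rewrite mulr_ge0 // divr_ge0.
  apply: le_trans (_ : \sum_(i : irr F d1) q ^+ (d1 + d2) * (q^-1 ^+ (2 * irrdeg i)) <= _).
    apply: ler_sum => i _; rewrite !mE irrdeg_le; case: leqP => dd; last first.
      by rewrite mulr0 mulr_ge0 // exprn_ge0 // invr_ge0 ltW.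
    rewrite -exprD exprVn -expfB_cond ?gt_eqF //=; last by have := irrdeg_le i; lia.
    by rewrite le_eqVlt; apply/orP; left; apply/eqP; congr (_ ^+ _); have := irrdeg_le i; lia.
  rewrite -mulr_sumr mulrC ler_wpM2r //.
  have f0 n : 0 <= q^-1 ^+ (2 * n) by rewrite exprn_ge0 // invr_ge0 ltW.
  apply: (le_trans (@sum_irrdeg F R d1 _ f0)).
  apply: le_trans (_ : \sum_(1 <= n < d1.+1) q^-1 ^+ n <= _).
    apply: ler_sum => n _; rewrite mul2n -addnn exprD mulrA -exprMn divff ?gt_eqF //.
    by rewrite expr1n mul1r.
  apply: le_trans (geometric_sum_le _ q1) _.
  by rewrite -div1r ler_pM2l // lef_pV2 ?posrE ?subr_gt0 //; move: q4; set Q := q; lra.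
rewrite lerBlDr.
have -> : s d1 * s d2 = \sum_(g <- monics F d1 | sqf g) \sum_(h <- monics F d2 | sqf h) 1.
  rewrite /s big_distrlr /=.
  by apply: eq_bigr => g _; apply: eq_bigr => h _; rewrite mulr1.
have -> : \sum_(i : irr F d1) m i d1 * m i d2 = \sum_(g <- monics F d1) \sum_(h <- monics F d2)
    \sum_(i : irr F d1) (if (irrp i %| g) && (irrp i %| h) then 1 else 0).
  under [RHS]eq_bigr do rewrite exchange_big /=.
  rewrite [RHS]exchange_big /=; apply: eq_bigr => i _.
  rewrite /m [X in X * _]big_mkcond [X in _ * X]big_mkcond big_distrlr /=.
  apply: eq_bigr => g _; apply: eq_bigr => h _.
  by case: (irrp i %| g); case: (irrp i %| h); rewrite /= ?mulr1 ?mulr0 ?mul0r.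
rewrite big_mkcond [X in _ <= X + _]big_mkcond -big_split /=.
rewrite big_seq [leRHS]big_seq; apply: ler_sum => g /monicsP[gm sg].
have pos h : 0 <= \sum_(i : irr F d1) (if (irrp i %| g) && (irrp i %| h) then 1 else 0 : R).
  by apply: sumr_ge0 => i _; case: ifP.
case: ifP => _; last by rewrite add0r sumr_ge0.
rewrite big_mkcond [X in _ <= X + _]big_mkcond -big_split /=.
apply: ler_sum => h _; case: (sqf h) => /=; last by rewrite add0r.
case: ifP => cgh; first by rewrite lerDl.
rewrite add0r; move/negbT: cgh; rewrite (coprimep_irrp (N := d1)) ?monic_neq0 ?sg //.
case/forallPn => i; rewrite negbK => igh.
rewrite (bigD1 i) //= igh lerDl; apply: sumr_ge0 => j _; by case: ifP.
Qed.

End Indicators.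

(** * Character sums over square-free polynomials *)

Section LocalCharacters.
Variables (R : realType) (F : finFieldType).
Implicit Types phi : F -> R[i].

Definition local_character phi :=
  [/\ phi 1 = 1, {morph phi : x y / x * y} & forall x, x != 0 -> cmod (phi x) = 1].

Definition nontrivial_character phi :=
  [/\ local_character phi, phi 0 = 0 & exists2 x, x != 0 & phi x != 1].

Lemma nontrivial_sum0 phi : nontrivial_character phi -> \sum_z phi z = 0.
Proof.
move=> [[_ phiM _] _ [x x0 px1]].
have H : phi x * \sum_z phi z = \sum_z phi z.
  rewrite mulr_sumr [RHS](reindex_inj (mulfI x0)) /=.
  by apply: eq_bigr => z _; rewrite phiM.
apply/eqP; have : (phi x - 1) * \sum_z phi z = 0 by rewrite mulrBl mul1r H subrr.
by move/eqP; rewrite mulf_eq0 subr_eq0 (negbTE px1).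
Qed.

Lemma conj_local_character phi y : local_character phi -> y != 0 ->
  (phi y)^*%C = phi y^-1.
Proof.
move=> [phi1 phiM phic] y0.
have H : phi y * phi y^-1 = 1 by rewrite -phiM divff.
have py0 : phi y != 0 by rewrite -cmod_eq0 phic ?oner_eq0.
have : phi y * (phi y)^*%C = 1 by rewrite -sqr_normc -cmodE phic // expr1n.
by rewrite -H => /(mulfI py0).
Qed.

(** For w nonzero the substitution z = 1 + w / y turns the sum into that of phi over z different
    from 1, which is -1. *)
Lemma correlation_le phi w : nontrivial_character phi ->
  cmod (\sum_y phi (y + w) * (phi y)^*%C ) <= if w != 0 then 1 else #|F|%:R.
Proof.
move=> [hphi phi0 hx]; have [phi1 phiM phic] := hphi.
have phi_le x : cmod (phi x) <= 1.
  by case: (eqVneq x 0) => [->|/phic ->]; rewrite ?phi0 ?cmod0.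
case: (eqVneq w 0) => [->|w0] /=; rewrite ?eqxx ?w0 /=.
  apply: le_trans (cmod_sum _ _ _) _.
  apply: le_trans (_ : \sum_(y : F) 1 <= _); last by rewrite sumr_const.
  by apply: ler_sum => y _; rewrite cmodM cmod_conj mulr_ile1 ?cmod_ge0.
rewrite (bigD1 0) //= phi0 conjc0 mulr0 add0r.
have -> : \sum_(y | y != 0) phi (y + w) * (phi y)^*%C = \sum_(z | z != 1) phi z.
  rewrite [RHS](reindex_onto (fun y => 1 + w / y) (fun z => w / (z - 1))) /=.
    apply: eq_big => [y|y y0].
      have [->|y0] := eqVneq y 0; first by rewrite invr0 mulr0 addr0 eqxx.
      rewrite -subr_eq0 addrAC subrr add0r mulf_neq0 ?invr_neq0 //=.
      by apply/esym/eqP; field; rewrite y0 w0.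
    by rewrite (conj_local_character hphi y0) -phiM mulrDl divff.
  move=> z z1; field; by rewrite w0 subr_eq0 z1.
have := nontrivial_sum0 (And3 hphi phi0 hx).
rewrite (bigD1 1) //= phi1 => /eqP; rewrite addrC addr_eq0 => /eqP ->.
by rewrite cmodN cmod1.
Qed.

(** * Products of characters of the values at distinct points, summed over monic and square-free
    polynomials *)

Section PolynomialCharacters.
Local Notation q := (#|F|%:R : R).
Variables (m : nat) (x : 'I_m -> F) (phi : 'I_m -> F -> R[i]) (nt : pred 'I_m).
Hypothesis x_inj : injective x.
Hypothesis phi_loc : forall i, local_character (phi i).
Hypothesis phi_le : forall i z, cmod (phi i z) <= 1.
Hypothesis phi_nt : forall i, nt i -> nontrivial_character (phi i).

Definition poly_character (g : {poly F}) : R[i] := \prod_(i < m) phi i g.[x i].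

Lemma poly_character_bounded : bounded_character poly_character.
Proof.
split=> [g h|g]; rewrite /poly_character.
  rewrite -big_split /=; apply: eq_bigr => i _; rewrite hornerM.
  by have [_ ->] := phi_loc i.
by rewrite cmod_prod; apply: prodr_ile1 => i _; rewrite cmod_ge0 phi_le.
Qed.

Lemma monic_sum_translate (V : nmodType) l (r : {poly F}) (f : {poly F} -> V) : (size r <= l)%N ->
  \sum_(g <- monics F l) f (g + r) = \sum_(g <- monics F l) f g.
Proof.
move=> rl; rewrite -[LHS](big_map (fun g => g + r) predT f); apply: perm_big.
have H (s : {poly F}) g : (size s <= l)%N -> g \in monics F l -> g + s \in monics F l.
  move=> sl /monicsP[gm sg]; apply/monicsP.
  have ss : (size s < size g)%N by rewrite sg ltnS.
  by rewrite monicE lead_coefDl // -monicE gm size_polyDl.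
apply: uniq_perm; rewrite ?monics_uniq //.
  by rewrite map_inj_uniq ?monics_uniq //; apply: addIr.
move=> g; apply/mapP/idP => [[h hl ->]|gl]; first exact: H.
by exists (g - r); rewrite ?subrK // H // size_polyN.
Qed.

(** In degree at least m the values at the m points are independent. Translating by multiples of a
    polynomial of degree m - 1 that vanishes at the other points moves the value at x_i freely, and
    the full sum of a nontrivial character is 0. *)
Lemma monic_sum_large l : (m <= l)%N -> (exists i, nt i) -> monic_sum poly_character l = 0.
Proof.
move=> ml [i nti]; have nt_i := phi_nt nti.
pose t : {poly F} := \prod_(j < m | j != i) ('X - (x j)%:P).
have st : (size t <= l)%N.
  rewrite /t -big_filter size_prod_XsubC size_filter -sum1_count (sum1_card (predC1 i)) cardC1 card_ord.
  by have := ltn_ord i; lia.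
have ti : t.[x i] != 0.
  rewrite horner_prod; apply/prodf_neq0 => j ji.
  by rewrite hornerXsubC subr_eq0 inj_eq // eq_sym.
have tj j : j != i -> t.[x j] = 0.
  move=> ji; rewrite horner_prod; apply/eqP/prodf_eq0; exists j => //.
  by rewrite hornerXsubC subrr.
have q0 : (#|F|%:R : R[i]) != 0.
  by rewrite pnatr_eq0 -lt0n; apply/card_gt0P; exists 0.
(* The sum is replaced by q equal copies, one for each translation by z times [t]. *)
apply: (mulfI q0); rewrite mulr0 mulr_natl -sumr_const.
transitivity (\sum_(z : F) \sum_(g <- monics F l) poly_character (g + z *: t)).
  apply: eq_bigr => z _; rewrite monic_sum_translate //.
  exact: leq_trans (size_scale_leq _ _) st.
rewrite exchange_big big1 //= => g _.
rewrite (eq_bigr (fun z => phi i (g.[x i] + z * t.[x i]) *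
   \prod_(j < m | j != i) phi j g.[x j])); last first.
  move=> z _; rewrite /poly_character (bigD1 i) //= hornerD hornerZ; congr (_ * _).
  by apply: eq_bigr => j ji; rewrite hornerD hornerZ tj // mulr0 addr0.
rewrite -mulr_suml.
have -> : \sum_z phi i (g.[x i] + z * t.[x i]) = \sum_z phi i z; last first.
  by rewrite nontrivial_sum0 ?mul0r.
rewrite [RHS](reindex_inj (addrI g.[x i])) /=.
by rewrite [RHS](reindex_inj (mulIf ti)).
Qed.

(** Lagrange interpolation: evaluation at m distinct points is a bijection from polynomials of
    degree less than m onto all value vectors. Injectivity follows from the number of roots,
    surjectivity from equal cardinals. *)
Lemma sum_npoly_eval (K : comNzRingType) (f : 'I_m -> F -> K) :
  \sum_(g : {poly_m F}) \prod_(i < m) f i (polyn g).[x i] = \prod_(i < m) \sum_z f i z.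
Proof.
rewrite bigA_distr_bigA /=.
pose ev (g : {poly_m F}) : {ffun 'I_m -> F} := [ffun i => (polyn g).[x i]].
have ev_inj : injective ev.
  move=> g h gh; apply: val_inj => /=; apply/eqP; rewrite -subr_eq0.
  apply: contraT => gh0.
  have ur : uniq_roots [seq x i | i <- enum 'I_m].
    by rewrite uniq_rootsE map_inj_uniq // enum_uniq.
  have ar : all (root (polyn g - polyn h)) [seq x i | i <- enum 'I_m].
    apply/allP => _ /mapP[i _ ->]; rewrite /root hornerD hornerN subr_eq0.
    by apply/eqP; have := congr1 (fun u : {ffun _} => u i) gh; rewrite !ffunE.
  have := max_ring_poly_roots gh0 ar ur; rewrite size_map size_enum_ord ltnNge.
  by rewrite (leq_trans (size_polyD _ _)) // size_polyN geq_max !size_npoly.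
have ev_bij : bijective ev.
  by apply: inj_card_bij => //; rewrite card_npoly card_ffun card_ord.
rewrite [RHS](reindex ev) /=; last exact: onW_bij.
by apply: eq_bigr => g _; apply: eq_bigr => i _; rewrite ffunE.
Qed.

(** Such polynomials are the multiples of the product of X - x_i over [T]. When [T] has at least l
    elements the truncated exponent is 0, which matches the zero polynomial alone. *)
Lemma card_npoly_roots l (T : {set 'I_m}) :
  (#|[set w : {poly_l F} | [forall i in T, root (polyn w) (x i)]]%SET| <= #|F| ^ (l - #|T|))%N.
Proof.
set A := finset.finset _.
pose t : {poly F} := \prod_(i in T) ('X - (x i)%:P).
have st : size t = #|T|.+1 by rewrite /t -big_enum size_prod_XsubC -cardE.
have t0 : t != 0 by rewrite -size_poly_gt0 st.
have dv w : w \in A -> t %| polyn w.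
  rewrite inE => /forall_inP H; rewrite /t -big_enum /=.
  rewrite -(big_map x predT (fun a => 'X - a%:P)).
  apply: uniq_roots_dvdp.
    by apply/allP => _ /mapP[i + ->]; rewrite mem_enum; apply: H.
  by rewrite uniq_rootsE map_inj_uniq // enum_uniq.
rewrite -card_npoly.
pose Q (w : {poly_l F}) : {poly_(l - #|T|) F} := npolyp _ (polyn w %/ t).
have Qv w : w \in A -> polyn (Q w) = polyn w %/ t.
  move=> wA; rewrite /Q npolypK // size_divp // st /=.
  by rewrite leq_sub2r // size_npoly.
rewrite -(@card_in_imset _ _ Q A) ?max_card // => w1 w2 w1A w2A e.
apply: val_inj => /=; rewrite -(divpK (dv _ w1A)) -(divpK (dv _ w2A)).
by rewrite -!Qv // e.
Qed.

Lemma monic_sum_npoly (V : nmodType) l (f : {poly F} -> V) :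
  \sum_(g <- monics F l) f g = \sum_(w : {poly_l F}) f ('X^l + polyn w).
Proof. by rewrite big_map big_enum. Qed.

Lemma polynD n (g h : {poly_n F}) : polyn (g + h) = polyn g + polyn h.
Proof. by []. Qed.

Definition shift_correlation l (w : {poly_l F}) : R[i] :=
  \sum_(g : {poly_m F})
    poly_character (polyn g + polyn w) * (poly_character (polyn g))^*%C.

(** Interpolation splits the sum over shifts into one correlation per point. Only nontrivial
    characters with a nonzero shift gain over the trivial bound q. *)
Lemma cmod_shift_correlation l (w : {poly_l F}) : cmod (shift_correlation w) <=
  \prod_(i < m) (if nt i && ((polyn w).[x i] != 0) then 1 else q).
Proof.
have -> : shift_correlation w = \prod_(i < m) \sum_z phi i (z + (polyn w).[x i]) * (phi i z)^*%C.
  rewrite -sum_npoly_eval; apply: eq_bigr => g _.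
  rewrite /poly_character rmorph_prod -big_split /=.
  by apply: eq_bigr => i _; rewrite hornerD.
rewrite cmod_prod; apply: ler_prod => i _; rewrite cmod_ge0 /=.
case: (boolP (nt i)) => [/phi_nt/correlation_le|_]; first exact.
apply: le_trans (cmod_sum _ _ _) _.
apply: le_trans (_ : \sum_(y : F) 1 <= _); last by rewrite sumr_const.
by apply: ler_sum => y _; rewrite cmodM cmod_conj mulr_ile1 ?cmod_ge0.
Qed.

(* Averaging over all shifts g of degree < m turns the squared incomplete sum over w
   into complete correlation sums, which factor over the points x_i. *)
Lemma parseval_shift l : (l <= m)%N ->
  \sum_(g : {poly_m F}) (cmod (\sum_(w : {poly_l F}) poly_character (polyn g + polyn w)) ^+ 2)%:C
  = (q ^+ l)%:C * \sum_(w : {poly_l F}) shift_correlation w.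
Proof.
move=> lm.
have shift (v : {poly_l F}) (f : {poly F} -> R[i]) :
    \sum_(g : {poly_m F}) f (polyn g + polyn v) = \sum_(g : {poly_m F}) f (polyn g).
  rewrite [RHS](reindex_inj (addIr (npolyp m (polyn v)))) /=.
  by apply: eq_bigr => g _; rewrite npolypK // (leq_trans (size_npoly v)).
transitivity (\sum_(g : {poly_m F}) \sum_(v : {poly_l F}) \sum_(w : {poly_l F})
    poly_character (polyn g + polyn w) * (poly_character (polyn g + polyn v))^*%C).
  apply: eq_bigr => g _; rewrite realcX cmodE sqr_normc rmorph_sum mulr_sumr.
  by apply: eq_bigr => v _; rewrite mulr_suml.
rewrite exchange_big /=.
rewrite (eq_bigr (fun=> \sum_(w : {poly_l F}) shift_correlation w)); last first.
  move=> v _; rewrite exchange_big /= (reindex_inj (addIr v)) /=.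
  apply: eq_bigr => w _.
  rewrite -[RHS](shift v (fun p => poly_character (p + polyn w) * (poly_character p)^*%C)).
  by apply: eq_bigr => g _; rewrite ?polynD addrAC addrA.
by rewrite sumr_const card_npoly -natrX natrC mulr_natl.
Qed.

(** At a nontrivial point the weight is at most 1 + q [w(x_i) = 0]. Expanding over subsets T of
    these points, each T contributes q^|T| times at most q^(l - |T|), that is q to the maximum of l
    and |T|, and there are at most 2^m subsets. *)
Lemma sum_shift_weight l :
  \sum_(w : {poly_l F}) \prod_(i < m) (if nt i && ((polyn w).[x i] != 0) then 1 else q)
  <= 2 ^+ m * q ^+ (#|[predC nt]| + maxn l #|nt|).
Proof.
have q_ge1 : 1 <= q by rewrite ler1n; apply/card_gt0P; exists 0.
have q_ge0 : 0 <= q := le_trans ler01 q_ge1.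
pose r (w : {poly_l F}) i := root (polyn w) (x i).
pose NT : {set 'I_m} := finset.finset nt.
apply: le_trans (_ : \sum_(w : {poly_l F}) q ^+ #|[predC nt]| *
  \sum_(T : {set 'I_m} | T \subset NT) q ^+ #|T| * [forall i in T, r w i]%:R <= _).
  apply: ler_sum => w _.
  have -> : \sum_(T : {set 'I_m} | T \subset NT) q ^+ #|T| * [forall i in T, r w i]%:R =
      \prod_(i < m | nt i) (q * (r w i)%:R + 1).
    rewrite big_mkcond [RHS]big_mkcond /=.
    transitivity (\prod_(i < m) ((if nt i then q * (r w i)%:R else 0) + 1)); last first.
      by apply: eq_bigr => i _; case: (nt i); rewrite ?add0r.
    rewrite bigA_distr; apply: eq_bigr => T _.
    case: ifP => [/fintype.subsetP TN|/negbT/fintype.subsetPn[i iT iN]]; last first.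
      rewrite (bigD1 i) //= iT (_ : nt i = false) ?mul0r //.
      by move: iN; rewrite inE => /negbTE.
    rewrite natr_forall -prodr_const [X in X * _]big_mkcond -big_split /=.
    apply: eq_bigr => i _; case: ifP => iT /=; last by rewrite mul1r.
    by have := TN _ iT; rewrite inE => ->.
  rewrite (bigID nt) /= mulrC ler_pM //.
  - by apply: prodr_ge0 => i _; case: ifP.
  - by apply: prodr_ge0 => i _; case: ifP.
  - rewrite (eq_bigr (fun=> q)) ?prodr_const //.
    by move=> i /negbTE ->.
  apply: ler_prod => i nti; rewrite nti /=.
  rewrite -[_ == 0]/(r w i); case: (r w i) => /=.
    by rewrite q_ge0 mulr1 lerDl ler01.
  by rewrite mulr0 add0r ler01 lexx.
rewrite -mulr_sumr exprD mulrCA ler_wpM2l ?exprn_ge0 //.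
rewrite exchange_big /=.
apply: le_trans (_ : \sum_(T : {set 'I_m} | T \subset NT) q ^+ maxn l #|nt| <= _).
  apply: ler_sum => T TN; rewrite -mulr_sumr.
  have -> : \sum_(w : {poly_l F}) [forall i in T, r w i]%:R =
     #|[set w : {poly_l F} | [forall i in T, root (polyn w) (x i)]]%SET|%:R :> R.
    rewrite -sum1_card natr_sum [RHS]big_mkcond /=; apply: eq_bigr => w _; rewrite inE.
    by rewrite /r; case: [forall i in T, _].
  apply: le_trans (_ : q ^+ #|T| * q ^+ (l - #|T|) <= _).
    by rewrite ler_wpM2l ?exprn_ge0 // -natrX ler_nat card_npoly_roots.
  rewrite -exprD ler_weXn2l // -maxnE geq_max leq_maxl andbT.
  rewrite (leq_trans _ (leq_maxr _ _)) // -(cardsE nt).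
  exact: subset_leq_card.
rewrite sumr_const -[leLHS]mulr_natl ler_wpM2r ?exprn_ge0 // -natrX ler_nat.
apply: (@leq_trans #|{: {set 'I_m}}|); first exact: max_card.
by rewrite -cardsT -powersetT card_powerset finset.cardsT card_ord.
Qed.

(** On the left of [parseval_shift] only the q^l shifts X^l + v are kept. Each has degree l < m and
    reproduces the monic sum, so dividing by q^l gives the bound. *)
Lemma monic_sum_parseval l : (l < m)%N ->
  cmod (monic_sum poly_character l) ^+ 2 <= 2 ^+ m * q ^+ (#|[predC nt]| + maxn l #|nt|).
Proof.
move=> lm; apply: le_trans (sum_shift_weight l).
have q_gt0 : 0 < q by rewrite ltr0n; apply/card_gt0P; exists 0.
rewrite -(ler_pM2l (exprn_gt0 l q_gt0)).
apply: le_trans (_ : \sum_(g : {poly_m F})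
   cmod (\sum_(w : {poly_l F}) poly_character (polyn g + polyn w)) ^+ 2 <= _).
  pose e (v : {poly_l F}) : {poly_m F} := npolyp m ('X^l + polyn v).
  have ev v : polyn (e v) = 'X^l + polyn v.
    rewrite /e npolypK // (leq_trans (size_polyD _ _)) // geq_max size_polyXn lm.
    by rewrite (leq_trans (size_npoly v)) // ltnW.
  have e_inj : injective e.
    move=> v w vw; apply: val_inj.
    by have := congr1 (fun u => polyn u) vw; rewrite !ev => /addrI.
  rewrite (bigID (mem (codom e))) /= ler_wpDr ?sumr_ge0 // => [g _|].
    by rewrite exprn_ge0 ?cmod_ge0.
  have cu : uniq (codom e) by rewrite map_inj_uniq // enum_uniq.
  rewrite -(big_uniq _ cu) big_image /=.
  rewrite (eq_bigr (fun=> cmod (monic_sum poly_character l) ^+ 2)); last first.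
    move=> v _; congr (cmod _ ^+ 2); rewrite ev /monic_sum monic_sum_npoly.
    rewrite [RHS](reindex_inj (addIr v)) /=.
    by apply: eq_bigr => w _; rewrite ?polynD -addrA [polyn v + _]addrC.
  by rewrite sumr_const card_npoly -natrX mulr_natl.
rewrite -lecR.
apply: le_trans (_ : `| (q ^+ l)%:C * \sum_(w : {poly_l F}) shift_correlation w| <= _).
  rewrite -parseval_shift ?(ltnW lm) //.
  pose f (g : {poly_m F}) :=
    cmod (\sum_(w : {poly_l F}) poly_character (polyn g + polyn w)) ^+ 2.
  rewrite -[\sum_g _ ^+ 2]/(\sum_g f g) -[\sum_g (_)%:C]/(\sum_g (f g)%:C).
  have -> : \sum_g (f g)%:C = (\sum_g f g)%:C by rewrite raddf_sum.
  by rewrite -cmodE cmod_real lecR ler_norm.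
rewrite -cmodE lecR cmodM cmod_real ger0_norm ?exprn_ge0 ?(ltW q_gt0) //.
rewrite ler_wpM2l ?exprn_ge0 ?(ltW q_gt0) //.
apply: le_trans (cmod_sum _ _ _) _; apply: ler_sum => w _.
exact: cmod_shift_correlation.
Qed.

(** Here [J] will be the total length of the two tuples, [h] the square root and [k] the fourth root
    of q. Trivial points weigh 2 in [J_size] because a marked point with congruent counts occurs at
    least twice in the tuples. *)
Variables (J : nat) (h k : R).
Hypotheses (h0 : 0 <= h) (k0 : 0 <= k) (hq : h ^+ 2 = q) (kh : k ^+ 2 = h).
Hypothesis J_size : (2 * #|[predC nt]| + #|nt| <= J)%N.

(** Square-root cancellation holds up to the loss [k ^+ J], that is q^(J/4), which is exactly what
    the trivial bound costs in short degrees. *)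
Lemma monic_sum_le l : (l < m)%N ->
  cmod (monic_sum poly_character l) <= 2 ^+ J * k ^+ J * h ^+ l.
Proof.
move=> lm.
have q_ge1 : 1 <= q by rewrite ler1n; apply/card_gt0P; exists 0.
have h1 : 1 <= h by rewrite -(ler_pXn2r (n := 2)) ?nnegrE ?expr1n ?hq.
have k1 : 1 <= k by rewrite -(ler_pXn2r (n := 2)) ?nnegrE ?expr1n ?kh.
have mJ : (#|[predC nt]| + #|nt| = m)%N.
  by rewrite addnC cardC card_ord.
have B0 : 0 <= 2 ^+ J * k ^+ J * h ^+ l by rewrite !mulr_ge0 ?exprn_ge0.
(* For 2 l <= J the trivial bound q^l = h^l k^(2l) already suffices; beyond that, the Parseval
   estimate is used. *)
have [lJ|lJ] := leqP (2 * l) J.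
  apply: le_trans (_ : q ^+ l <= _).
    apply: le_trans (cmod_sum _ _ _) _.
    apply: le_trans (_ : \sum_(g <- monics F l) 1 <= _).
      by apply: ler_sum => g _; case: poly_character_bounded.
    by rewrite big_const_seq count_predT size_monics iter_addr_0 natrX.
  rewrite -hq -exprM mulnC -{1}kh -exprM.
  apply: le_trans (_ : k ^+ J * h ^+ l <= _); last first.
    by rewrite ler_wpM2r ?exprn_ge0 // ler_peMl ?exprn_ege1 ?exprn_ge0 // ler1n.
  rewrite -kh -exprM -exprD ler_weXn2l //; lia.
rewrite -(ler_pXn2r (n := 2)) ?nnegrE ?cmod_ge0 //.
apply: le_trans (monic_sum_parseval lm) _.
have -> : (2 ^+ J * k ^+ J * h ^+ l) ^+ 2 = 2 ^+ (2 * J) * h ^+ (J + 2 * l).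
  rewrite !exprMn -!exprM exprD [(J * 2)%N]mulnC (exprM k 2 J) kh.
  by rewrite [(l * 2)%N]mulnC mulrA.
apply: ler_pM; rewrite ?exprn_ge0 //.
  by rewrite ler_weXn2l ?ler1n //; lia.
rewrite -hq -exprM ler_weXn2l //.
(* With a trivial and b nontrivial points the claim is 2a + 2 max(l, b) <= J + 2l. It follows from
   2a + b <= J, together with b <= J < 2l when b exceeds l. *)
move: lJ J_size mJ lm; move: #|[predC nt]| #|nt| => a b lJ Js mJ lm.
rewrite /maxn; case: ltnP => lb; lia.
Qed.

Lemma card_irrsdeg N e : (#|[set T : {set irr F N} | irrsdeg T == e]%SET| <= #|F| ^ e)%N.
Proof.
rewrite -size_monics cardE -(size_map (@irrprod F N)).
apply: uniq_leq_size.
  by rewrite map_inj_uniq ?enum_uniq //; apply: irrprod_inj.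
by move=> _ /mapP[T + ->]; rewrite mem_enum inE => /eqP <-; exact: irrprod_mem.
Qed.

(** In the sum over square divisors, the at most q^e divisors d of degree e each leave a monic sum
    of size h^(n - 2e), so every e contributes the same amount h^n. Monic sums of degree at least m
    vanish, which leaves at most m <= J values of e. *)
Lemma sqf_sum_nontrivial n : (exists i, nt i) ->
  cmod (sqf_sum poly_character n) <= J%:R * 2 ^+ J * k ^+ J * h ^+ n.
Proof.
move=> hnt.
have [chiM chi1] := poly_character_bounded.
have B0 l : 0 <= 2 ^+ J * k ^+ J * h ^+ l by rewrite !mulr_ge0 ?exprn_ge0.
rewrite (sqf_sumE (leqnn n) chiM).
apply: le_trans (cmod_sum _ _ _) _.
apply: le_trans (_ : \sum_(T : {set irr F n} | (2 * irrsdeg T <= n)%N)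
    (if (n - 2 * irrsdeg T < m)%N then 2 ^+ J * k ^+ J * h ^+ (n - 2 * irrsdeg T) else 0) <= _).
  apply: ler_sum => T _; rewrite !cmodM cmodX cmodN cmod1 expr1n mul1r.
  case: ltnP => lm; last first.
    by rewrite monic_sum_large // cmod0 mulr0.
  rewrite -[leRHS]mul1r ler_pM ?cmod_ge0 ?monic_sum_le //.
    by rewrite mulr_ge0 ?cmod_ge0.
  by rewrite mulr_ile1 ?cmod_ge0.
rewrite (partition_big (fun T : {set irr F n} => inord (irrsdeg T) : 'I_n.+1)
   (fun e : 'I_n.+1 => (2 * e <= n)%N)) /=; last first.
  by move=> T aT; rewrite inordK // ltnS; lia.
apply: le_trans (_ : \sum_(e < n.+1 | (2 * e <= n)%N)
   (if (n - 2 * e < m)%N then 2 ^+ J * k ^+ J * h ^+ n else 0) <= _).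
  apply: ler_sum => e en.
  rewrite (eq_bigl (fun T : {set irr F n} => T \in [set T : {set irr F n} | irrsdeg T == e]%SET)); last first.
    move=> T; rewrite inE; apply/andP/eqP => [[aT /eqP <-]|->].
      by rewrite inordK // ltnS; lia.
    by rewrite en inord_val.
  rewrite (eq_bigr (fun=> if (n - 2 * e < m)%N then 2 ^+ J * k ^+ J * h ^+ (n - 2 * e) else 0));
    last by move=> T; rewrite inE => /eqP ->.
  rewrite sumr_const; case: ifP => _; last by rewrite mul0rn.
  rewrite -[leLHS]mulr_natl.
  apply: le_trans (_ : q ^+ e * (2 ^+ J * k ^+ J * h ^+ (n - 2 * e)) <= _).
    by rewrite ler_wpM2r // -natrX ler_nat card_irrsdeg.
  by rewrite mulrCA -hq -exprM -exprD subnKC.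
rewrite -big_mkcondr /= sumr_const -[leLHS]mulr_natl -!mulrA ler_wpM2r ?mulrA //.
rewrite ler_nat; apply: leq_trans (_ : m <= J)%N; last first.
  by have : (#|nt| + #|[predC nt]| = m)%N by [rewrite cardC card_ord]; lia.
(* The surviving e are counted through the distinct numbers n - 2e, all less than m. *)
rewrite cardE -(size_map (fun e : 'I_n.+1 => (n - 2 * e)%N)) -[X in (_ <= X)%N](size_iota 0).
apply: uniq_leq_size.
  rewrite map_inj_in_uniq ?enum_uniq // => e1 e2.
  rewrite !mem_enum !unfold_in => /andP[l1 _] /andP[l2 _] ?.
  by apply: val_inj => /=; lia.
by move=> _ /mapP[e + ->]; rewrite mem_enum unfold_in mem_iota => /andP[].
Qed.

End PolynomialCharacters.
End LocalCharacters.

(** * Function fields and curve isomorphisms *)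

Section Homogenization.
Variable F : finFieldType.
Implicit Types p r u v : {poly F}.

Definition emb p : ratfun F := FracField.tofrac p.

Lemma emb_is_zmod_morphism : zmod_morphism emb.
Proof. exact: tofracB. Qed.
Lemma emb_is_monoid_morphism : monoid_morphism emb.
Proof. by split; [exact: tofrac1 | exact: tofracM]. Qed.
HB.instance Definition _ := GRing.isZmodMorphism.Build {poly F} (ratfun F) emb
  emb_is_zmod_morphism.
HB.instance Definition _ := GRing.isMonoidMorphism.Build {poly F} (ratfun F) emb
  emb_is_monoid_morphism.

Lemma emb_inj : injective emb.
Proof. by move=> p r /eqP; rewrite /emb tofrac_eq => /eqP. Qed.

Lemma emb_eq0 p : (emb p == 0) = (p == 0).
Proof. exact: tofrac_eq0. Qed.

Lemma ratCE c : ratC c = emb c%:P.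
Proof. by []. Qed.

(** This is v^n p(u / v): the binary form of degree n attached to p, evaluated at (u, v). *)
Definition hom u v n p : {poly F} := \sum_(i < n.+1) p`_i *: (u ^+ i * v ^+ (n - i)).

Lemma ratC_is_zmod_morphism : zmod_morphism (@ratC F).
Proof. by move=> x y; rewrite !ratCE polyCB rmorphB. Qed.
Lemma ratC_is_monoid_morphism : monoid_morphism (@ratC F).
Proof. by split=> [|x y]; rewrite !ratCE ?polyC1 ?rmorph1 // polyCM rmorphM. Qed.
HB.instance Definition _ := GRing.isZmodMorphism.Build F (ratfun F) (@ratC F)
  ratC_is_zmod_morphism.
HB.instance Definition _ := GRing.isMonoidMorphism.Build F (ratfun F) (@ratC F)
  ratC_is_monoid_morphism.

Definition ev (t : ratfun F) p : ratfun F := (map_poly (@ratC F) p).[t].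

Lemma evD t p r : ev t (p + r) = ev t p + ev t r.
Proof. by rewrite /ev rmorphD hornerD. Qed.
Lemma evB t p r : ev t (p - r) = ev t p - ev t r.
Proof. by rewrite /ev rmorphB hornerD hornerN. Qed.
Lemma evM t p r : ev t (p * r) = ev t p * ev t r.
Proof. by rewrite /ev rmorphM hornerM. Qed.
Lemma evC t c : ev t c%:P = ratC c.
Proof. by rewrite /ev map_polyC hornerC. Qed.
Lemma evX t : ev t 'X = t.
Proof. by rewrite /ev map_polyX hornerX. Qed.
Lemma evE t p n : (size p <= n)%N -> ev t p = \sum_(i < n) ratC p`_i * t ^+ i.
Proof.
move=> sp; rewrite /ev (@horner_coef_wide _ n); last by rewrite size_map_poly.
by apply: eq_bigr => i _; rewrite coef_map.
Qed.
Lemma ev0 t : ev t 0 = 0. Proof. by rewrite /ev rmorph0 horner0. Qed.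
Lemma ev1 t : ev t 1 = 1. Proof. by rewrite /ev rmorph1 hornerC. Qed.
Lemma emb_scale (c : F) p : emb (c *: p) = ratC c * emb p.
Proof. by rewrite -mul_polyC rmorphM. Qed.

Lemma emb_hom u v n p : v != 0 -> (size p <= n.+1)%N ->
  emb (hom u v n p) = emb v ^+ n * ev (emb u / emb v) p.
Proof.
move=> v0 sp; rewrite (evE _ sp) mulr_sumr /hom rmorph_sum /=.
have tv0 : emb v != 0 by rewrite emb_eq0.
apply: eq_bigr => i _; rewrite emb_scale rmorphM !rmorphXn /= [RHS]mulrCA; congr (_ * _).
have ni : (i <= n)%N by rewrite -ltnS.
have -> : emb v ^+ n = emb v ^+ (n - i) * emb v ^+ i by rewrite -exprD subnK.
by rewrite exprMn exprVn [_ * (_ ^+ i)^-1]mulrC -[RHS]mulrA mulVKf ?expf_neq0 // mulrC.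
Qed.

Lemma homM u v m n p r : v != 0 -> (size p <= m.+1)%N -> (size r <= n.+1)%N ->
  hom u v (m + n) (p * r) = hom u v m p * hom u v n r.
Proof.
move=> v0 sp sr; apply: emb_inj.
have spr : (size (p * r)%R <= (m + n).+1)%N by rewrite (leq_trans (size_polyMleq _ _)) //; lia.
by rewrite rmorphM /= !emb_hom // evM exprD mulrACA.
Qed.

Lemma homX u v n p k : v != 0 -> (size p <= n.+1)%N ->
  hom u v (n * k) (p ^+ k) = hom u v n p ^+ k.
Proof.
move=> v0 sp; elim: k => [|k IH].
  by rewrite muln0 !expr0 /hom big_ord1 coef1 scale1r !expr0 mulr1.
rewrite mulnS !exprS homM ?IH //.
elim: k {IH} => [|k IH]; first by rewrite muln0 size_poly1.
rewrite exprS (leq_trans (size_polyMleq _ _)) // mulnS; lia.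
Qed.

Lemma hom1 u v n : hom u v n 1 = v ^+ n.
Proof.
rewrite /hom big_ord_recl coef1 scale1r expr0 mul1r subn0 big1 ?addr0 // => i _.
by rewrite coef1 scale0r.
Qed.

Lemma homZ u v n c p : hom u v n (c *: p) = c *: hom u v n p.
Proof. by rewrite /hom scaler_sumr; apply: eq_bigr => i _; rewrite coefZ scalerA. Qed.

Lemma homD u v n p r : hom u v n (p + r) = hom u v n p + hom u v n r.
Proof.
by rewrite /hom -big_split; apply: eq_bigr => i _; rewrite coefD scalerDl.
Qed.

Lemma size_hom u v e n p : (size u <= e.+1)%N -> (size v <= e.+1)%N ->
  (size (hom u v n p) <= (e * n).+1)%N.
Proof.
move=> su sv; rewrite /hom; apply: (leq_trans (size_sum _ _ _)).
apply/bigmax_leqP => i _; apply: (leq_trans (size_scale_leq _ _)).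
have pw (w : {poly F}) k : (size w <= e.+1)%N -> (size (w ^+ k)%R <= (e * k).+1)%N.
  move=> sw; apply: leq_trans (size_poly_exp_leq _ _) _.
  by rewrite ltnS leq_mul2r; apply/orP; right; lia.
apply: (leq_trans (size_polyMleq _ _)).
have ni : (i <= n)%N by rewrite -ltnS.
move: (pw u i su) (pw v (n - i)%N sv).
have : (e * n = e * i + e * (n - i))%N by rewrite -mulnDr subnKC.
lia.
Qed.

End Homogenization.

(** * Linear substitutions in binary forms, and stability of the families of models *)

Section Moebius.
Variable F : finFieldType.
Implicit Types p r u v : {poly F}.

Definition lin (a b : F) : {poly F} := a *: 'X + b%:P.

Lemma size_lin a b : (size (lin a b) <= 2)%N.
Proof.
rewrite /lin (leq_trans (size_polyD _ _)) // geq_max size_polyC.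
by rewrite (leq_trans (size_scale_leq _ _)) ?size_polyX //=; case: (_ == _).
Qed.

Lemma coef_lin a b i : (lin a b)`_i = if i == 0%N then b else if i == 1%N then a else 0.
Proof.
by rewrite /lin coefD coefZ coefX coefC; case: i => [|[|i]] /=;
  rewrite ?mulr0 ?mulr1 ?add0r ?addr0.
Qed.

Lemma lin_eq0 a b : (lin a b == 0) = (a == 0) && (b == 0).
Proof.
apply/eqP/andP => [H|[/eqP -> /eqP ->]]; last by rewrite /lin scale0r add0r.
by have := coef_lin a b 0; have := coef_lin a b 1; rewrite H !coef0 /= => <- <-.
Qed.

Lemma horner_lin a b x : (lin a b).[x] = a * x + b.
Proof. by rewrite /lin hornerD hornerZ hornerX hornerC. Qed.

Lemma hom_lin u v a b : hom u v 1 (lin a b) = a *: u + b *: v.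
Proof.
rewrite /hom !big_ord_recl big_ord0 !coef_lin /= !expr0 expr1 mul1r mulr1 addr0.
by rewrite addrC expr1.
Qed.

(** The adjugate matrix inverts the substitution up to the determinant, which appears to the power n
    because the form has degree n. *)
Lemma hom_lin_adj a b c d n p : a * d - b * c != 0 -> (size p <= n.+1)%N ->
  hom (lin d (- b)) (lin (- c) a) n (hom (lin a b) (lin c d) n p) =
  (a * d - b * c) ^+ n *: p.
Proof.
move=> D sp.
have v0 : lin (- c) a != 0.
  rewrite lin_eq0 oppr_eq0; apply: contraNN D => /andP[/eqP -> /eqP ->].
  by rewrite mul0r mulr0 subrr.
have hsum (I : Type) (s : seq I) (f : I -> {poly F}) u v :
    hom u v n (\sum_(i <- s) f i) = \sum_(i <- s) hom u v n (f i).
  elim/big_rec2: _ => [|i y z _ <-]; last by rewrite homD.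
  by rewrite /hom big1 // => i _; rewrite coef0 scale0r.
rewrite {2}/hom hsum.
rewrite (eq_bigr (fun i : 'I_n.+1 => (a * d - b * c) ^+ n *: (p`_i *: 'X^i))); last first.
  move=> i _; have ni : (i <= n)%N by rewrite -ltnS.
  rewrite homZ.
  have -> : hom (lin d (- b)) (lin (- c) a) n (lin a b ^+ i * lin c d ^+ (n - i)) =
     hom (lin d (- b)) (lin (- c) a) (1 * i + 1 * (n - i)) (lin a b ^+ i * lin c d ^+ (n - i)).
    by rewrite !mul1n subnKC.
  have sX e f k : (size (lin e f ^+ k)%R <= (1 * k).+1)%N.
    rewrite (leq_trans (size_poly_exp_leq _ _)) // ltnS leq_mul2r; apply/orP; right.
    by have := size_lin e f; lia.
  rewrite homM // !homX ?size_lin // !hom_lin.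
  have -> : a *: lin d (- b) + b *: lin (- c) a = (a * d - b * c) *: 'X.
    apply/polyP => k; rewrite coefD !coefZ !coef_lin coefX.
    by case: k => [|[|k]] /=; ring.
  have -> : c *: lin d (- b) + d *: lin (- c) a = (a * d - b * c)%:P.
    apply/polyP => k; rewrite coefD !coefZ !coef_lin coefC.
    by case: k => [|[|k]] /=; ring.
  rewrite exprZn -polyC_exp mulrC mul_polyC !scalerA; congr (_ *: _).
  by rewrite -mulrA -exprD subnK // mulrC.
by rewrite -scaler_sumr -poly_def; congr (_ *: _); apply/polyP => k;
  rewrite coef_poly; case: ltnP => // kn; rewrite nth_default // (leq_trans sp).
Qed.

Lemma hom_neq0 a b c d n p : a * d - b * c != 0 -> (size p <= n.+1)%N -> p != 0 ->
  hom (lin a b) (lin c d) n p != 0.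
Proof.
move=> D sp; apply: contraNN => /eqP H.
have := hom_lin_adj D sp; rewrite H.
have -> : hom (lin d (- b)) (lin (- c) a) n 0 = 0.
  by rewrite /hom big1 // => i _; rewrite coef0 scale0r.
by move/esym/eqP; rewrite scaler_eq0 expf_eq0 (negbTE D) andbF.
Qed.

Lemma sqf_neq0 p : sqf p -> p != 0.
Proof.
move=> /sqfP H; apply/eqP => p0; have := H 0; rewrite p0 dvdp0 size_poly0.
by move=> /(_ isT).
Qed.

Lemma sqf_dvd p r : r %| p -> sqf p -> sqf r.
Proof. by move=> rp /sqfP H; apply/sqfP => e er; apply: H; apply: dvdp_trans rp. Qed.

Lemma sqfZ (c : F) p : c != 0 -> sqf (c *: p) = sqf p.
Proof. by move=> c0; apply/sqfP/sqfP => H e; have := H e; rewrite dvdpZr. Qed.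

(** The two conditions say that the binary form of degree n is square-free, with at most a simple
    zero at infinity. A square factor after the substitution is carried back by the adjugate: it
    either gives a square factor of p or makes the degree of p drop by at least 2. *)
Lemma sqf_hom a b c d n p : a * d - b * c != 0 -> (n <= size p <= n.+1)%N -> sqf p ->
  sqf (hom (lin a b) (lin c d) n p) /\ (n <= size (hom (lin a b) (lin c d) n p))%N.
Proof.
move=> D /andP[np sp] sqp; have p0 := sqf_neq0 sqp.
set P := hom _ _ _ _; have P0 : P != 0 by apply: hom_neq0.
have D' : d * a - (- b) * (- c) != 0 by rewrite mulrNN mulrC.
have v0 : lin (- c) a != 0.
  rewrite lin_eq0 oppr_eq0; apply: contraNN D => /andP[/eqP -> /eqP ->].
  by rewrite mul0r mulr0 subrr.
have sP : (size P <= n.+1)%N.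
  by apply: leq_trans (size_hom _ _ (size_lin _ _) (size_lin _ _)) _; rewrite mul1n.
have key e (w r : {poly F}) : (0 < e)%N -> (size w <= e.+1)%N -> P = w ^+ 2 * r ->
    (2 * e <= n)%N -> (size r <= (n - 2 * e).+1)%N -> False.
  move=> e0 sw Pe en sr.
  have := hom_lin_adj D sp; rewrite -/P Pe.
  have -> : hom (lin d (- b)) (lin (- c) a) n (w ^+ 2 * r) =
      hom (lin d (- b)) (lin (- c) a) (e * 2 + (n - 2 * e)) (w ^+ 2 * r).
    by rewrite mulnC subnKC.
  have sw2 : (size (w ^+ 2)%R <= (e * 2).+1)%N.
    by rewrite (leq_trans (size_poly_exp_leq _ _)) // ltnS leq_mul2r; apply/orP; right; lia.
  rewrite homM // homX //.
  set W := hom _ _ e w; set Q := hom _ _ _ r => H.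
  have Dn : (a * d - b * c) ^+ n != 0 by rewrite expf_neq0.
  have dW : W ^+ 2 %| p by rewrite -(dvdpZr _ _ Dn) -H dvdp_mulr.
  have sW : size W = 1%N by apply: (sqfP _ sqp).
  have : size p = size (W ^+ 2 * Q) by rewrite H size_scale.
  have [Q0|Q0] := eqVneq Q 0; first by rewrite Q0 mulr0 size_poly0 => /eqP; rewrite size_poly_eq0 (negbTE p0).
  have W0 : W != 0 by rewrite -size_poly_gt0 sW.
  rewrite expr2 -mulrA size_mul ?mulf_neq0 // size_mul // sW.
  have : (size Q <= (n - 2 * e).+1)%N.
    by apply: leq_trans (size_hom _ _ (size_lin _ _) (size_lin _ _)) _; rewrite mul1n.
  move: np en e0; move: (size Q) (size p) => y z; clear; lia.
split.
  apply/sqfP => w /dvdpP[r Pr].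
  have [w0 r0] : w != 0 /\ r != 0.
    by move: P0; rewrite Pr mulf_eq0 expf_eq0 negb_or /= => /andP[].
  have sw0 : (0 < size w)%N by rewrite size_poly_gt0.
  have sr0 : (0 < size r)%N by rewrite size_poly_gt0.
  apply/eqP; apply: contraT => sw1; exfalso.
  have : size P = size (r * w ^+ 2) by rewrite Pr.
  rewrite expr2 size_mul ?mulf_neq0 // size_mul // => sPe.
  have [e0 en er] : [/\ (0 < (size w).-1)%N, (2 * (size w).-1 <= n)%N &
      (size r <= (n - 2 * (size w).-1).+1)%N].
    move: sPe sP sw0 sr0 sw1; move: (size w) (size r) (size P) => x y z; clear => *.
    by split; lia.
  by apply: (key _ w r e0 _ _ en er); [rewrite prednK|rewrite Pr mulrC].
(* A drop of the degree by 2 is a double zero at infinity: it is the square of the form of degree 1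
   represented by the constant 1. *)
rewrite leqNgt; apply/negP => sPn; have sP0 : (0 < size P)%N by rewrite size_poly_gt0.
have [en er] : (2 * 1 <= n)%N /\ (size P <= (n - 2 * 1).+1)%N.
  by move: sPn sP0; move: (size P) => x; clear => *; split; lia.
by apply: (key 1%N 1 P isT _ _ en er); rewrite ?size_poly1 ?expr1n ?mul1r.
Qed.

Lemma sqfM p r : coprimep p r -> sqf p -> sqf r -> sqf (p * r).
Proof.
move=> cpr sp sr; have p0 := sqf_neq0 sp; have r0 := sqf_neq0 sr.
set N := size (p * r)%R.
have spN : (size p <= N.+1)%N.
  by rewrite leqW // /N dvdp_leq ?mulf_neq0 // dvdp_mulr.
have srN : (size r <= N.+1)%N.
  by rewrite leqW // /N dvdp_leq ?mulf_neq0 // dvdp_mull.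
rewrite (sqf_irrp (N := N)) ?mulf_neq0 // ?leqW //.
move: sp sr; rewrite (sqf_irrp p0 spN) (sqf_irrp r0 srN) => /forallP sp /forallP sr.
apply/forallP => i; apply/negP => H.
have : irrp i %| p * r by apply: dvdp_trans H; rewrite expr2 dvdp_mulr.
rewrite irrp_dvdM => /orP[ip|ir].
  have ci : coprimep (irrp i ^+ 2) r.
    by rewrite coprimep_expl //; apply: coprimep_dvdr ip cpr.
  by move: H; rewrite (Gauss_dvdpl _ ci); apply/negP.
have ci : coprimep (irrp i ^+ 2) p.
  by rewrite coprimep_expl //; apply: coprimep_dvdr ir _; rewrite coprimep_sym.
by move: H; rewrite (Gauss_dvdpr _ ci); apply/negP.
Qed.

Lemma sqfM_coprime p r : sqf (p * r) -> coprimep p r.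
Proof.
move=> spr; rewrite coprimep_def; apply/eqP; apply: (sqfP _ spr).
by rewrite expr2 dvdp_mul ?dvdp_gcdl ?dvdp_gcdr.
Qed.

Lemma FhatP a b f : Fhat a b f <->
  exists A B : {poly F}, [/\ f = A * B ^+ 2, size A = a.+1, size B = b.+1 & sqf (A * B)].
Proof.
split=> [[al [f1 [f2 [-> al0 [m1 s1 z1] [m2 s2 z2] cop]]]]|[A [B [-> sA sB sAB]]]].
  exists (al *: f1), f2; rewrite scalerAl size_scale //; split => //.
  by rewrite -scalerAl sqfZ // sqfM //; apply/sqfP.
have := sqf_neq0 sAB; rewrite mulf_eq0 negb_or => /andP[A0 B0].
have lA : lead_coef A != 0 by rewrite lead_coef_eq0.
have lB : lead_coef B != 0 by rewrite lead_coef_eq0.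
exists (lead_coef A * lead_coef B ^+ 2), ((lead_coef A)^-1 *: A), ((lead_coef B)^-1 *: B).
split.
- rewrite exprZn -scalerAr -scalerAl !scalerA -{1}[A * _]scale1r; congr (_ *: _).
  by field; rewrite lA lB.
- by rewrite mulf_neq0 // expf_neq0.
- split; first by rewrite monicE lead_coefZ mulVf.
    by apply/sqfP; rewrite sqfZ ?invr_neq0 // (sqf_dvd _ sAB) // dvdp_mulr.
  by rewrite size_scale ?invr_neq0.
- split; first by rewrite monicE lead_coefZ mulVf.
    by apply/sqfP; rewrite sqfZ ?invr_neq0 // (sqf_dvd _ sAB) // dvdp_mull.
  by rewrite size_scale ?invr_neq0.
- by rewrite coprimepZl ?invr_neq0 // coprimepZr ?invr_neq0 // sqfM_coprime.
Qed.

(** The three families together are the products A B^2 of forms of degrees d1 and d2 such that A B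
    is square-free also at infinity. In this shape invariance under linear substitutions becomes
    visible. *)
Lemma Fhat_brP d1 d2 f : Fhat_br d1 d2 f <->
  exists A B : {poly F}, [/\ f = A * B ^+ 2, (size A <= d1.+1)%N, (size B <= d2.+1)%N,
    sqf (A * B) & (d1 + d2 <= size (A * B)%R)%N].
Proof.
have nz (A B : {poly F}) : sqf (A * B) -> 
    [/\ (0 < size A)%N, (0 < size B)%N & size (A * B)%R = (size A + size B).-1].
  move/sqf_neq0; rewrite mulf_eq0 negb_or => /andP[A0 B0].
  by rewrite !size_poly_gt0 size_mul.
split=> [[[]|]|[A [B [fe sA sB sAB sz]]]].
- move=> /FhatP[A [B [-> sA sB sAB]]]; exists A, B; have [_ _ ->] := nz _ _ sAB.
  by rewrite sA sB; split => //; lia.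
- move=> /= [d10 /FhatP[A [B [-> sA sB sAB]]]]; exists A, B; have [_ _ ->] := nz _ _ sAB.
  by rewrite sA sB; split => //; lia.
- move=> /= [d20 /FhatP[A [B [-> sA sB sAB]]]]; exists A, B; have [_ _ ->] := nz _ _ sAB.
  by rewrite sA sB; split => //; lia.
have [A0 B0 sABe] := nz _ _ sAB; move: sz; rewrite sABe => sz.
have [eA|nA] := eqVneq (size A) d1.+1; have [eB|nB] := eqVneq (size B) d2.+1.
- by left; left; apply/FhatP; exists A, B.
- by right; split; [lia|apply/FhatP; exists A, B; split => //; lia].
- by left; right; split; [lia|apply/FhatP; exists A, B; split => //; lia].
- by exfalso; move: nA nB sA sB; lia.
Qed.

Lemma Fhat_br_hom a b c d l d1 d2 f : a * d - b * c != 0 -> l != 0 ->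
  Fhat_br d1 d2 f -> Fhat_br d1 d2 (l *: hom (lin a b) (lin c d) (d1 + 2 * d2) f).
Proof.
move=> D l0 /Fhat_brP[A [B [-> sA sB sAB sz]]]; apply/Fhat_brP.
have v0 : lin c d != 0.
  by rewrite lin_eq0; apply: contraNN D => /andP[/eqP -> /eqP ->]; rewrite !mulr0 subrr.
set h := hom (lin a b) (lin c d).
have sB2 : (size (B ^+ 2)%R <= (d2 * 2).+1)%N.
  by rewrite (leq_trans (size_poly_exp_leq _ _)) // ltnS leq_mul2r; apply/orP; right; lia.
have hs n p : (size (h n p) <= n.+1)%N.
  by apply: leq_trans (size_hom _ _ (size_lin _ _) (size_lin _ _)) _; rewrite mul1n.
exists (l *: h d1 A), (h d2 B).
have e : h (d1 + 2 * d2)%N (A * B ^+ 2) = h d1 A * h d2 B ^+ 2.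
  by rewrite mulnC /h homM // homX.
have e2 : h (d1 + d2)%N (A * B) = h d1 A * h d2 B by rewrite /h homM.
have szAB : (d1 + d2 <= size (A * B)%R <= (d1 + d2).+1)%N.
  by rewrite sz (leq_trans (size_polyMleq _ _)) //; lia.
have [sq1 sq2] := sqf_hom D szAB sAB.
split; rewrite -?scalerAl.
- by rewrite -/h e.
- by rewrite size_scale.
- exact: hs.
- by rewrite sqfZ // -e2.
- by rewrite size_scale // -e2.
Qed.

End Moebius.

Lemma subf_div (K : fieldType) (a b c d : K) : b != 0 -> d != 0 ->
  a / b - c / d = (a * d - c * b) / (b * d).
Proof. by move=> b0 d0; field; rewrite b0 d0. Qed.

(** * Fractions, substitution of a transcendental element, and top coefficients of forms *)

Section RationalFunctions.
Variable F : finFieldType.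
Implicit Types (p r u v : {poly F}) (t z : ratfun F).

Lemma ratfun_frac z : exists p r, r != 0 /\ z = emb p / emb r.
Proof.
pose n := (fraction.frac (repr z)).1; pose d := (fraction.frac (repr z)).2.
have d0 : d != 0 := denom_ratioP (repr z).
have e0 : emb d != 0 by rewrite emb_eq0.
exists n, d; split=> //; apply: (mulIf e0); rewrite divfK // -{1}[z]reprK /emb.
rewrite /FracField.tofrac; unlock FracField.tofrac.
rewrite -[_ * _]/(FracField.mul _ _) -FracField.pi_mul; apply/eqmodP => /=.
rewrite FracField.equivfE /FracField.mulf !numden_Ratio ?mulf_neq0 ?oner_eq0 //.
by rewrite !mulr1 mulrC.
Qed.

Lemma ratfun_coprime_frac z : exists p r, [/\ r != 0, coprimep p r & z = emb p / emb r].
Proof.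
have [p [r [r0 ->]]] := ratfun_frac z.
have g0 : gcdp p r != 0 by rewrite gcdp_eq0 negb_and r0 orbT.
exists (p %/ gcdp p r), (r %/ gcdp p r).
have rg : r %/ gcdp p r != 0 by rewrite dvdp_div_eq0 ?dvdp_gcdr.
split=> //; first by rewrite coprimep_div_gcd // r0 orbT.
have eg : emb (gcdp p r) != 0 by rewrite emb_eq0.
have ep : emb p = emb (p %/ gcdp p r) * emb (gcdp p r).
  by rewrite -rmorphM divpK // dvdp_gcdl.
have er : emb r = emb (r %/ gcdp p r) * emb (gcdp p r).
  by rewrite -rmorphM divpK // dvdp_gcdr.
by rewrite ep er -mulf_div divff // mulr1.
Qed.

Lemma rmorph_emb (th : {rmorphism ratfun F -> ratfun F}) p :
  (forall c, th (ratC c) = ratC c) -> th (emb p) = ev (th (emb 'X)) p.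
Proof.
move=> thC; rewrite (evE _ (leqnn _)) -{1}(coefK p) poly_def !rmorph_sum /=.
apply: eq_bigr => i _; rewrite emb_scale !rmorphM /= thC.
by rewrite -rmorphXn -rmorphXn.
Qed.

Lemma rmorph_frac (th : {rmorphism ratfun F -> ratfun F}) p r :
  (forall c, th (ratC c) = ratC c) ->
  th (emb p / emb r) = ev (th (emb 'X)) p / ev (th (emb 'X)) r.
Proof.
move=> thC; rewrite -(rmorph_emb p thC) -(rmorph_emb r thC).
exact: (fmorph_div th (emb p) (emb r)).
Qed.

Section Substitution.
Variable t : ratfun F.
Hypothesis t_tr : forall r, r != 0 -> ev t r != 0.

(** A fraction is chosen for each element; [substE] shows that the value of the substitution does
    not depend on the choice. *)
Definition subst_num z := projT1 (cid (ratfun_frac z)).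
Definition subst_den z := projT1 (cid (projT2 (cid (ratfun_frac z)))).

Definition subst z : ratfun F := ev t (subst_num z) / ev t (subst_den z).

Lemma subst_numdenP z : subst_den z != 0 /\ z = emb (subst_num z) / emb (subst_den z).
Proof. exact: projT2 (cid (projT2 (cid (ratfun_frac z)))). Qed.

Lemma substE p r : r != 0 -> subst (emb p / emb r) = ev t p / ev t r.
Proof.
move=> r0; have [d0] := subst_numdenP (emb p / emb r); rewrite /subst.
set n := subst_num _; set d := subst_den _ in d0 *.
move/eqP; rewrite eqr_div ?emb_eq0 // -!rmorphM => /eqP /emb_inj e.
by apply/eqP; rewrite eqr_div ?t_tr // -!evM e.
Qed.

Lemma subst_emb p : subst (emb p) = ev t p.
Proof. by have := substE p (oner_neq0 _); rewrite rmorph1 ev1 !divr1. Qed.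

Lemma subst_is_zmod_morphism : zmod_morphism subst.
Proof.
move=> x y; have [p [r [r0 ->]]] := ratfun_frac x; have [p' [r' [r0' ->]]] := ratfun_frac y.
rewrite subf_div ?emb_eq0 // -!rmorphM -rmorphB !substE ?mulf_neq0 // evB !evM.
by rewrite subf_div ?t_tr.
Qed.

Lemma subst_is_monoid_morphism : monoid_morphism subst.
Proof.
split=> [|x y]; first by rewrite -(rmorph1 (@emb F)) subst_emb ev1.
have [p [r [r0 ->]]] := ratfun_frac x; have [p' [r' [r0' ->]]] := ratfun_frac y.
rewrite mulf_div -!rmorphM !substE ?mulf_neq0 // !evM.
by rewrite mulf_div.
Qed.

Definition subst_rmorphism : {rmorphism ratfun F -> ratfun F} :=
  HB.pack subst
    (GRing.isZmodMorphism.Build (ratfun F) (ratfun F) subst subst_is_zmod_morphism)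
    (GRing.isMonoidMorphism.Build (ratfun F) (ratfun F) subst subst_is_monoid_morphism).

Lemma subst_ratC c : subst (ratC c) = ratC c.
Proof. by rewrite ratCE subst_emb evC. Qed.

Lemma subst_X : subst (emb 'X) = t.
Proof. by rewrite subst_emb evX. Qed.

End Substitution.

Lemma rmorph_ratfun_eq (th th' : {rmorphism ratfun F -> ratfun F}) :
  (forall c, th (ratC c) = ratC c) -> (forall c, th' (ratC c) = ratC c) ->
  th (emb 'X) = th' (emb 'X) -> th =1 th'.
Proof.
move=> h h' e z; have [p [r [r0 ->]]] := ratfun_frac z.
rewrite (rmorph_frac p r h) (rmorph_frac p r h').
by rewrite e.
Qed.

Lemma coefM_top p r a b : (size p <= a.+1)%N -> (size r <= b.+1)%N ->
  (p * r)`_(a + b) = p`_a * r`_b.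
Proof.
move=> sp sr; have ab : (a < (a + b).+1)%N by rewrite ltnS leq_addr.
rewrite coefM (bigD1 (Ordinal ab)) //= addKn big1 ?addr0 // => i.
rewrite -val_eqE /= => ia; case: (ltngtP i a) ia => // ia _.
  by rewrite [r`__]nth_default ?mulr0 // (leq_trans sr) //; lia.
by rewrite nth_default ?mul0r // (leq_trans sp).
Qed.

Lemma coefX_top u n k : (size u <= n.+1)%N -> (u ^+ k)`_(n * k) = u`_n ^+ k.
Proof.
move=> su; elim: k => [|k IH]; first by rewrite muln0 coef1.
rewrite mulnS !exprS coefM_top ?IH //.
by rewrite (leq_trans (size_poly_exp_leq _ _)) // ltnS leq_mul2r; apply/orP; right; lia.
Qed.

Lemma coef_hom_top u v n m p : (size u <= n.+1)%N -> (size v <= n.+1)%N ->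
  (hom u v m p)`_(n * m) = \sum_(i < m.+1) p`_i * (u`_n ^+ i * v`_n ^+ (m - i)).
Proof.
move=> su sv; rewrite /hom coef_sum; apply: eq_bigr => i _.
have im : (i <= m)%N by rewrite -ltnS.
have sX (w : {poly F}) k : (size w <= n.+1)%N -> (size (w ^+ k)%R <= (n * k).+1)%N.
  move=> sw; rewrite (leq_trans (size_poly_exp_leq _ _)) // ltnS leq_mul2r.
  by apply/orP; right; lia.
have -> : (n * m = n * i + n * (m - i))%N by rewrite -mulnDr subnKC.
by rewrite coefZ coefM_top ?sX // !coefX_top.
Qed.

End RationalFunctions.

Lemma divf_scale (K : fieldType) (k a b : K) : k != 0 -> (k * a) / (k * b) = a / b.
Proof. by move=> k0; rewrite -mulf_div divff ?mul1r. Qed.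

(** * Automorphisms of F(X) over F are Moebius transformations *)

Section Automorphisms.
Variable F : finFieldType.
Implicit Types (p r u v : {poly F}) (t z : ratfun F).

Lemma irreducible_ndvd_exp (pi v : {poly F}) n : irreducible_poly pi ->
  pi %| v ^+ n -> pi %| v.
Proof.
move=> hpi H; apply: contraT; rewrite -(irreducible_poly_coprime _ hpi) => cop.
by have := coprimep_expr n cop; rewrite (irreducible_poly_coprime _ hpi) H.
Qed.

(** The last hypothesis excludes a common zero of the two forms at infinity. A common prime factor
    of the results must divide v, and then u through the term with the top coefficient, against the
    coprimality of u and v. *)
Lemma coprimep_hom u v m p r : v != 0 -> coprimep u v -> coprimep p r ->
  (size p <= m.+1)%N -> (size r <= m.+1)%N -> (p`_m != 0) || (r`_m != 0) ->
  coprimep (hom u v m p) (hom u v m r).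
Proof.
move=> v0 cuv cpr sp sr pr; apply: contraT => ncop.
have g1 : (gcdp (hom u v m p) (hom u v m r) == 0) || (1 < size (gcdp (hom u v m p) (hom u v m r)))%N.
  move: ncop; rewrite coprimep_def -size_poly_eq0; case: (size _) => [|[]] //.
have [pi [hpi pip pir]] : exists pi, [/\ irreducible_poly pi, pi %| hom u v m p & pi %| hom u v m r].
  case/orP: g1 => [|/poly_irr_factor[pi [_ hpi]]]; last first.
    by rewrite dvdp_gcd => /andP[? ?]; exists pi.
  rewrite gcdp_eq0 => /andP[/eqP -> /eqP ->]; exists 'X; split; rewrite ?dvdp0 //.
  by have := irredp_XsubC (0 : F); rewrite subr0.
(* Homogenizing a Bezout identity of [p] and [r] expresses a power of v as a combination of the two
   forms. *)
have piv : pi %| v.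
  have /Bezout_eq1_coprimepP[[A B] /= AB] := cpr.
  pose k := maxn (size A) (size B).
  have sA : (size A <= k.+1)%N by rewrite leqW // leq_maxl.
  have sB : (size B <= k.+1)%N by rewrite leqW // leq_maxr.
  apply: (irreducible_ndvd_exp (n := k + m) hpi).
  by rewrite -(hom1 u) -AB homD !homM // dvdp_addr ?dvdp_mull.
have top s : hom u v m s = (\sum_(i < m) s`_i *: (u ^+ i * v ^+ (m - i).-1)) * v + s`_m *: u ^+ m.
  rewrite /hom big_ord_recr /= subnn mulr1; congr (_ + _).
  rewrite mulr_suml; apply: eq_bigr => i _; rewrite -scalerAl -mulrA -exprSr prednK //.
  by rewrite subn_gt0.
have piu : pi %| u.
  apply: (irreducible_ndvd_exp (n := m) hpi).
  case/orP: pr => c0.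
    by move: pip; rewrite top dvdp_addr ?dvdp_mull // dvdpZr.
  by move: pir; rewrite top dvdp_addr ?dvdp_mull // dvdpZr.
have : pi %| gcdp u v by rewrite dvdp_gcd piu.
move: cuv; rewrite coprimep_def => /eqP s1 /dvdp_leq.
have g0 : gcdp u v != 0 by rewrite -size_poly_gt0 s1.
move=> /(_ g0); rewrite s1; case: hpi => spi _; by rewrite leqNgt spi.
Qed.

(** Degrees of rational functions multiply under composition: if p/r composed with u/v is X, then
    u/v has degree 1. *)
Lemma hom_degree_one u v m p r : v != 0 -> coprimep u v -> coprimep p r ->
  (size p <= m.+1)%N -> (size r <= m.+1)%N -> (p`_m != 0) || (r`_m != 0) ->
  'X * hom u v m r = hom u v m p -> hom u v m r != 0 ->
  (size u <= 2)%N /\ (size v <= 2)%N /\ ((1 < size u)%N || (1 < size v)%N).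
Proof.
move=> v0 cuv cpr sp sr pr e r0.
have chr := coprimep_hom v0 cuv cpr sp sr pr.
have s1 : size (hom u v m r) = 1%N.
  apply/eqP; rewrite -coprimepp; apply: coprimep_dvdr chr.
  by rewrite -e dvdp_mull.
have sp2 : size (hom u v m p) = 2%N.
  by rewrite -e size_mul ?polyX_eq0 // size_polyX s1.
pose n := (maxn (size u) (size v)).-1.
have mx : (0 < maxn (size u) (size v))%N by rewrite leq_max !size_poly_gt0 v0 orbT.
have su : (size u <= n.+1)%N by rewrite prednK // leq_maxl.
have sv : (size v <= n.+1)%N by rewrite prednK // leq_maxr.
(* Otherwise the coefficients of degree n m vanish in both forms. They are the values of the forms
   of [p] and [r] at the nonzero point (u_n, v_n), so these would have a common zero, possibly at
   infinity. *)
have nm : (n * m <= 1)%N.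
  rewrite leqNgt; apply/negP => nm.
  have z1 : \sum_(i < m.+1) p`_i * (u`_n ^+ i * v`_n ^+ (m - i)) = 0.
    by rewrite -coef_hom_top // nth_default // sp2.
  have z2 : \sum_(i < m.+1) r`_i * (u`_n ^+ i * v`_n ^+ (m - i)) = 0.
    by rewrite -coef_hom_top // nth_default // s1 ltnW.
  have [vn|vn] := eqVneq v`_n 0.
    have un : u`_n != 0.
      apply/negP => /eqP un.
      have uu : size u = 0%N \/ size u != n.+1.
        right; apply/eqP => sun; move: un; rewrite -[n]/(n.+1.-1) -sun -lead_coefE.
        by move/eqP; rewrite lead_coef_eq0 -size_poly_eq0 sun.
      have vv : size v != n.+1.
        apply/eqP => sun; move: vn; rewrite -[n]/(n.+1.-1) -sun -lead_coefE.
        by move/eqP; rewrite lead_coef_eq0 -size_poly_eq0 sun.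
      move: uu vv mx su sv; rewrite /n; move: (size u) (size v) => x y; clear.
      by case: (leqP x y) => xy; rewrite ?(maxn_idPr xy) ?(maxn_idPl (ltnW xy)); lia.
    have red (s : {poly F}) : \sum_(i < m.+1) s`_i * (u`_n ^+ i * v`_n ^+ (m - i)) = s`_m * u`_n ^+ m.
      rewrite big_ord_recr /= subnn mulr1 big1 ?add0r // => i _.
      by rewrite vn expr0n subn_eq0 leqNgt ltn_ord /= !mulr0.
    move: z1 z2; rewrite !red => /eqP z1 /eqP z2.
    move: z1 z2 pr; rewrite !mulf_eq0 !expf_eq0 (negbTE un) !andbF !orbF.
    by move=> /eqP -> /eqP ->; rewrite eqxx.
  have red (s : {poly F}) : (size s <= m.+1)%N ->
      \sum_(i < m.+1) s`_i * (u`_n ^+ i * v`_n ^+ (m - i)) = v`_n ^+ m * s.[u`_n / v`_n].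
    move=> ss; rewrite (horner_coef_wide _ ss) mulr_sumr; apply: eq_bigr => i _.
    have im : (i <= m)%N by rewrite -ltnS.
    have -> : v`_n ^+ m = v`_n ^+ (m - i) * v`_n ^+ i by rewrite -exprD subnK.
    rewrite exprMn exprVn; field.
    by rewrite expf_neq0.
  move: z1 z2; rewrite !red // => /eqP z1 /eqP z2.
  move: z1 z2; rewrite !mulf_eq0 !expf_eq0 (negbTE vn) !andbF !orFb => z1 z2.
  have rz : root p (u`_n / v`_n) by [].
  by have := coprimep_root cpr rz; rewrite z2.
have n0 : (0 < n)%N.
  rewrite lt0n; apply/eqP => n0.
  by have := size_hom m p su sv; rewrite n0 mul0n sp2.
have m0 : (0 < m)%N.
  rewrite lt0n; apply/eqP => m0; move: sp2; rewrite m0 /hom big_ord1 !expr0 mulr1.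
  by rewrite alg_polyC size_polyC; case: (_ != _).
have n1 : n = 1%N by case: n nm n0 {su sv} => [|[|n]] //; case: (m) m0 => // ? _; rewrite mulSn; lia.
move: su sv n1 mx; rewrite /n; move: (size u) (size v) => x y; clear.
by case: (leqP x y) => xy; rewrite ?(maxn_idPr xy) ?(maxn_idPl (ltnW xy)) => *;
   split; [lia|split; [lia|apply/orP; lia]| lia | split; [lia|apply/orP; lia]].
Qed.

(** This picks one matrix in each class modulo scalars, so that parameters will correspond to
    isomorphisms one to one. *)
Definition moebius_normal (c d : F) := (c == 1) || ((c == 0) && (d == 1)).

(** Writing th(X) = u/v and th'(X) = p/r in lowest terms, the relation th(th'(X)) = X puts
    [hom_degree_one] to use. *)
Lemma ratfun_automorphism (th th' : {rmorphism ratfun F -> ratfun F}) :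
  (forall c, th (ratC c) = ratC c) -> (forall c, th' (ratC c) = ratC c) ->
  th (th' (emb 'X)) = emb 'X ->
  exists a b c d, [/\ a * d - b * c != 0, moebius_normal c d &
    th (emb 'X) = emb (lin a b) / emb (lin c d)].
Proof.
move=> thC thC' e.
have [u [v [v0 cuv tE]]] := ratfun_coprime_frac (th (emb 'X)).
have [p [r [r0 cpr zE]]] := ratfun_coprime_frac (th' (emb 'X)).
pose m := (maxn (size p) (size r)).-1.
have mx : (0 < maxn (size p) (size r))%N by rewrite leq_max [X in _ || X]size_poly_gt0 r0 orbT.
have sp : (size p <= m.+1)%N by rewrite prednK // leq_maxl.
have sr : (size r <= m.+1)%N by rewrite prednK // leq_maxr.
have pr : (p`_m != 0) || (r`_m != 0).
  rewrite -negb_and; apply/negP => /andP[/eqP pm /eqP rm].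
  have h (s : {poly F}) : s`_m = 0 -> (size s != m.+1).
    move=> sm; apply/eqP => ssm; move: sm; rewrite -[m]/(m.+1.-1) -ssm -lead_coefE.
    by move/eqP; rewrite lead_coef_eq0 -size_poly_eq0 ssm.
  move: (h _ pm) (h _ rm) mx; rewrite /m; move: (size p) (size r) => x y; clear.
  by case: (leqP x y) => xy; rewrite ?(maxn_idPr xy) ?(maxn_idPl (ltnW xy)); lia.
have evr0 : ev (emb u / emb v) r != 0.
  by rewrite -tE -rmorph_emb // fmorph_eq0 emb_eq0.
have er : emb (hom u v m r) = emb v ^+ m * ev (emb u / emb v) r by rewrite emb_hom.
have hr0 : hom u v m r != 0.
  have ev0 : emb v != 0 by rewrite emb_eq0.
  by rewrite -emb_eq0 er; exact: mulf_neq0 (expf_neq0 m ev0) evr0.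
have eX : 'X * hom u v m r = hom u v m p.
  apply: emb_inj; rewrite rmorphM /= er emb_hom // mulrCA; congr (_ * _).
  move: e; rewrite zE (rmorph_frac p r thC) tE => <-.
  by rewrite divfK.
have [su [sv suv]] := hom_degree_one v0 cuv cpr sp sr pr eX hr0.
have lE (w : {poly F}) : (size w <= 2)%N -> w = lin w`_1 w`_0.
  move=> sw; apply/polyP => i; rewrite coef_lin; case: i => [|[|i]] //=.
  by rewrite nth_default // (leq_trans sw).
have uE := lE _ su; have vE := lE _ sv.
set a := u`_1 in uE; set b := u`_0 in uE; set c := v`_1 in vE; set d := v`_0 in vE.
have D : a * d - b * c != 0.
  apply/negP => /eqP D0.
  have cuav : c *: u = a *: v.
    apply/polyP => i; rewrite uE vE !coefZ !coef_lin.
    by case: i => [|[|i]] /=; [apply/eqP; rewrite eq_sym -subr_eq0 -D0; apply/eqP; ring|ring|rewrite !mulr0].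
  have [c0|c0] := eqVneq c 0.
    have sv1 : (size v <= 1)%N.
      by apply/leq_sizeP => [[|[|i]]] // _; rewrite nth_default // (leq_trans sv).
    have a0 : a != 0.
      move: suv; rewrite [(1 < size v)%N]ltnNge sv1 orbF => su2.
      have su2' : size u = 2%N by apply/eqP; rewrite eqn_leq su.
      have : lead_coef u != 0 by rewrite lead_coef_eq0 -size_poly_eq0 su2'.
      by rewrite lead_coefE su2'.
    by move: cuav; rewrite c0 scale0r => /esym/eqP; rewrite scaler_eq0 (negbTE a0) (negbTE v0).
  have vu : v %| u by rewrite -(dvdpZr _ _ c0) cuav -mul_polyC dvdp_mull.
  have := coprimep_dvdr vu cuv; rewrite coprimepp => /eqP sv1.
  by move: c0; rewrite /c nth_default ?eqxx // sv1.
have linZ k a1 b1 : k *: lin a1 b1 = lin (k * a1) (k * b1).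
  by apply/polyP => i; rewrite coefZ !coef_lin; case: i => [|[|i]] //=; rewrite mulr0.
have fracZ k p1 r1 : k != 0 -> emb p1 / emb r1 = emb (k *: p1) / emb (k *: r1).
  move=> k0; rewrite !emb_scale; apply/esym/divf_scale.
  by rewrite fmorph_eq0.
have [c0|c0] := eqVneq c 0.
  have d0 : d != 0 by move: D; rewrite c0 mulr0 subr0; apply: contraNneq => ->; rewrite mulr0.
  exists (a / d), (b / d), 0, 1; split; rewrite /moebius_normal ?eqxx ?orbT //.
    by move: D; rewrite c0 !mulr0 !subr0 mulr1 !mulf_eq0 invr_eq0.
  rewrite tE (fracZ d (lin (a / d) _)) // !linZ uE vE c0 mulr0 mulr1.
  by rewrite ![d * (_ / d)]mulrC !divfK.
exists (a / c), (b / c), 1, (d / c); split; rewrite /moebius_normal ?eqxx //.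
  have -> : a / c * (d / c) - b / c * 1 = (a * d - b * c) / c ^+ 2 by field.
  by rewrite mulf_neq0 // invr_neq0 // expf_neq0.
rewrite tE (fracZ c (lin (a / c) _)) // !linZ uE vE mulr1.
by rewrite ![c * (_ / c)]mulrC !divfK.
Qed.

End Automorphisms.

(** * Homomorphisms between algebras L[Y] / (Y^3 - e) that commute with Y -> z Y *)

Section CubicAlgebra.
Variable L : fieldType.
Implicit Types (e g : L) (p : {poly L}).

Lemma coef_comp_scale p c i : (p \Po (c *: 'X))`_i = p`_i * c ^+ i.
Proof.
rewrite comp_polyE coef_sum.
under eq_bigr do rewrite exprZn coefZ coefZ coefXn.
case: (ltnP i (size p)) => ip; last first.
  rewrite nth_default // mul0r big1 // => j _.
  by case: eqP => [ij|_]; rewrite ?mulr0 //; have := ltn_ord j; rewrite -ij ltnNge ip.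
rewrite (bigD1 (Ordinal ip)) //= eqxx mulr1 big1 ?addr0 // => j.
by rewrite -val_eqE /= eq_sym => /negbTE ->; rewrite !mulr0.
Qed.

Definition cubic e : {poly L} := 'X^3 - e%:P.
Definition cubic_alg e := {poly %/ cubic e}.

Lemma cubic_monic e : cubic e \is monic.
Proof. by rewrite /cubic monicXnsubC. Qed.

Lemma size_cubic e : size (cubic e) = 4%N.
Proof. by rewrite /cubic size_XnsubC. Qed.

Lemma mk_cubic e : mk_monic (cubic e) = cubic e.
Proof. by rewrite /mk_monic size_cubic cubic_monic. Qed.

Lemma size_cubic_alg e (u : cubic_alg e) : (size (polyn u) <= 3)%N.
Proof. by apply: leq_trans (size_npoly u) _; rewrite mk_cubic size_cubic. Qed.

Lemma in_cubic_small e p : (size p <= 3)%N -> polyn (in_qpoly (cubic e) p) = p.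
Proof. by move=> sp; rewrite in_qpoly_small // mk_cubic size_cubic. Qed.

Lemma cubic_alg_eq e (u v : cubic_alg e) :
  (forall i, (i < 3)%N -> (polyn u)`_i = (polyn v)`_i) -> u = v.
Proof.
move=> H; apply: val_inj; apply/polyP => i /=.
case: (ltnP i 3) => i3; first exact: H.
by rewrite !nth_default // (leq_trans (size_cubic_alg _)).
Qed.

(** The semilinear map that acts by [th] on coefficients and sends Y to c Y. *)
Definition twist (th : L -> L) (c : L) e g (u : cubic_alg e) : cubic_alg g :=
  in_qpoly (cubic g) (map_poly th (polyn u) \Po (c *: 'X)).

Definition scale_aut (z : L) e (u : cubic_alg e) : cubic_alg e :=
  in_qpoly (cubic e) (polyn u \Po (z *: 'X)).

Lemma coef_twist (th : {rmorphism L -> L}) c e g (u : cubic_alg e) i : (i < 3)%N ->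
  (polyn (twist th c g u))`_i = th (polyn u)`_i * c ^+ i.
Proof.
move=> i3; rewrite in_cubic_small ?coef_comp_scale ?coef_map //.
apply/leq_sizeP => j j3; rewrite coef_comp_scale coef_map /= nth_default ?rmorph0 ?mul0r //.
exact: leq_trans (size_cubic_alg u) j3.
Qed.

Lemma coef_scale_aut z e (u : cubic_alg e) i : (i < 3)%N ->
  (polyn (scale_aut z u))`_i = (polyn u)`_i * z ^+ i.
Proof.
move=> i3; rewrite /scale_aut in_cubic_small ?coef_comp_scale //.
apply/leq_sizeP => j j3; rewrite coef_comp_scale nth_default ?mul0r //.
exact: leq_trans (size_cubic_alg u) j3.
Qed.

Lemma coef_qpolyC e k i : (polyn (qpolyC (cubic e) k))`_i = if i == 0%N then k else 0.
Proof. by rewrite qpolyCE coefC. Qed.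

Lemma coef_qX e i : (polyn ('qX : cubic_alg e))`_i = (i == 1%N)%:R.
Proof. by rewrite in_cubic_small ?size_polyX // coefX. Qed.

Lemma in_cubic_cubic e : in_qpoly (cubic e) (cubic e) = 0.
Proof. by apply: val_inj; rewrite /= mk_cubic Pdiv.RingMonic.rmodpp // cubic_monic. Qed.

Lemma in_qpoly_const e k : in_qpoly (cubic e) k%:P = qpolyC (cubic e) k.
Proof.
apply: val_inj; rewrite /= -[LHS]/(polyn (in_qpoly _ _)) in_cubic_small //.
by rewrite size_polyC; case: (_ == _).
Qed.

Lemma in_qpoly_polyn e (u : cubic_alg e) : in_qpoly (cubic e) (polyn u) = u.
Proof.
by apply: val_inj; rewrite /= -[LHS]/(polyn (in_qpoly _ _)) in_cubic_small // size_cubic_alg.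
Qed.

Lemma polyn_qpolyCM e k (u : cubic_alg e) : polyn (qpolyC (cubic e) k * u) = k *: polyn u.
Proof.
rewrite -in_qpoly_const -{1}[u]in_qpoly_polyn -in_qpolyM mul_polyC in_cubic_small //.
exact: leq_trans (size_scale_leq _ _) (size_cubic_alg u).
Qed.

(** The hypothesis is the compatibility of Y -> c Y with the relations Y^3 = e and Y^3 = g; it makes
    the image of the source modulus a multiple of the target modulus. *)
Lemma twist_mul (th : {rmorphism L -> L}) c e g (u v : cubic_alg e) :
  th e = c ^+ 3 * g -> twist th c g (u * v) = twist th c g u * twist th c g v.
Proof.
move=> ec; rewrite /twist -in_qpolyM -rmorphM -rmorphM /=.
rewrite [in RHS](Pdiv.RingMonic.rdivp_eq (cubic_monic e) (polyn u * polyn v)).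
rewrite rmorphD rmorphM /= rmorphD rmorphM /= in_qpolyD in_qpolyM.
have -> : map_poly th (cubic e) \Po (c *: 'X) = c ^+ 3 *: cubic g.
  rewrite /cubic rmorphB /= map_polyXn map_polyC /= ec.
  rewrite comp_polyB comp_polyC rmorphXn /= comp_polyX exprZn scalerBr.
  by rewrite -!mul_polyC -polyCM.
rewrite in_qpolyZ in_cubic_cubic scaler0 mulr0 add0r; congr (in_qpoly _ (map_poly _ _ \Po _)).
exact: (congr1 (fun h => Pdiv.CommonRing.rmodp (polyn u * polyn v) h) (mk_cubic e)).
Qed.

Lemma twistK (th th' : {rmorphism L -> L}) (c : L) e g : cancel th th' -> c != 0 ->
  cancel (@twist th c e g) (@twist th' (th' c)^-1 g e).
Proof.
move=> thK c0 u; apply: cubic_alg_eq => i i3; rewrite !coef_twist //.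
by rewrite rmorphM rmorphXn /= thK exprVn mulfK // expf_neq0 // fmorph_eq0.
Qed.

Lemma twist_zmod (th : {rmorphism L -> L}) c e g : zmod_morphism (@twist th c e g).
Proof.
move=> u v; apply: cubic_alg_eq => i i3.
have cB h (x y : cubic_alg h) : (polyn (x - y))`_i = (polyn x)`_i - (polyn y)`_i.
  by rewrite -coefB.
by rewrite coef_twist // !cB !coef_twist // rmorphB mulrBl.
Qed.

Lemma twist_qpolyC (th : {rmorphism L -> L}) c e g k :
  twist th c g (qpolyC (cubic e) k) = qpolyC (cubic g) (th k).
Proof.
apply: cubic_alg_eq => i i3; rewrite coef_twist // !coef_qpolyC.
by case: i i3 => [|i] _ /=; rewrite ?expr0 ?mulr1 // rmorph0 mul0r.
Qed.

Lemma twist_qX (th : {rmorphism L -> L}) c e g :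
  twist th c g ('qX : cubic_alg e) = qpolyC (cubic g) c * 'qX.
Proof.
apply: cubic_alg_eq => i i3; rewrite coef_twist // polyn_qpolyCM coefZ !coef_qX.
by rewrite rmorph_nat; case: i i3 => [|[|i]] _; rewrite ?mul0r ?mulr0 //= mul1r mulr1.
Qed.

Lemma twist_scale_aut (th : {rmorphism L -> L}) z c e g u : th z = z ->
  @twist th c e g (scale_aut z u) = scale_aut z (twist th c g u).
Proof.
move=> thz; apply: cubic_alg_eq => i i3.
rewrite coef_twist // !coef_scale_aut // coef_twist // rmorphM rmorphXn /= thz.
by rewrite mulrAC.
Qed.

Lemma cubic_alg_decomp e (u : cubic_alg e) :
  u = \sum_(i < 3) qpolyC (cubic e) (polyn u)`_i * 'qX ^+ i.
Proof.
have H : polyn u = \sum_(i < 3) (polyn u)`_i *: 'X^i.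
  rewrite -poly_def; apply/polyP => i; rewrite coef_poly; case: ltnP => // i3.
  by rewrite nth_default // (leq_trans (size_cubic_alg u)).
rewrite -{1}[u]in_qpoly_polyn {1}H rmorph_sum; apply: eq_bigr => i _.
by rewrite /= -mul_polyC rmorphM rmorphXn /= in_qpoly_const.
Qed.

Lemma cubic_qX3 e : ('qX : cubic_alg e) ^+ 3 = qpolyC (cubic e) e.
Proof.
have := in_cubic_cubic e; rewrite {2}/cubic rmorphB rmorphXn /=.
by move=> /eqP; rewrite subr_eq0 => /eqP ->; rewrite /= in_qpoly_const.
Qed.

Lemma qpolyC_inj e : injective (qpolyC (cubic e)).
Proof. by move=> x y xy; have := coef_qpolyC e x 0; rewrite xy coef_qpolyC. Qed.

Lemma scale_aut_qpolyC z e k : scale_aut z (qpolyC (cubic e) k) = qpolyC (cubic e) k.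
Proof.
apply: cubic_alg_eq => i i3; rewrite coef_scale_aut // !coef_qpolyC.
by case: i {i3} => [|i] /=; rewrite ?expr0 ?mulr1 // mul0r.
Qed.

Lemma scale_aut_qX z e : scale_aut z ('qX : cubic_alg e) = qpolyC (cubic e) z * 'qX.
Proof.
have := twist_qX (GRing.RMorphism.clone _ _ (@idfun L) _) z e e.
move=> <-; apply: cubic_alg_eq => i i3.
by rewrite coef_scale_aut // coef_twist.
Qed.

(** 1, Y and Y^2 are eigenvectors for the distinct eigenvalues 1, z and z^2, so the fixed elements
    are the constants. *)
Lemma scale_aut_fixed z e (u : cubic_alg e) : 3.-primitive_root z ->
  scale_aut z u = u -> u = qpolyC (cubic e) (polyn u)`_0.
Proof.
move=> pz fu; apply: cubic_alg_eq => i i3; rewrite coef_qpolyC.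
case: i i3 => // i i3; have := coef_scale_aut z u i3; rewrite fu.
move/eqP; rewrite -subr_eq0 -{1}[(polyn u)`__]mulr1 -mulrBr mulf_eq0 => /orP[/eqP ->//|].
rewrite subr_eq0 eq_sym -(prim_order_dvd pz) => d3.
by have := dvdn_leq (ltn0Sn i) d3; rewrite leqNgt i3.
Qed.

Lemma scale_aut_eigen z e (u : cubic_alg e) : 3.-primitive_root z ->
  scale_aut z u = qpolyC (cubic e) z * u -> u = qpolyC (cubic e) (polyn u)`_1 * 'qX.
Proof.
move=> pz fu.
apply: cubic_alg_eq => i i3; rewrite polyn_qpolyCM coefZ coef_qX.
have := coef_scale_aut z u i3; rewrite fu polyn_qpolyCM coefZ => /eqP.
case: i i3 => [|[|i]] i3; rewrite ?mulr0 ?mulr1 //.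
  rewrite -subr_eq0 -{2}[(polyn u)`__]mul1r -mulrBl mulf_eq0 => /orP[|/eqP //].
  by rewrite subr_eq0 => /eqP z1; have := prim_order_dvd pz 1; rewrite z1 expr1n eqxx.
case: i i3 => // _; rewrite -subr_eq0 [_ * z ^+ 2]mulrC -mulrBl mulf_eq0 => /orP[|/eqP //].
rewrite subr_eq0 eq_sym expr2 -subr_eq0 -{3}[z]mulr1 -mulrBr mulf_eq0.
rewrite (prim_root_eq0 pz) /= subr_eq0 => /eqP z1.
by have := prim_order_dvd pz 1; rewrite z1 expr1n eqxx.
Qed.

Lemma qpolyCM_qX_inj e x y : qpolyC (cubic e) x * 'qX = qpolyC (cubic e) y * 'qX -> x = y.
Proof.
move=> /(congr1 (fun w : cubic_alg e => (polyn w)`_1)).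
by rewrite !polyn_qpolyCM !coefZ !coef_qX !mulr1.
Qed.

Lemma twist_one (th : {rmorphism L -> L}) c e g : @twist th c e g 1 = 1.
Proof.
by rewrite -(rmorph1 (qpolyC (cubic e))) twist_qpolyC !rmorph1.
Qed.

Section CubicIso.
Variables (z e g : L) (phi : cubic_alg e -> cubic_alg g).
Hypothesis z_prim : 3.-primitive_root z.
Hypothesis phiB : zmod_morphism phi.
Hypothesis phiM : monoid_morphism phi.
Hypothesis phi_aut : forall u, phi (scale_aut z u) = scale_aut z (phi u).

(** Commuting with the order 3 automorphism forces the map to preserve the fixed subring, which is
    the base field. *)
Lemma cubic_iso_base : exists th : {rmorphism L -> L},
  forall k, phi (qpolyC (cubic e) k) = qpolyC (cubic g) (th k).
Proof.
pose th k := (polyn (phi (qpolyC (cubic e) k)))`_0.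
have E k : phi (qpolyC (cubic e) k) = qpolyC (cubic g) (th k).
  by apply: scale_aut_fixed z_prim _; rewrite -phi_aut scale_aut_qpolyC.
have thB : zmod_morphism th.
  by move=> x y; apply: (@qpolyC_inj g); rewrite -E rmorphB phiB rmorphB !E.
have thM : monoid_morphism th.
  split=> [|x y]; apply: (@qpolyC_inj g); rewrite -E.
    by rewrite !rmorph1 phiM.1.
  by rewrite qpolyCM phiM.2 [RHS]qpolyCM !E.
pose T : {rmorphism L -> L} := HB.pack th (GRing.isZmodMorphism.Build L L th thB)
  (GRing.isMonoidMorphism.Build L L th thM).
by exists T.
Qed.

(** The image of Y is an eigenvector for z, hence c Y, and c is nonzero by injectivity; base field
    and Y determine the map. *)
Lemma cubic_iso_twist (th : {rmorphism L -> L}) : injective phi ->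
  (forall k, phi (qpolyC (cubic e) k) = qpolyC (cubic g) (th k)) -> th z = z ->
  exists c, [/\ c != 0, th e = c ^+ 3 * g & phi =1 twist th c g].
Proof.
move=> phi_inj thE thz.
have [c cE] : exists c, phi 'qX = qpolyC (cubic g) c * 'qX.
  exists (polyn (phi 'qX))`_1; apply: scale_aut_eigen z_prim _.
  by rewrite -phi_aut scale_aut_qX phiM.2 thE thz.
have ec : th e = c ^+ 3 * g.
  have H : qpolyC (cubic g) (th e) = (qpolyC (cubic g) c * 'qX) ^+ 3.
    by rewrite -thE -cubic_qX3 !exprS !expr0 !mulr1 !phiM.2 cE.
  by apply: (@qpolyC_inj g); rewrite H exprMn cubic_qX3 qpolyCM rmorphXn.
exists c; split=> //.
  apply/negP => /eqP c0; move: cE; rewrite c0 rmorph0 mul0r => q0.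
  have p0 : phi 0 = 0 by rewrite -(subrr 0) phiB subrr.
  have := coef_qX e 1; rewrite (phi_inj _ _ (etrans q0 (esym p0))) coef0 /=.
  by move/esym/eqP; rewrite oner_eq0.
pose P : {rmorphism cubic_alg e -> cubic_alg g} :=
  HB.pack phi (GRing.isZmodMorphism.Build (cubic_alg e) (cubic_alg g) phi phiB)
    (GRing.isMonoidMorphism.Build (cubic_alg e) (cubic_alg g) phi phiM).
have tM : monoid_morphism (@twist th c e g).
  by split=> [|u v]; [exact: twist_one | exact: twist_mul].
pose T : {rmorphism cubic_alg e -> cubic_alg g} :=
  HB.pack (@twist th c e g)
    (GRing.isZmodMorphism.Build (cubic_alg e) (cubic_alg g) _ (@twist_zmod th c e g))
    (GRing.isMonoidMorphism.Build (cubic_alg e) (cubic_alg g) _ tM).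
move=> u; rewrite -[phi u]/(P u) -[twist _ _ _ u]/(T u) [u]cubic_alg_decomp !rmorph_sum.
apply: eq_bigr => i _; rewrite !rmorphM !rmorphXn /=; congr (_ * _ ^+ _).
  by rewrite thE twist_qpolyC.
by rewrite cE twist_qX.
Qed.

End CubicIso.

End CubicAlgebra.

Lemma cube_cancel (L : fieldType) (k w y : L) : k != 0 -> w != 0 ->
  (k^-1 / w) ^+ 3 * (k ^+ 3 * (w ^+ 3 * y)) = y.
Proof. by move=> k0 w0; field; rewrite k0 w0. Qed.

Lemma cube_ratio (L : fieldType) (r s y : L) : r != 0 -> r ^+ 3 * ((s / r) ^+ 3 * y) = s ^+ 3 * y.
Proof. by move=> r0; field. Qed.

Lemma moebius_adj (L : fieldType) (a b c d u v x : L) : v != 0 ->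
  a * d - b * c != 0 -> u = a * x + b -> v = c * x + d ->
  (d * (u / v) - b) / (- c * (u / v) + a) = x.
Proof.
move=> v0 D uE vE.
have -> : d * (u / v) - b = (a * d - b * c) * x / v by rewrite uE; move: v0; rewrite vE => v0; field.
have -> : - c * (u / v) + a = (a * d - b * c) / v by rewrite uE; move: v0; rewrite vE => v0; field.
by field; rewrite v0 D.
Qed.

(** * Parametrization of all isomorphisms between two models *)

Section CurveIsomorphisms.
Variables (F : finFieldType) (zeta : F).
Hypothesis zeta_prim : 3.-primitive_root zeta.
Implicit Types f g : {poly F}.

Lemma curve_iso_id f : curve_iso zeta (@id (function_field f)).
Proof. by split=> //; exists id. Qed.

Lemma curve_iso_comp f g h (phi : function_field f -> function_field g)
  (psi : function_field g -> function_field h) :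
  curve_iso zeta phi -> curve_iso zeta psi -> curve_iso zeta (psi \o phi).
Proof.
move=> [b1 z1 m1 c1 s1] [b2 z2 m2 c2 s2]; split.
- exact: bij_comp.
- by move=> x y; exact: etrans (congr1 psi (z1 x y)) (z2 _ _).
- split=> [|x y]; first exact: etrans (congr1 psi m1.1) m2.1.
  exact: etrans (congr1 psi (m1.2 x y)) (m2.2 _ _).
- by move=> c; exact: etrans (congr1 psi (c1 c)) (c2 c).
- by move=> u; exact: etrans (congr1 psi (s1 u)) (s2 _).
Qed.

Lemma curve_iso_inv f g (phi : function_field f -> function_field g) psi :
  curve_iso zeta phi -> cancel phi psi -> cancel psi phi -> curve_iso zeta psi.
Proof.
move=> [b1 z1 m1 c1 s1] K1 K2; have inj := can_inj K1; split.
- by exists phi.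
- move=> x y; apply: inj; apply: etrans (K2 _) _; apply: etrans (esym (z1 _ _)).
  exact: esym (congr2 (fun x y => x - y) (K2 x) (K2 y)).
- split=> [|x y]; apply: inj; first exact: etrans (K2 _) (esym m1.1).
  apply: etrans (K2 _) _; apply: etrans (esym (m1.2 _ _)).
  exact: esym (congr2 (fun x y => x * y) (K2 x) (K2 y)).
- by move=> c; apply: inj; exact: etrans (K2 _) (esym (c1 c)).
- move=> u; apply: inj; apply: etrans (K2 _) _; apply: etrans (esym (s1 _)).
  exact: esym (congr1 _ (K2 u)).
Qed.

Definition moebius (a b c d : F) : ratfun F := emb (lin a b) / emb (lin c d).

Lemma lin_neq0 (a b c d : F) : a * d - b * c != 0 -> lin c d != 0.
Proof.
move=> D; rewrite lin_eq0; apply: contraNN D => /andP[/eqP -> /eqP ->].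
by rewrite !mulr0 subrr.
Qed.

Lemma moebius_tr a b c d : a * d - b * c != 0 ->
  forall r : {poly F}, r != 0 -> ev (moebius a b c d) r != 0.
Proof.
move=> D r r0; have v0 := lin_neq0 D.
apply/eqP => e0; have := hom_neq0 D (leqnSn (size r)) r0.
rewrite -emb_eq0 (emb_hom (lin a b) v0 (leqnSn (size r))) -/(moebius a b c d) e0.
by rewrite mulr0 eqxx.
Qed.

Definition moebius_subst a b c d (D : a * d - b * c != 0) :=
  subst_rmorphism (moebius_tr D).

Lemma moebius_subst_ratC a b c d (D : a * d - b * c != 0) k :
  moebius_subst D (ratC k) = ratC k.
Proof. exact: (subst_ratC (moebius_tr D) k). Qed.

Lemma moebius_subst_X a b c d (D : a * d - b * c != 0) :
  moebius_subst D (emb 'X) = moebius a b c d.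
Proof. exact: (subst_X (moebius_tr D)). Qed.

Lemma ev_lin t (a b : F) : ev t (lin a b) = ratC a * t + ratC b.
Proof. by rewrite /lin evD evC -mul_polyC evM evC evX. Qed.

Lemma moebius_subst_adj a b c d (D : a * d - b * c != 0)
  (D' : d * a - (- b) * (- c) != 0) :
  moebius_subst D (moebius d (- b) (- c) a) = emb 'X.
Proof.
have v0 := lin_neq0 D; have v0' := lin_neq0 D'.
rewrite [moebius d _ _ _]/moebius (rmorph_frac (lin d (- b)) (lin (- c) a) (moebius_subst_ratC D)).
rewrite moebius_subst_X !ev_lin.
rewrite !rmorphN /=; apply: moebius_adj.
- by rewrite emb_eq0.
- by rewrite -!rmorphM -rmorphB fmorph_eq0.
- by rewrite rmorphD /= emb_scale.
- by rewrite rmorphD /= emb_scale.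
Qed.

Lemma moebius_substK a b c d (D : a * d - b * c != 0)
  (D' : d * a - (- b) * (- c) != 0) :
  cancel (moebius_subst D') (moebius_subst D).
Proof.
pose T : {rmorphism ratfun F -> ratfun F} := GRing.RMorphism.clone _ _ (moebius_subst D \o moebius_subst D') _.
pose I : {rmorphism ratfun F -> ratfun F} := GRing.RMorphism.clone _ _ (@idfun (ratfun F)) _.
have H : T =1 I.
  apply: rmorph_ratfun_eq => [k|//|].
    exact: etrans (congr1 (moebius_subst D) (moebius_subst_ratC D' k)) (moebius_subst_ratC D k).
  exact: etrans (congr1 (moebius_subst D) (moebius_subst_X D')) (moebius_subst_adj D D').
by move=> x; exact: H.
Qed.

Definition iso_param : finType := (F * F * F * F * F)%type.

Definition valid_param (x : iso_param) :=
  let: (a, b, c, d, l) := x in [&& a * d - b * c != 0, moebius_normal c d & l != 0].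

Variables (d1 d2 n : nat).
Hypothesis deg3n : (d1 + 2 * d2 = n * 3)%N.

(** The twist by the substitution with factor 1 / (l (cX + d)^n) sends Y^3 = f to Y^3 = l^3 (cX +
    d)^(3n) f((aX + b) / (cX + d)). Divisibility of d1 + 2 d2 by 3 makes the right side exactly this
    form. *)
Definition model_of (x : iso_param) f : {poly F} :=
  let: (a, b, c, d, l) := x in l ^+ 3 *: hom (lin a b) (lin c d) (d1 + 2 * d2) f.

Definition iso_of (x : iso_param) f g : function_field f -> function_field g :=
  let: (a, b, c, d, l) := x in
  @twist _ (subst (moebius a b c d)) ((ratC l)^-1 / emb (lin c d) ^+ n) (emb f) (emb g).

Lemma Fhat_br_size f : Fhat_br d1 d2 f -> (size f <= (d1 + 2 * d2).+1)%N.
Proof.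
move=> /Fhat_brP[A [B [-> sA sB _ _]]]; rewrite (leq_trans (size_polyMleq _ _)) //.
have := size_poly_exp_leq B 2; move: sA sB; move: (size A) (size B) (size (B ^+ 2)%R); clear.
by move=> x y z; lia.
Qed.

Lemma model_of_br x f : valid_param x -> Fhat_br d1 d2 f -> Fhat_br d1 d2 (model_of x f).
Proof.
case: x => [[[[a b] c] d] l] /and3P[D _ l0] hf.
by apply: Fhat_br_hom => //; rewrite expf_neq0.
Qed.

Lemma iso_of_iso x f : valid_param x -> Fhat_br d1 d2 f ->
  curve_iso zeta (@iso_of x f (model_of x f)).
Proof.
case: x => [[[[a b] c] d] l] /and3P[D _ l0] hf.
have v0 := lin_neq0 D; have V0 : emb (lin c d) != 0 by rewrite emb_eq0.
have D' : d * a - (- b) * (- c) != 0 by rewrite mulrNN mulrC.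
have D2 : a * d - - - b * - - c != 0 by rewrite !opprK.
have l0' : ratC l != 0 by rewrite fmorph_eq0.
have W0 := expf_neq0 n V0.
rewrite /iso_of; set e := (ratC l)^-1 / _.
have e0 : e != 0 by exact: mulf_neq0 (invr_neq0 l0') (invr_neq0 W0).
pose th := moebius_subst D; pose th' := moebius_subst D'.
have thK : cancel th' th by exact: moebius_substK.
have thK' : cancel th th'.
  have H := @moebius_substK d (- b) (- c) a D' D2.
  have E : moebius_subst D2 =1 th.
    apply: rmorph_ratfun_eq; try exact: moebius_subst_ratC.
    by rewrite !moebius_subst_X !opprK.
  by move=> x; rewrite -E H.
have ec : th (emb f) = e ^+ 3 * emb (model_of (a, b, c, d, l) f).
  rewrite /model_of emb_scale (emb_hom (lin a b) v0 (Fhat_br_size hf)) deg3n exprM rmorphXn.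
  apply: etrans (esym (cube_cancel (ev (moebius a b c d) f) l0' W0)).
  exact: (subst_emb (moebius_tr D) f).
set G := model_of _ _ in ec *.
have K1 := @twistK _ th th' e (emb f) (emb G) thK' e0.
have te0 : th' e != 0 by rewrite (fmorph_eq0 th' e); exact: e0.
have e0' := invr_neq0 te0.
have K2 := @twistK _ th' th (th' e)^-1 (emb G) (emb f) thK e0'.
have ee : (th (th' e)^-1)^-1 = e by rewrite (fmorphV th (th' e)) thK; exact: invrK.
rewrite ee in K2.
split.
- exact: (Bijective K1 K2).
- exact: (@twist_zmod _ th e (emb f) (emb G)).
- split; first exact: (@twist_one _ th e (emb f) (emb G)).
  by move=> u v; exact: (@twist_mul _ th e (emb f) (emb G) u v ec).
- move=> k; apply: etrans (@twist_qpolyC _ th e (emb f) (emb G) (ratC k)) _.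
  exact: congr1 (moebius_subst_ratC D k).
- move=> u.
  exact: (@twist_scale_aut _ th (ratC zeta) e (emb f) (emb G) u (moebius_subst_ratC D zeta)).
Qed.

(** An irreducible divides at most one of A and B, and that one only once, so its exponent in A B^2
    is at most 2. *)
Lemma Fhat_br_cubefree (s f : {poly F}) : Fhat_br d1 d2 f -> s ^+ 3 %| f -> size s = 1%N.
Proof.
move=> /Fhat_brP[A [B [-> _ _ sAB _]]] s3.
have AB0 := sqf_neq0 sAB; have := AB0; rewrite mulf_eq0 negb_or => /andP[A0 B0].
have f0 : A * B ^+ 2 != 0 by rewrite mulf_neq0 // expf_neq0.
have s0 : s != 0.
  by apply: contraNneq f0 => s0; move: s3; rewrite s0 expr0n dvd0p.
apply/eqP; apply: contraT => s1.
have [|p [_ hp] ps] := @poly_irr_factor F s.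
  by rewrite ltn_neqAle eq_sym s1 size_poly_gt0.
have p3 : p ^+ 3 %| A * B ^+ 2 by apply: dvdp_trans s3; rewrite dvdp_exp2r.
have p0 : p != 0 := irredp_neq0 hp.
have nsq (r : {poly F}) : p ^+ 2 %| r -> r %| A * B -> False.
  move=> pr rAB; case: hp => sp _.
  have H : size p = 1%N by apply: (sqfP _ sAB); apply: dvdp_trans rAB.
  by rewrite H in sp.
have cAB := sqfM_coprime sAB.
have [pB|npB] := boolP (p %| B).
  have cpA : coprimep p A.
    by apply: coprimep_dvdr pB _; rewrite coprimep_sym.
  have := p3; rewrite (Gauss_dvdpr _ (coprimep_expl 3 cpA)).
  move/dvdpP: pB => [B1 B1E]; rewrite {1}B1E exprMn [_ * p ^+ 2]mulrC.
  rewrite exprSr dvdp_mul2l ?expf_neq0 // => /(irreducible_ndvd_exp hp) pB1.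
  exfalso; apply: (nsq B); last by rewrite dvdp_mull.
  by rewrite B1E expr2 dvdp_mul.
have cpB : coprimep (p ^+ 3) (B ^+ 2).
  by rewrite coprimep_expl // coprimep_expr // (irreducible_poly_coprime _ hp).
exfalso; apply: (nsq A); last by rewrite dvdp_mulr.
by move: p3; rewrite (Gauss_dvdpl _ cpB); apply: dvdp_trans; rewrite dvdp_exp2l.
Qed.

(** In lowest terms the cube of the numerator divides [f] and the cube of the denominator divides
    [g]; both polynomials are cube-free. *)
Lemma const_cube_ratio (c1 : ratfun F) f g : Fhat_br d1 d2 f -> Fhat_br d1 d2 g ->
  emb f = c1 ^+ 3 * emb g -> exists2 k, k != 0 & c1 = ratC k.
Proof.
move=> hf hg; have [s [r [r0 csr ->]]] := ratfun_coprime_frac c1.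
have er0 : emb r != 0 by rewrite emb_eq0.
move=> e; have E : r ^+ 3 * f = s ^+ 3 * g.
  have M (p h : {poly F}) : emb (p ^+ 3 * h) = emb p ^+ 3 * emb h by rewrite rmorphM /= rmorphXn.
  by apply: emb_inj; rewrite !M e; exact: cube_ratio.
have s1 : size s = 1%N.
  apply: (Fhat_br_cubefree hf).
  have cc : coprimep (s ^+ 3) (r ^+ 3) by rewrite coprimep_expl // coprimep_expr.
  by rewrite -(Gauss_dvdpr _ cc) E dvdp_mulr.
have r1 : size r = 1%N.
  apply: (Fhat_br_cubefree hg).
  have cc : coprimep (r ^+ 3) (s ^+ 3) by rewrite coprimep_expl // coprimep_expr // coprimep_sym.
  by rewrite -(Gauss_dvdpr _ cc) -E dvdp_mulr.
move/eqP: s1 => /size_poly1P[s0 s00 ->]; move/eqP: r1 => /size_poly1P[k k0 ->].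
exists (s0 / k); first by rewrite mulf_neq0 ?invr_neq0.
by apply/esym; exact: (fmorph_div (@ratC F) s0 k).
Qed.

(** An isomorphism restricts to a Moebius substitution on F(X) and sends Y to c0 Y. Since c0 (cX +
    d)^n has cube the ratio of two models, it is a constant, which gives the parameter l. *)
Lemma iso_of_surj f g (phi : function_field f -> function_field g) :
  Fhat_br d1 d2 f -> Fhat_br d1 d2 g -> curve_iso zeta phi ->
  exists2 x, valid_param x /\ model_of x f = g & phi = @iso_of x f g.
Proof.
move=> hf hg hphi; have [[psi K1 K2] phiB phiM phiC phiA] := hphi.
have [_ psiB psiM psiC psiA] := curve_iso_inv hphi K1 K2.
have zp : 3.-primitive_root (ratC zeta : ratfun F) by rewrite fmorph_primitive_root.
have [th thE] := @cubic_iso_base _ (ratC zeta) (emb f) (emb g) phi zp phiB phiM phiA.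
have [th' thE'] := @cubic_iso_base _ (ratC zeta) (emb g) (emb f) psi zp psiB psiM psiA.
have thC k : th (ratC k) = ratC k.
  by apply: (@qpolyC_inj _ (emb g)); rewrite -thE; exact: phiC.
have thC' k : th' (ratC k) = ratC k.
  by apply: (@qpolyC_inj _ (emb f)); rewrite -thE'; exact: psiC.
have thK : th (th' (emb 'X)) = emb 'X.
  apply: (@qpolyC_inj _ (emb g)); apply: etrans (esym (thE _)) _.
  exact: etrans (congr1 phi (esym (thE' _))) (K2 _).
have [c0 [c00 ec phiE]] :=
  @cubic_iso_twist _ _ (emb f) (emb g) phi zp phiB phiM phiA th (can_inj K1) thE (thC zeta).
have [a [b [c [d [D nrm tE]]]]] := ratfun_automorphism thC thC' thK.
have thS : (th : ratfun F -> ratfun F) = subst (moebius a b c d).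
  apply/funext; apply: (@rmorph_ratfun_eq _ th (moebius_subst D) thC (moebius_subst_ratC D)).
  exact: etrans tE (esym (moebius_subst_X D)).
have v0 := lin_neq0 D; have V0 : emb (lin c d) != 0 by rewrite emb_eq0.
have W0 := expf_neq0 n V0.
pose h := hom (lin a b) (lin c d) (d1 + 2 * d2) f.
have hh : Fhat_br d1 d2 h.
  by have := Fhat_br_hom D (oner_neq0 _) hf; rewrite scale1r.
have hE : emb h = (c0 * emb (lin c d) ^+ n) ^+ 3 * emb g.
  rewrite /h (emb_hom (lin a b) v0 (Fhat_br_size hf)) deg3n exprM.
  have <- : th (emb f) = ev (emb (lin a b) / emb (lin c d)) f.
    by rewrite (rmorph_emb f thC) tE.
  by rewrite ec exprMn mulrCA mulrA.
have [k k0 kE] := const_cube_ratio hh hg hE.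
have l0 : k^-1 != 0 by rewrite invr_neq0.
have c0E : c0 = (ratC k^-1)^-1 / emb (lin c d) ^+ n.
  have ck : (ratC k^-1)^-1 = ratC k by rewrite (fmorphV (@ratC F) k); exact: invrK.
  by rewrite ck -kE; apply/esym; exact: (mulfK W0).
have hgE : h = k ^+ 3 *: g.
  apply: emb_inj; apply: etrans hE _; rewrite kE emb_scale; congr (_ * _).
  exact: esym (rmorphXn (@ratC F) 3 k).
exists (a, b, c, d, k^-1); first split.
- by rewrite /valid_param D nrm l0.
- by rewrite /model_of -/h hgE scalerA -exprMn mulVf // expr1n scale1r.
apply: etrans (funext phiE) _.
exact: (congr2 (fun t e => @twist _ t e (emb f) (emb g)) thS c0E).
Qed.

(** The image of X determines the matrix up to a scalar, fixed by the normalization of (c, d); the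
    image of Y then determines l. *)
Lemma iso_of_inj x y f g : valid_param x -> valid_param y ->
  @iso_of x f g = @iso_of y f g -> x = y.
Proof.
case: x => [[[[a b] c] d] l] /and3P[D nrm l0].
case: y => [[[[a' b'] c'] d'] l'] /and3P[D' nrm' l0'] E.
have v0 := lin_neq0 D; have v0' := lin_neq0 D'.
have V0 : emb (lin c d) != 0 by rewrite emb_eq0.
have V0' : emb (lin c' d') != 0 by rewrite emb_eq0.
set e := (ratC l)^-1 / emb (lin c d) ^+ n.
set e' := (ratC l')^-1 / emb (lin c' d') ^+ n.
have tt : moebius a b c d = moebius a' b' c' d'.
  apply: (@qpolyC_inj _ (emb g)).
  have H1 := @twist_qpolyC _ (moebius_subst D) e (emb f) (emb g) (emb 'X).
  have H2 := @twist_qpolyC _ (moebius_subst D') e' (emb f) (emb g) (emb 'X).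
  rewrite -(moebius_subst_X D) -(moebius_subst_X D').
  apply: etrans (esym H1) _; apply: etrans _ H2.
  exact: (congr1 (fun phi => phi (qpolyC _ (emb 'X))) E).
have ee : e = e'.
  have H1 := @twist_qX _ (moebius_subst D) e (emb f) (emb g).
  have H2 := @twist_qX _ (moebius_subst D') e' (emb f) (emb g).
  have H3 : qpolyC (cubic (emb g)) e * 'qX = qpolyC (cubic (emb g)) e' * 'qX.
    apply: etrans (esym H1) _; apply: etrans _ H2.
    exact: (congr1 (fun phi => phi 'qX) E).
  exact: qpolyCM_qX_inj H3.
have P : lin a b * lin c' d' = lin a' b' * lin c d.
  apply: emb_inj; rewrite !rmorphM; apply/eqP; rewrite -(eqr_div _ _ V0 V0').
  exact/eqP.
have sl e1 e2 : (size (lin e1 e2) <= 1.+1)%N := size_lin e1 e2.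
have P2 : a * c' = a' * c.
  have := congr1 (fun p : {poly F} => p`_(1 + 1)) P.
  by rewrite !coefM_top // !coef_lin.
have P0 : b * d' = b' * d.
  have := congr1 (fun p : {poly F} => p.[0]) P.
  by rewrite !hornerM !horner_lin !mulr0 !add0r.
have P1 : a * d' + b * c' = a' * d + b' * c.
  have := congr1 (fun p : {poly F} => p.[1]) P.
  rewrite !hornerM !horner_lin !mulr1 => H; apply/eqP; rewrite -subr_eq0; apply/eqP.
  have -> : a * d' + b * c' - (a' * d + b' * c) =
    ((a + b) * (c' + d') - (a' + b') * (c + d)) - (a * c' - a' * c) - (b * d' - b' * d) by ring.
  by rewrite H P2 P0 !subrr.
have [ea eb ec ed] : [/\ a = a', b = b', c = c' & d = d'].
  move: nrm nrm'; rewrite /moebius_normal => /orP[/eqP c1|/andP[/eqP c0 /eqP d1']] /orP[/eqP c1'|/andP[/eqP c0' /eqP d1'']].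
  - move: P2 P1 P0 D D'; rewrite c1 c1' !mulr1 => -> P1 P0 D D'.
    have bb : b = b' + a' * (d - d') by rewrite mulrBr; apply: (addrI (a' * d')); rewrite P1; ring.
    have : (d' - d) * (a' * d' - b') = 0.
      by move: P0; rewrite bb => /eqP; rewrite -subr_eq0 => /eqP P0; rewrite -[RHS]oppr0 -P0; ring.
    move/eqP; rewrite mulf_eq0 (negbTE D') orbF subr_eq0 => /eqP dd.
    by split=> //; rewrite bb dd subrr mulr0 addr0.
  - by move: P2 D'; rewrite c1 c0' mulr0 mulr1 => <-; rewrite mul0r mulr0 subrr eqxx.
  - by move: P2 D; rewrite c0 c1' mulr0 mulr1 => ->; rewrite mul0r mulr0 subrr eqxx.
  - by move: P1 P0; rewrite c0 c0' d1' d1'' !mulr1 !mulr0 !addr0 => -> ->.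
have W0 := expf_neq0 n V0.
have ll : l = l'.
  apply: (fmorph_inj (@ratC F)); apply: invr_inj; move: ee; rewrite /e /e' -ec -ed.
  exact: (mulIf (invr_neq0 W0)).
by rewrite ea eb ec ed ll.
Qed.

End CurveIsomorphisms.

(** * The moment as an average over models *)

Lemma big_pred1_uniq (V : Type) (idx : V) (op : Monoid.law idx) (I : eqType) (r : seq I) i (G : I -> V) :
  uniq r -> i \in r -> \big[op/idx]_(j <- r | i == j) G j = G i.
Proof.
move=> ur ri; rewrite (eq_bigl (pred1 i)) => [|j]; last exact: eq_sym.
by rewrite -big_filter filter_pred1_uniq // big_seq1.
Qed.

Lemma card_fset_set_image (T : finType) (U : choiceType) (h : T -> U) (P : pred T) :
  {in P &, injective h} -> #|` fset_set (h @` [set x | P x])| = #|P|.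
Proof.
move=> h_inj; have fP : finite_set [set x | P x] by exact: finite_finset.
have memP x : (x \in fset_set [set x | P x]) = P x.
  by rewrite in_fset_set //; apply/idP/idP => [/set_mem|/mem_set].
rewrite fset_set_image //.
have/card_in_imfsetP/eqP -> : {in fset_set [set x | P x] &, injective h}.
  by move=> x y; rewrite !memP; apply: h_inj.
rewrite cardE; apply: perm_size; apply: uniq_perm; rewrite ?fset_uniq ?enum_uniq //.
by move=> x; rewrite mem_enum; exact: memP.
Qed.

Section CountingClasses.
Variables (F : finFieldType) (zeta : F) (d1 d2 n : nat).
Hypothesis zeta_prim : 3.-primitive_root zeta.
Hypothesis deg3n : (d1 + 2 * d2 = n * 3)%N.
Implicit Types f g : {poly F}.

Lemma isomorphic_curves_refl f : isomorphic_curves zeta f f.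
Proof. exists id; exact: curve_iso_id. Qed.

Lemma isomorphic_curves_sym f g : isomorphic_curves zeta f g -> isomorphic_curves zeta g f.
Proof.
move=> [phi hphi]; have [[psi K1 K2] _ _ _ _] := hphi.
by exists psi; exact: curve_iso_inv hphi K1 K2.
Qed.

Lemma isomorphic_curves_trans f g h : isomorphic_curves zeta f g ->
  isomorphic_curves zeta g h -> isomorphic_curves zeta f h.
Proof.
move=> [phi hphi] [psi hpsi]; exists (psi \o phi); exact: curve_iso_comp hphi hpsi.
Qed.

Definition iso_params f g : pred (iso_param F) :=
  fun x => valid_param x && (model_of d1 d2 x f == g).

Lemma curve_iso_set f g : Fhat_br d1 d2 f -> Fhat_br d1 d2 g ->
  [set phi : function_field f -> function_field g | curve_iso zeta phi] =
  (fun x => @iso_of F n x f g) @` [set x | iso_params f g x].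
Proof.
move=> hf hg; apply/seteqP; split=> [phi hphi|_ [x /andP[vx /eqP xg] <-]].
  have [x [vx xg] ->] := iso_of_surj zeta_prim deg3n hf hg hphi.
  by exists x => //; rewrite /iso_params /= vx xg eqxx.
by rewrite -{}xg in hg *; exact: (@iso_of_iso F zeta d1 d2 n deg3n x f vx hf).
Qed.

Lemma card_iso_params f g : Fhat_br d1 d2 f -> Fhat_br d1 d2 g ->
  #|` fset_set [set phi : function_field f -> function_field g | curve_iso zeta phi]| =
  #|iso_params f g|.
Proof.
move=> hf hg; rewrite curve_iso_set //; apply: card_fset_set_image => x y.
by move=> /andP[vx _] /andP[vy _]; apply: iso_of_inj.
Qed.

Lemma finite_curve_iso f g : Fhat_br d1 d2 f -> Fhat_br d1 d2 g ->
  finite_set [set phi : function_field f -> function_field g | curve_iso zeta phi].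
Proof.
by move=> hf hg; rewrite curve_iso_set //; apply: finite_image; exact: finite_finset.
Qed.

(** Composition with one fixed isomorphism identifies the automorphisms of [f] with the isomorphisms
    from [f] to [g]. *)
Lemma card_iso_Aut f g : Fhat_br d1 d2 f -> Fhat_br d1 d2 g -> isomorphic_curves zeta f g ->
  #|iso_params f g| = card_curve_Aut zeta f.
Proof.
move=> hf hg [phi hphi]; rewrite -(card_iso_params hf hg).
have [[psi K1 K2] _ _ _ _] := hphi.
have E : [set th : function_field f -> function_field g | curve_iso zeta th] =
    (fun th => phi \o th) @` [set th : function_field f -> function_field f | curve_iso zeta th].
  apply/seteqP; split=> [th hth|_ [th hth <-]]; last exact: curve_iso_comp hth hphi.
  exists (psi \o th).
    exact: curve_iso_comp hth (curve_iso_inv hphi K1 K2).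
  by apply/funext => u; exact: K2.
rewrite E (fset_set_image _ (finite_curve_iso hf hf)).
apply/eqP/card_in_imfsetP => th1 th2 _ _ e; apply/funext => u.
apply: (can_inj K1); exact: (congr1 (fun h => h u) e).
Qed.

Lemma iso_params_nonempty f g x : Fhat_br d1 d2 f -> Fhat_br d1 d2 g ->
  iso_params f g x -> isomorphic_curves zeta f g.
Proof.
move=> hf hg ix; exists (@iso_of F n x f g).
have : ((fun x => @iso_of F n x f g) @` [set x | iso_params f g x]) (@iso_of F n x f g).
  by exists x.
by rewrite -(curve_iso_set hf hg).
Qed.

Definition all_models : seq {poly F} :=
  [seq polyn r | r <- enum [pred r : {poly_((d1 + 2 * d2).+1) F} | `[< Fhat_br d1 d2 (polyn r) >]]].

Lemma all_models_uniq : uniq all_models.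
Proof. by rewrite map_inj_uniq ?enum_uniq //; exact: val_inj. Qed.

Lemma all_modelsP f : reflect (Fhat_br d1 d2 f) (f \in all_models).
Proof.
apply: (iffP mapP) => [[r + ->]|hf]; first by rewrite mem_enum => /asboolP.
have E : polyn (npolyp (d1 + 2 * d2).+1 f) = f.
  rewrite npolypK //; exact: (Fhat_br_size hf).
exists (npolyp (d1 + 2 * d2).+1 f); last exact: esym E.
by rewrite mem_enum inE E.
Qed.

Definition num_params := #|[pred x : iso_param F | valid_param x]|.

Lemma num_params_gt0 : (0 < num_params)%N.
Proof.
apply/card_gt0P; exists (1, 0, 0, 1, 1).
by rewrite !inE /= mulr1 mulr0 subr0 oner_eq0 /moebius_normal !eqxx /= orbT.
Qed.

(** This plays the role of orbit-stabilizer: every parameter sends [f] to some model of its class,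
    and each such model is reached by as many parameters as [f] has automorphisms. *)
Lemma class_card f : Fhat_br d1 d2 f ->
  num_params = (card_curve_Aut zeta f *
    count (fun g => `[< isomorphic_curves zeta f g >]) all_models)%N.
Proof.
move=> hf.
transitivity (\sum_(g <- all_models) #|iso_params f g|)%N.
  rewrite /num_params -sum1_card.
  rewrite (eq_bigr (fun x => \sum_(g <- all_models | model_of d1 d2 x f == g) 1)%N); last first.
    move=> x vx; have hx : model_of d1 d2 x f \in all_models.
      by apply/all_modelsP; exact: model_of_br.
    by rewrite big_pred1_uniq // all_models_uniq.
  rewrite (exchange_big_dep predT) //=; apply: eq_bigr => g _.
  by rewrite -sum1_card; apply: eq_bigl => x; rewrite inE.
rewrite -sum1_count big_distrr /= [RHS]big_mkcond big_seq [RHS]big_seq.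
apply: eq_bigr => g /all_modelsP hg; rewrite muln1.
case: asboolP => fg; first by rewrite card_iso_Aut.
apply/eqP; rewrite -leqn0 leqNgt; apply/negP => /card_gt0P[x xi].
by apply: fg; exact: iso_params_nonempty xi.
Qed.

Local Notation cl := (curve_class zeta d1 d2).

Lemma curve_class_eq f g : Fhat_br d1 d2 f -> Fhat_br d1 d2 g ->
  (cl f = cl g) <-> isomorphic_curves zeta f g.
Proof.
move=> hf hg; split=> [e|fg].
  have : cl g g := conj hg (isomorphic_curves_refl g).
  by rewrite -e => -[_].
apply/seteqP; split=> h [hh H].
  exact: conj hh (isomorphic_curves_trans (isomorphic_curves_sym fg) H).
exact: conj hh (isomorphic_curves_trans fg H).
Qed.

Lemma model_curve_class f : Fhat_br d1 d2 f ->
  Fhat_br d1 d2 (model (cl f)) /\ isomorphic_curves zeta f (model (cl f)).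
Proof.
move=> hf; have H : exists g, cl f g by exists f; exact: conj hf (isomorphic_curves_refl f).
exact: xgetPex H.
Qed.

(** By [class_card] the weight 1/|Aut| of a class is its number of models divided by a constant, so
    the weighted sum spreads evenly over the models. *)
Lemma weighted_sumE (R : realType) (h : set {poly F} -> R[i]) :
  weighted_sum zeta d1 d2 h = (\sum_(f <- all_models) h (cl f)) / num_params%:R.
Proof.
set Cs := undup [seq cl f | f <- all_models].
have moduliE : trigonal_moduli zeta d1 d2 = [set` Cs].
  apply/seteqP; split=> [_ [f hf <-]|C] /=.
    by rewrite mem_undup; apply: map_f; apply/all_modelsP.
  by rewrite mem_undup => /mapP[f /all_modelsP hf ->]; exists f.
rewrite /weighted_sum moduliE -(fsbig_seq _ _ (undup_uniq _)) /=.
rewrite mulr_suml.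
transitivity (\sum_(f <- all_models) \sum_(C <- Cs | cl f == C) h C / num_params%:R).
  rewrite (exchange_big_dep predT) //= big_seq [RHS]big_seq; apply: eq_bigr => C.
  rewrite mem_undup => /mapP[f /all_modelsP hf ->].
  have [hm im] := model_curve_class hf.
  rewrite big_const_seq iter_addr_0 -[RHS]mulr_natr -!mulrA; congr (_ * _).
  rewrite (class_card hm) natrM.
  have -> : count (fun g => `[< isomorphic_curves zeta (model (cl f)) g >]) all_models =
      count (fun g => cl g == cl f) all_models.
    apply: eq_in_count => g /all_modelsP hg.
    have E := (curve_class_eq hf hm).2 im; have EG := curve_class_eq hm hg.
    apply/idP/idP => [/asboolP H|/eqP H].
      by have H2 := etrans E (EG.2 H); apply/eqP; exact: esym H2.
    by apply/asboolP; exact: EG.1 (etrans (esym E) (esym H)).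
  have c0 : (count (fun g => cl g == cl f) all_models)%:R != 0 :> R[i].
    rewrite pnatr_eq0 -lt0n -has_count; apply/hasP; exists f => //.
    exact/all_modelsP.
  by rewrite invfM -mulrA mulVf // mulr1.
rewrite big_seq [RHS]big_seq; apply: eq_bigr => f fm.
have clm : cl f \in Cs by rewrite mem_undup map_f.
by rewrite big_pred1_uniq // undup_uniq.
Qed.

Lemma momentE (R : realType) (chi : F -> R[i]) j k :
  moment zeta chi d1 d2 j k = (size all_models)%:R^-1 *
    \sum_(f <- all_models)
      (- trace_chi chi d1 d2 (cl f) / sqrt_q1 R F) ^+ j *
      (- trace_chibar chi d1 d2 (cl f) / sqrt_q1 R F) ^+ k.
Proof.
rewrite /moment /weighted_card !weighted_sumE.
have p0 : num_params%:R != 0 :> R[i] by rewrite pnatr_eq0 -lt0n num_params_gt0.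
rewrite big_const_seq count_predT iter_addr_0 invfM invrK -mulrA; congr (_ * _).
by rewrite mulrC divfK.
Qed.

End CountingClasses.

Lemma Fhat_size (F : finFieldType) a b (f : {poly F}) : Fhat a b f -> size f = (a + 2 * b).+1.
Proof.
move=> /FhatP[A [B [-> sA sB sAB]]]; have := sqf_neq0 sAB.
rewrite mulf_eq0 negb_or => /andP[A0 B0].
rewrite size_mul ?expf_neq0 // sA.
have : (size (B ^+ 2)).-1 = (b * 2)%N by rewrite size_exp sB.
have : (size (B ^+ 2) > 0)%N by rewrite size_poly_gt0 expf_neq0.
by move: (size (B ^+ 2)); clear => z; lia.
Qed.

(** Reading the value at infinity as a coefficient of fixed index treats the three families alike:
    in the two smaller ones the degree is too low and the coefficient is 0. *)
Lemma value_infinity (F : finFieldType) d1 d2 (f : {poly F}) : Fhat_br d1 d2 f ->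
  value_P1 d1 d2 f None = f`_(d1 + 2 * d2).
Proof.
move=> hf; rewrite /value_P1; case: ifPn => [/set_mem hf'|nf].
  by rewrite lead_coefE (Fhat_size hf').
apply/esym; apply: nth_default.
have {}nf : ~ Fhat d1 d2 f by move=> H; move/negP: nf; apply; exact/mem_set.
case: hf => [[//|[d0 /Fhat_size ->]]|[d0 /Fhat_size ->]]; move: d0; clear; lia.
Qed.

(** * Independence of the point sum from the chosen model *)

Section TraceInvariance.
Variables (R : realType) (F : finFieldType) (zeta : F) (chi : F -> R[i]) (d1 d2 n : nat).
Hypothesis zeta_prim : 3.-primitive_root zeta.
Hypothesis deg3n : (d1 + 2 * d2 = n * 3)%N.
Hypothesis chi_cubic : cubic_character chi.
Implicit Types f g : {poly F}.

Lemma chi_cube x y : x != 0 -> chi (x ^+ 3 * y) = chi y.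
Proof.
have [_ c1 cM c3 _] := chi_cubic; move=> x0.
have e3 : chi (x ^+ 3) = chi x ^+ 3 by rewrite !exprS expr0 !mulr1 !cM.
by rewrite cM e3 c3 // mul1r.
Qed.

(** The binary form of degree d1 + 2 d2 at a pair of homogeneous coordinates. As 3 divides the
    degree, rescaling changes it by a cube, so its cubic character is well defined on the projective
    line. *)
Definition hvalue f (p : F * F) : F :=
  \sum_(i < (d1 + 2 * d2).+1) f`_i * (p.1 ^+ i * p.2 ^+ (d1 + 2 * d2 - i)).

Definition homog (x : option F) : F * F := if x is Some y then (y, 1) else (1, 0).

Definition proj_point (p : F * F) : option F := if p.2 == 0 then None else Some (p.1 / p.2).

Lemma hvalue_scale f c (p : F * F) :
  hvalue f (c * p.1, c * p.2) = c ^+ (d1 + 2 * d2) * hvalue f p.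
Proof.
rewrite /hvalue mulr_sumr; apply: eq_bigr => i _ /=.
have iN : (i <= d1 + 2 * d2)%N by rewrite -ltnS.
have -> : c ^+ (d1 + 2 * d2) = c ^+ i * c ^+ (d1 + 2 * d2 - i) by rewrite -exprD subnKC.
rewrite !exprMn; move: (c ^+ i) (c ^+ (d1 + 2 * d2 - i)) (p.1 ^+ i) (p.2 ^+ (d1 + 2 * d2 - i)) => u v w z.
ring.
Qed.

Lemma chi_hvalue_scale f c (p : F * F) : c != 0 ->
  chi (hvalue f (c * p.1, c * p.2)) = chi (hvalue f p).
Proof. by move=> c0; rewrite hvalue_scale deg3n exprM chi_cube ?expf_neq0. Qed.

Lemma homog_proj (p : F * F) : p != (0, 0) ->
  exists2 c, c != 0 & p = (c * (homog (proj_point p)).1, c * (homog (proj_point p)).2).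
Proof.
case: p => s t; rewrite /proj_point /=; case: (eqVneq t 0) => [-> H|t0 _] /=.
  by exists s; [apply: contraNneq H => -> | rewrite mulr1 mulr0].
by exists t => //; rewrite mulr1 mulrC divfK.
Qed.

Lemma hvalue_homog f x : Fhat_br d1 d2 f -> hvalue f (homog x) = value_P1 d1 d2 f x.
Proof.
move=> hf; case: x => [y|]; rewrite /hvalue.
  rewrite /value_P1 (horner_coef_wide _ (Fhat_br_size hf)).
  by apply: eq_bigr => i _; rewrite /= expr1n mulr1.
rewrite value_infinity // big_ord_recr /= big1 ?add0r => [|i _].
  by rewrite subnn expr1n expr0 !mulr1.
by rewrite expr0n subn_eq0 leqNgt ltn_ord !mulr0.
Qed.

Definition moebius_point (x : iso_param F) (y : option F) : F * F :=
  let: (a, b, c, d, l) := x in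
  (a * (homog y).1 + b * (homog y).2, c * (homog y).1 + d * (homog y).2).

Lemma moebius_point_neq0 x y : valid_param x -> moebius_point x y != (0, 0).
Proof.
case: x => [[[[a b] c] d] l] /and3P[D _ _].
have N : homog y != (0, 0) by case: y => [y|] /=; rewrite xpair_eqE oner_eq0 ?andbF.
apply: contraNneq N; rewrite /moebius_point; case: (homog y) => s t /= [E1 E2].
have e1 : (a * d - b * c) * s = 0.
  have -> : (a * d - b * c) * s = d * (a * s + b * t) - b * (c * s + d * t) by ring.
  by rewrite E1 E2 !mulr0 subrr.
have e2 : (a * d - b * c) * t = 0.
  have -> : (a * d - b * c) * t = a * (c * s + d * t) - c * (a * s + b * t) by ring.
  by rewrite E1 E2 !mulr0 subrr.
by move/eqP: e1; move/eqP: e2; rewrite !mulf_eq0 (negbTE D) /= => /eqP -> /eqP ->.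
Qed.

Lemma moebius_point_inj x : valid_param x -> injective (fun y => proj_point (moebius_point x y)).
Proof.
move=> vx y y' E.
have [c c0 H] := homog_proj (moebius_point_neq0 y vx).
have [c' c0' H'] := homog_proj (moebius_point_neq0 y' vx).
rewrite E in H; move: H H'; set h := homog _ => H H'.
have cross : (moebius_point x y).1 * (moebius_point x y').2 =
    (moebius_point x y').1 * (moebius_point x y).2.
  by rewrite H H' /=; ring.
case: x vx cross {E H H' h} => [[[[a b] e] d] l] /and3P[D _ _].
rewrite /moebius_point /=.
set s := (homog y).1; set t := (homog y).2; set s' := (homog y').1; set t' := (homog y').2.
move=> /eqP; rewrite -subr_eq0.
have -> : (a * s + b * t) * (e * s' + d * t') - (a * s' + b * t') * (e * s + d * t) =
   (a * d - b * e) * (s * t' - s' * t) by ring.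
rewrite mulf_eq0 (negbTE D) /= /s /t /s' /t'.
case: y {s t c c0} => [y|]; case: y' {s' t' c' c0'} => [y'|] //=;
  rewrite ?(mulr1, mul1r, mulr0, mul0r, subr0, sub0r, oppr_eq0, oner_eq0) // subr_eq0.
by move/eqP ->.
Qed.

Lemma hvalue_model x f y : hvalue (model_of d1 d2 x f) (homog y) =
   let: (a, b, c, d, l) := x in l ^+ 3 * hvalue f (moebius_point x y).
Proof.
case: x => [[[[a b] c] d] l]; rewrite /model_of.
case: y => [y|].
  transitivity ((l ^+ 3 *: hom (lin a b) (lin c d) (d1 + 2 * d2) f).[y]).
    rewrite (@horner_coef_wide _ (d1 + 2 * d2).+1).
      by rewrite /hvalue; apply: eq_bigr => i _; rewrite /= expr1n mulr1.
    rewrite (leq_trans (size_scale_leq _ _)) //.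
    have := @size_hom F (lin a b) (lin c d) 1 (d1 + 2 * d2) f (size_lin _ _) (size_lin _ _).
    by rewrite mul1n.
  rewrite hornerZ /hom horner_sum; congr (_ * _); apply: eq_bigr => i _.
  by rewrite hornerZ hornerM !horner_exp !horner_lin /= !mulr1.
rewrite {1}/hvalue big_ord_recr /= big1 ?add0r => [|i _]; last first.
  by rewrite expr0n subn_eq0 leqNgt ltn_ord !mulr0.
rewrite subnn !expr1n !mulr1 coefZ; congr (_ * _).
have := @coef_hom_top F (lin a b) (lin c d) 1 (d1 + 2 * d2) f (size_lin _ _) (size_lin _ _).
rewrite mul1n => ->; apply: eq_bigr => i _.
by rewrite !coef_lin /= !mulr0 !addr0 ?mulr1.
Qed.

Lemma chi_model x f y : valid_param x -> Fhat_br d1 d2 f ->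
  chi (value_P1 d1 d2 (model_of d1 d2 x f) y) =
  chi (value_P1 d1 d2 f (proj_point (moebius_point x y))).
Proof.
move=> vx hf; rewrite -!hvalue_homog //; last exact: model_of_br.
have [c c0 H] := homog_proj (moebius_point_neq0 y vx).
rewrite hvalue_model; case: x vx H => [[[[a b] e] d] l] vx H.
have /and3P[_ _ l0] := vx.
by rewrite chi_cube // {1}H chi_hvalue_scale.
Qed.

Definition trace_sum f : R[i] := \sum_(x : option F) chi (value_P1 d1 d2 f x).

(** A Moebius map permutes the rational points of the projective line and l^3 is a cube. This is
    needed because the trace of a class is defined through an arbitrary choice of model. *)
Lemma trace_sum_isomorphic f g : Fhat_br d1 d2 f -> Fhat_br d1 d2 g ->
  isomorphic_curves zeta f g -> trace_sum g = trace_sum f.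
Proof.
move=> hf hg [phi hphi].
have [x [vx xg] _] := @iso_of_surj F zeta zeta_prim d1 d2 n deg3n f g phi hf hg hphi.
rewrite -{}xg; clear phi hphi hg.
rewrite /trace_sum [RHS](reindex_inj (moebius_point_inj vx)) /=.
by apply: eq_bigr => y _; exact: chi_model.
Qed.

Lemma moment_trace_sum j k :
  moment zeta chi d1 d2 j k = (size (all_models F d1 d2))%:R^-1 *
    \sum_(f <- all_models F d1 d2)
      (trace_sum f / sqrt_q1 R F) ^+ j * ((trace_sum f)^*%C / sqrt_q1 R F) ^+ k.
Proof.
rewrite (momentE zeta_prim deg3n); congr (_ * _).
rewrite big_seq [RHS]big_seq; apply: eq_bigr => f /all_modelsP hf.
have [hm im] := model_curve_class zeta hf.
rewrite /trace_chibar /trace_chi -/(trace_sum _) (trace_sum_isomorphic hf hm im).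
by rewrite opprK rmorphN /= opprK.
Qed.

End TraceInvariance.

(** * Sums over models as sums over a leading coefficient and a coprime square-free pair *)

Section ModelParametrization.
Variable F : finFieldType.
Implicit Types p g u : {poly F}.

(** After division by the gcd of [g] and [g'], the square of each cofactor divides a square-free
    polynomial, so both cofactors are constants. *)
Lemma square_part_unique p p' g g' : sqf p -> sqf p' -> g != 0 -> g' != 0 ->
  p * g ^+ 2 = p' * g' ^+ 2 -> g %= g'.
Proof.
move=> sp sp' g0 g0' E; set d := gcdp g g'.
have d0 : d != 0 by rewrite gcdp_eq0 negb_and g0.
have [gE gE'] : g = g %/ d * d /\ g' = g' %/ d * d by rewrite !divpK ?dvdp_gcdl ?dvdp_gcdr.
have cop : coprimep (g %/ d) (g' %/ d) by apply: coprimep_div_gcd; rewrite g0.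
move: gE gE' cop; move: (g %/ d) (g' %/ d) => a b gE gE' cop.
have {}E : p * a ^+ 2 = p' * b ^+ 2.
  apply: (mulIf (expf_neq0 2 d0)).
  by rewrite -[LHS]mulrA -[RHS]mulrA -[a ^+ 2 * _]exprMn -[b ^+ 2 * _]exprMn -gE -gE'.
have cc : coprimep (a ^+ 2) (b ^+ 2) by rewrite coprimep_expl // coprimep_expr.
have a1 : size a = 1%N.
  by apply: (sqfP _ sp'); rewrite -(Gauss_dvdpl p' cc) -E dvdp_mull.
have b1 : size b = 1%N.
  by apply: (sqfP _ sp); rewrite coprimep_sym in cc; rewrite -(Gauss_dvdpl p cc) E dvdp_mull.
move/eqP: a1 => /size_poly1P[k k0 ak]; move/eqP: b1 => /size_poly1P[k' k0' bk'].
by rewrite gE gE' ak bk' !mul_polyC (eqp_trans (eqp_scale _ k0)) // eqp_sym eqp_scale.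
Qed.

Definition coprime_pairs a b : seq ({poly F} * {poly F}) :=
  [seq t <- [seq (g, u) | g <- monics F a, u <- monics F b] |
    [&& sqf t.1, sqf t.2 & coprimep t.1 t.2]].

Definition Fhat_seq a b : seq {poly F} :=
  [seq x *: (t.1 * t.2 ^+ 2) | x <- [seq x <- enum F | x != 0], t <- coprime_pairs a b].

Lemma coprime_pairsP a b g u : reflect
  [/\ g \in monics F a, u \in monics F b, sqf g, sqf u & coprimep g u]
  ((g, u) \in coprime_pairs a b).
Proof.
rewrite mem_filter /=; apply: (iffP andP) => [[/and3P[sg su c]]|[hg hu sg su c]].
  by move=> /allpairsP[[g' u'] /= [hg hu [eg eu]]]; split=> //; rewrite ?eg ?eu.
by rewrite sg su c; split=> //; apply/allpairsP; exists (g, u).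
Qed.

Lemma Fhat_seqP a b f : reflect (Fhat a b f) (f \in Fhat_seq a b).
Proof.
apply: (iffP allpairsP) => [[[x [g u]] /= [+ + ->]]|].
  rewrite mem_filter => /andP[x0 _] /coprime_pairsP[/monicsP[gm sg] /monicsP[um su] /sqfP hg /sqfP hu c].
  by exists x, g, u.
move=> [x [g [u [-> x0 [gm hg sg] [um hu su] c]]]]; exists (x, (g, u)); split=> //=.
  by rewrite mem_filter x0 mem_enum.
by apply/coprime_pairsP; split=> //; try exact/monicsP; exact/sqfP.
Qed.

Lemma Fhat_seq_uniq a b : uniq (Fhat_seq a b).
Proof.
apply: allpairs_uniq.
- by rewrite filter_uniq // enum_uniq.
- rewrite filter_uniq //; apply: allpairs_uniq; rewrite ?monics_uniq //.
  by move=> [? ?] [? ?] _ _ [-> ->].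
move=> [x [g u]] [x' [g' u']] /allpairsP[[y [h v]] /= [+ + [-> -> ->]]].
rewrite mem_filter => /andP[y0 _] /coprime_pairsP[/monicsP[hm _] /monicsP[vm _] sh _ _].
move=> /allpairsP[[y' [h' v']] /= [+ + [-> -> ->]]].
rewrite mem_filter => /andP[y0' _] /coprime_pairsP[/monicsP[hm' _] /monicsP[vm' _] sh' _ _] E.
have lc z (p r : {poly F}) : p \is monic -> r \is monic -> lead_coef (z *: (p * r ^+ 2)) = z.
  by move=> pm rm; rewrite lead_coefZ lead_coefM (monicP pm) mul1r lead_coef_exp (monicP rm) expr1n mulr1.
have yy : y = y' by rewrite -(lc y h v hm vm) E lc.
move: E; rewrite -yy => /(scalerI y0) E.
have vv : v = v'.
  apply/eqP; rewrite -eqp_monic //.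
  exact: (square_part_unique sh sh' (monic_neq0 vm) (monic_neq0 vm') E).
congr (_, (_, _)) => //.
by move: E; rewrite -vv => /(mulIf (expf_neq0 2 (monic_neq0 vm))).
Qed.

Lemma sum_Fhat_seq (V : nmodType) (h : {poly F} -> V) a b :
  \sum_(f <- Fhat_seq a b) h f =
  \sum_(x | x != 0) \sum_(g <- monics F a | sqf g)
    \sum_(u <- monics F b | sqf u && coprimep g u) h (x *: (g * u ^+ 2)).
Proof.
rewrite big_allpairs_dep big_filter big_enum_cond; apply: eq_bigr => x _.
rewrite big_filter big_mkcond big_allpairs [RHS]big_mkcond.
apply: eq_bigr => g _ /=; case: (sqf g) => /=; last by rewrite big1.
by rewrite -big_mkcond.
Qed.

(** The three families are disjoint because their members have degrees D, D - 1 and D - 2 for D = d1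
    + 2 d2. *)
Lemma sum_all_models (V : nmodType) (h : {poly F} -> V) d1 d2 :
  \sum_(f <- all_models F d1 d2) h f =
  \sum_(f <- Fhat_seq d1 d2) h f
  + (if (0 < d1)%N then \sum_(f <- Fhat_seq d1.-1 d2) h f else 0)
  + (if (0 < d2)%N then \sum_(f <- Fhat_seq d1 d2.-1) h f else 0).
Proof.
pose s1 := if (0 < d1)%N then Fhat_seq d1.-1 d2 else [::].
pose s2 := if (0 < d2)%N then Fhat_seq d1 d2.-1 else [::].
have -> : (if (0 < d1)%N then \sum_(f <- Fhat_seq d1.-1 d2) h f else 0) = \sum_(f <- s1) h f.
  by rewrite /s1; case: ifP; rewrite ?big_nil.
have -> : (if (0 < d2)%N then \sum_(f <- Fhat_seq d1 d2.-1) h f else 0) = \sum_(f <- s2) h f.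
  by rewrite /s2; case: ifP; rewrite ?big_nil.
have m1 f : f \in s1 -> (0 < d1)%N /\ Fhat d1.-1 d2 f.
  by rewrite /s1; case: ifP => // _ /Fhat_seqP.
have m2 f : f \in s2 -> (0 < d2)%N /\ Fhat d1 d2.-1 f.
  by rewrite /s2; case: ifP => // _ /Fhat_seqP.
rewrite -!big_cat; apply: perm_big; apply: uniq_perm.
- exact: all_models_uniq.
- rewrite !cat_uniq Fhat_seq_uniq /=.
  have -> : uniq s1 by rewrite /s1; case: ifP => // _; exact: Fhat_seq_uniq.
  have -> : uniq s2 by rewrite /s2; case: ifP => // _; exact: Fhat_seq_uniq.
  rewrite !andbT; apply/andP; split; apply/hasPn => f.
    move=> /m1[d0 /Fhat_size sf]; apply/negP => /Fhat_seqP /Fhat_size.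
    by rewrite sf; move: d0; clear; lia.
  move=> /m2[d0 /Fhat_size sf]; rewrite mem_cat negb_or; apply/andP; split; apply/negP.
    by move=> /Fhat_seqP /Fhat_size; rewrite sf; move: d0; clear; lia.
  by move=> /m1[d0' /Fhat_size]; rewrite sf; move: d0 d0'; clear; lia.
move=> f; rewrite !mem_cat; apply/all_modelsP/idP.
  move=> [[hf|[d0 hf]]|[d0 hf]].
  - by apply/orP; left; apply/orP; left; exact/Fhat_seqP.
  - by apply/orP; left; apply/orP; right; rewrite /s1 d0; exact/Fhat_seqP.
  - by apply/orP; right; rewrite /s2 d0; exact/Fhat_seqP.
move=> /orP[/orP[/Fhat_seqP hf|/m1 hf]|/m2 hf]; [left; left|left; right|right] => //.
Qed.

End ModelParametrization.

(** * The random moment *)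

Lemma big_option (V : Type) (idx : V) (op : Monoid.com_law idx) (I : finType) (f : option I -> V) :
  \big[op/idx]_m f m = op (f None) (\big[op/idx]_i f (Some i)).
Proof.
rewrite (bigD1 None) //= (reindex_omap Some id) /=; last by case.
by congr (op _ _); apply: eq_bigl => i; rewrite eqxx.
Qed.

Section Atoms.
Context {d : measure_display} {T : measurableType d} {R : realType}.
Variable P : probability T R.

(** Disjoint events of total probability 1 carry the law, so [f] agrees almost everywhere with the
    simple function taking the value [c i] on [E i]. *)
Lemma expectation_atoms (I : finType) (E : I -> set T) (p c : I -> R) (f : T -> R) :
  (forall i, measurable (E i)) -> (forall i, P (E i) = (p i)%:E) ->
  (forall i j t, E i t -> E j t -> i = j) -> \sum_i p i = 1 ->
  measurable_fun [set: T] f -> (forall i t, E i t -> f t = c i) ->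
  ('E_P[f] = (\sum_i c i * p i)%:E)%E.
Proof.
move=> mE PE Edis p1 mf fE; rewrite unlock.
pose g t : R := \sum_i c i * \1_(E i) t.
have intE i : P.-integrable [set: T] (fun t => (\1_(E i) t)%:E) by exact: integrable_indic.
have gE t : (g t)%:E = (\sum_i ((c i)%:E * (\1_(E i) t)%:E))%E.
  by rewrite /g -sumEFin.
transitivity (\int[P]_t (g t)%:E)%E; last first.
  under eq_integral do rewrite gE.
  rewrite integral_sum //= => [|i]; last exact: integrableZl.
  rewrite -sumEFin; apply: eq_bigr => i _.
  rewrite integralZl // integral_indic // setIT EFinM; congr (_ * _)%E; exact: PE.
have mU : measurable (\bigcup_(i in [set` enum I]) E i).
  exact: fin_bigcup_measurable.
have PU : P (\bigcup_(i in [set` enum I]) E i) = 1%E.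
  rewrite measure_fin_bigcup //.
  - rewrite -(fsbig_seq _ _ (enum_uniq I)) /= big_enum /=.
    by rewrite (eq_bigr (fun i => (p i)%:E)) ?sumEFin ?p1 // => i _; exact: PE.
  - by move=> i j _ _ [t [ti tj]]; exact: Edis ti tj.
apply: ae_eq_integral => //.
- exact/measurable_realfun.measurable_EFinP.
- apply/measurable_realfun.measurable_EFinP; apply: measurable_sum => i.
  by apply: measurable_realfun.measurable_funM => //; exact: measurable_realfun.measurable_indic.
exists (~` \bigcup_(i in [set` enum I]) E i); split.
- exact: measurableC.
- by apply: etrans (probability_setC P mU) _; rewrite PU subee.
move=> t /= H; apply: contra_not H => -[i _ ti] _.
rewrite (fE i t ti) /g (bigD1 i) //= big1 => [|j ji].
  by rewrite addr0 indicE mem_set // mulr1.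
rewrite indicE memNset ?mulr0 // => tj.
by move/eqP: ji; apply; exact: Edis tj ti.
Qed.

Lemma complex_rvP (Z : T -> R[i]) : complex_rv Z <->
  measurable_fun [set: T] (fun t => complex.Re (Z t) : R) /\
  measurable_fun [set: T] (fun t => complex.Im (Z t) : R).
Proof. exact: (measurable_fun_pairP (complex_to_pair \o Z)). Qed.

Lemma complex_rv_cst z : complex_rv (fun _ : T => z : R[i]).
Proof. by apply/complex_rvP; split; exact: measurable_cst. Qed.

Lemma complex_rvD (Z W : T -> R[i]) :
  complex_rv Z -> complex_rv W -> complex_rv (fun t => Z t + W t).
Proof.
move=> /complex_rvP[Z1 Z2] /complex_rvP[W1 W2]; apply/complex_rvP; split.
- rewrite (_ : (fun _ => _) = (fun t => complex.Re (Z t) + complex.Re (W t))).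
    exact: measurable_realfun.measurable_funD.
  by apply/funext => t; case: (Z t) => a b; case: (W t).
- rewrite (_ : (fun _ => _) = (fun t => complex.Im (Z t) + complex.Im (W t))).
    exact: measurable_realfun.measurable_funD.
  by apply/funext => t; case: (Z t) => a b; case: (W t).
Qed.

Lemma complex_rvM (Z W : T -> R[i]) :
  complex_rv Z -> complex_rv W -> complex_rv (fun t => Z t * W t).
Proof.
move=> /complex_rvP[Z1 Z2] /complex_rvP[W1 W2]; apply/complex_rvP; split.
- rewrite (_ : (fun _ => _) = (fun t =>
     complex.Re (Z t) * complex.Re (W t) - complex.Im (Z t) * complex.Im (W t))).
    by apply: measurable_realfun.measurable_funB; exact: measurable_realfun.measurable_funM.
  by apply/funext => t; case: (Z t) => a b; case: (W t).
- rewrite (_ : (fun _ => _) = (fun t =>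
     complex.Re (Z t) * complex.Im (W t) + complex.Im (Z t) * complex.Re (W t))).
    by apply: measurable_realfun.measurable_funD; exact: measurable_realfun.measurable_funM.
  by apply/funext => t; case: (Z t) => a b; case: (W t).
Qed.

Lemma complex_rv_conj (Z : T -> R[i]) : complex_rv Z -> complex_rv (fun t => (Z t)^*).
Proof.
move=> /complex_rvP[Z1 Z2]; apply/complex_rvP; split.
- rewrite (_ : (fun _ => _) = (fun t => complex.Re (Z t))) //.
  by apply/funext => t; case: (Z t).
- rewrite (_ : (fun _ => _) = (fun t => - complex.Im (Z t))).
    exact: measurable_realfun.measurable_funN.
  by apply/funext => t; case: (Z t).
Qed.

Lemma complex_rvX (Z : T -> R[i]) n : complex_rv Z -> complex_rv (fun t => Z t ^+ n).
Proof.
move=> hZ; elim: n => [|n IH]; first exact: (complex_rv_cst 1).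
rewrite (_ : (fun _ => _) = (fun t => Z t * Z t ^+ n)); first exact: complex_rvM.
by apply/funext => t; rewrite exprS.
Qed.

Lemma complex_rv_sum (I : Type) (r : seq I) (Z : I -> T -> R[i]) :
  (forall i, complex_rv (Z i)) -> complex_rv (fun t => \sum_(i <- r) Z i t).
Proof.
move=> hZ; elim: r => [|i r IH].
  rewrite (_ : (fun _ => _) = (fun=> 0)); first exact: complex_rv_cst.
  by apply/funext => t; rewrite big_nil.
rewrite (_ : (fun _ => _) = (fun t => Z i t + \sum_(i <- r) Z i t)); first exact: complex_rvD.
by apply/funext => t; rewrite big_cons.
Qed.

Lemma complex_expectation_atoms (I : finType) (E : I -> set T) (p : I -> R) (c : I -> R[i])
  (Z : T -> R[i]) :
  (forall i, measurable (E i)) -> (forall i, P (E i) = (p i)%:E) ->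
  (forall i j t, E i t -> E j t -> i = j) -> \sum_i p i = 1 ->
  complex_rv Z -> (forall i t, E i t -> Z t = c i) ->
  complex_expectation P Z = \sum_i c i * (p i)%:C.
Proof.
move=> mE PE Edis p1 /complex_rvP[Z1 Z2] ZE; rewrite /complex_expectation.
rewrite (expectation_atoms (c := fun i => complex.Re (c i)) mE PE Edis p1 Z1) => [|i t /ZE -> //].
rewrite (expectation_atoms (c := fun i => complex.Im (c i)) mE PE Edis p1 Z2) => [|i t /ZE -> //].
rewrite /=; apply/eqP; rewrite eq_complex /= (raddf_sum (@complex.Re R)) (raddf_sum (@complex.Im R)) /=.
apply/andP; split; apply/eqP; apply: eq_bigr => i _; case: (c i) => a b /=.
  by rewrite mulr0 subr0.
by rewrite mulr0 add0r.
Qed.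

Lemma measurable_singleton_pair (z : R[i]) :
  measurable [set complex_to_pair z].
Proof.
have -> : [set complex_to_pair z] =
    [set complex.Re z : measurableTypeR R] `*` [set complex.Im z : measurableTypeR R].
  by apply/seteqP; split=> [[a b] [-> ->]|[a b] [/= -> ->]].
by apply: measurableX; exact: measurable_set1.
Qed.

Lemma complex_to_pair_inj : injective (@complex_to_pair R).
Proof. by move=> [a b] [a' b'] [-> ->]. Qed.

Variables (omega : R[i]) (q : nat) (X : 'I_q.+1 -> T -> R[i]).
Hypothesis omega_prim : 3.-primitive_root omega.
Hypothesis X_iid : iid_trigonal P omega X.

Definition trigonal_value (m : option 'I_3) : R[i] := if m is Some e then omega ^+ e else 0.

Definition trigonal_prob (m : option 'I_3) : R :=
  if m is Some e then q%:R / (3 * (q%:R + 2)) else 2 / (q%:R + 2).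

Lemma trigonal_value_inj : injective trigonal_value.
Proof.
have w0 (e : nat) : omega ^+ e != 0.
  apply: expf_neq0; apply/eqP => w0; have := prim_expr_order omega_prim.
  by rewrite w0 expr0n /= => /eqP; rewrite eq_sym oner_eq0.
case=> [e|] [e'|] //= /eqP; last by rewrite eq_sym (negbTE (w0 _)).
  rewrite (eq_prim_root_expr omega_prim) => /eqP; rewrite !modn_small // => ee.
  by congr Some; exact: val_inj.
by rewrite (negbTE (w0 _)).
Qed.

Lemma sum_trigonal_prob : \sum_m trigonal_prob m = 1.
Proof.
rewrite big_option /= sumr_const card_ord.
have q0 : 0 <= q%:R :> R by exact: ler0n.
by rewrite /trigonal_prob -mulr_natr; field; lra.
Qed.

Lemma trigonal_probE i m : P [set t | X i t = trigonal_value m] = (trigonal_prob m)%:E.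
Proof. by have [_ _ /(_ i)[law0 law]] := X_iid; case: m => [m|] //=; exact: law. Qed.

Lemma random_momentE j k :
  random_moment P j k X =
  \sum_(v : {ffun 'I_q.+1 -> option 'I_3})
    (((Num.sqrt (q.+1)%:R : R)%:C)^-1 * \sum_i trigonal_value (v i)) ^+ j *
    (((Num.sqrt (q.+1)%:R : R)%:C)^-1 * \sum_i (trigonal_value (v i))^*%C) ^+ k *
    (\prod_i trigonal_prob (v i))%:C.
Proof.
have [rvX indep law] := X_iid.
(* Independence is applied to singletons: the atoms are the events that all the variables take
   prescribed values. *)
pose B (v : {ffun 'I_q.+1 -> option 'I_3}) i := [set complex_to_pair (trigonal_value (v i))].
have BE v i t : B v i (complex_to_pair (X i t)) <-> X i t = trigonal_value (v i).
  by split=> [/complex_to_pair_inj|->].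
pose E v := \bigcap_(i in [set` [set: 'I_q.+1]%SET]) [set t | B v i (complex_to_pair (X i t))].
have mB v i : measurable (B v i) by exact: measurable_singleton_pair.
have EB v i : [set t | B v i (complex_to_pair (X i t))] = [set t | X i t = trigonal_value (v i)].
  by apply/seteqP; split=> t /= /BE.
have inE v t i : E v t -> X i t = trigonal_value (v i).
  by move=> /(_ i) H; apply/BE; apply: H; rewrite /= finset.in_setT.
apply: (@complex_expectation_atoms _ E).
- move=> v; apply: fin_bigcap_measurable => // i _.
  by rewrite -[X in measurable X]setTI; apply: (rvX i).
- move=> v; rewrite /E (indep _ (B v)) //; congr (_%:E).
  rewrite (eq_bigl predT) => [|i]; last by rewrite finset.in_setT.
  by apply: eq_bigr => i _; rewrite EB trigonal_probE.
- move=> v w t Ev Ew; apply/ffunP => i; apply: trigonal_value_inj.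
  by rewrite -(inE v t i Ev) (inE w t i Ew).
- rewrite -(bigA_distr_bigA (fun=> trigonal_prob)) /=.
  by rewrite big1 // => i _; exact: sum_trigonal_prob.
- apply: complex_rvM; apply: complex_rvX; apply: complex_rvM; try exact: complex_rv_cst.
    exact: complex_rv_sum.
  by apply: complex_rv_sum => i; exact: complex_rv_conj.
- move=> v t Ev; congr (( _ * _ ) ^+ _ * (_ * _) ^+ _); apply: eq_bigr => i _.
    exact: inE Ev.
  by rewrite (inE v t i Ev).
Qed.

End Atoms.

(** * Expansion over tuples of points *)

Section Expansion.
Variables (R : realType) (I : finType).

Definition local_monomial a b (z : R[i]) : R[i] := z ^+ a * z^*%C ^+ b.

Lemma prod_count_mem (K : comNzRingType) (z : I -> K) (s : seq I) :
  \prod_(x <- s) z x = \prod_x z x ^+ count_mem x s.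
Proof.
elim: s => [|y s IH]; first by rewrite big_nil big1.
rewrite big_cons IH; under [RHS]eq_bigr => x _ do rewrite /= exprD.
rewrite big_split /=; congr (_ * _).
rewrite (bigD1 y) //= eqxx expr1 big1 ?mulr1 // => x.
by rewrite eq_sym => /negbTE ->; rewrite expr0.
Qed.

Lemma expand_power (K : comNzRingType) (z : I -> K) n :
  (\sum_x z x) ^+ n = \sum_(t : n.-tuple I) \prod_x z x ^+ count_mem x t.
Proof.
rewrite -[n in LHS]card_ord -prodr_const bigA_distr_bigA /=.
rewrite (reindex (fun t : n.-tuple I => [ffun i => tnth t i])) /=; last first.
  exists (fun f => [tuple f i | i < n]) => [t _|f _].
    by apply: eq_from_tnth => i; rewrite tnth_mktuple ffunE.
  by apply/ffunP => i; rewrite ffunE tnth_mktuple.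
apply: eq_bigr => t _; rewrite -prod_count_mem big_tuple.
by apply: eq_bigr => i _; rewrite ffunE.
Qed.

Lemma expand_moment (z : I -> R[i]) c j k :
  (c * \sum_x z x) ^+ j * (c * \sum_x (z x)^*%C) ^+ k =
  c ^+ (j + k) * \sum_(t : j.-tuple I) \sum_(u : k.-tuple I)
    \prod_x local_monomial (count_mem x t) (count_mem x u) (z x).
Proof.
rewrite !exprMn mulrACA -exprD !expand_power big_distrlr /=; congr (_ * _).
by apply: eq_bigr => t _; apply: eq_bigr => u _; rewrite -big_split.
Qed.

Definition congruent_counts (t u : seq I) : bool :=
  [forall x, count_mem x t == count_mem x u %[mod 3]].

Lemma sum_count_mem (s : seq I) : (\sum_x count_mem x s = size s)%N.
Proof.
elim: s => [|y s IH]; first by rewrite big1.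
rewrite /= big_split /= IH (bigD1 y) //= eqxx big1 // => x.
by rewrite eq_sym => /negbTE ->.
Qed.

Lemma congruent_counts_size t u : congruent_counts t u -> size t = size u %[mod 3].
Proof.
move=> /forallP H; rewrite -!sum_count_mem.
by elim/big_rec2: _ => // x m n _ IH; rewrite -modnDm IH (eqP (H x)) modnDm.
Qed.

Definition congruent_pairs j k : nat :=
  #|[set p : j.-tuple I * k.-tuple I | congruent_counts p.1 p.2]%SET|.

(** It is used with a point added once to both tuples, or three times to one of them; either
    operation preserves congruence mod 3 and gains a factor |I|. *)
Lemma congruent_pairs_extend j k j' k' (ext : I -> j.-tuple I * k.-tuple I -> j'.-tuple I * k'.-tuple I) :
  (forall x x' p p', ext x p = ext x' p' -> x = x' /\ p = p') ->
  (forall x (p : j.-tuple I * k.-tuple I), congruent_counts p.1 p.2 -> congruent_counts (ext x p).1 (ext x p).2) ->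
  (#|I| * congruent_pairs j k <= congruent_pairs j' k')%N.
Proof.
move=> ext_inj ext_good.
rewrite /congruent_pairs -cardsT -cardsX.
rewrite -(card_in_imset (f := fun z => ext z.1 z.2)); last first.
  by move=> [x p] [x' p'] _ _ /ext_inj[/= -> ->].
apply: subset_leq_card; apply/fintype.subsetP => _ /imsetP[[x p] + ->].
by rewrite !inE /= => H; exact: ext_good.
Qed.

Lemma congruent_pairsSS j k : (#|I| * congruent_pairs j k <= congruent_pairs j.+1 k.+1)%N.
Proof.
apply: (@congruent_pairs_extend _ _ _ _ (fun x p => ([tuple of x :: p.1], [tuple of x :: p.2]))).
  move=> x x' [t u] [t' u'] [-> e1 e2]; split=> //.
  by congr (_, _); apply: val_inj.
by move=> x p /forallP H; apply/forallP => y /=; rewrite eqn_modDl.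
Qed.

Lemma congruent_pairs3r j k : (#|I| * congruent_pairs j k <= congruent_pairs j k.+3)%N.
Proof.
apply: (@congruent_pairs_extend _ _ _ _ (fun x p => (p.1, [tuple of x :: x :: x :: p.2]))).
  move=> x x' [t u] [t' u'] [-> -> e2]; split=> //.
  by congr (_, _); apply: val_inj.
move=> x p /forallP H; apply/forallP => y /=.
have -> : ((x == y) + ((x == y) + ((x == y) + count_mem y p.2)) = (x == y) * 3 + count_mem y p.2)%N.
  by lia.
by rewrite modnMDl.
Qed.

Lemma congruent_pairs3l j k : (#|I| * congruent_pairs j k <= congruent_pairs j.+3 k)%N.
Proof.
apply: (@congruent_pairs_extend _ _ _ _ (fun x p => ([tuple of x :: x :: x :: p.1], p.2))).
  move=> x x' [t u] [t' u'] [e1 _ _ e2 e3]; split=> //.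
  by rewrite e3; congr (_, _); apply: val_inj.
move=> x p /forallP H; apply/forallP => y /=.
have -> : ((x == y) + ((x == y) + ((x == y) + count_mem y p.1)) = (x == y) * 3 + count_mem y p.1)%N.
  by lia.
by rewrite modnMDl.
Qed.

(** Each extension adds 2 or 3 entries and gains a factor |I|, hence at least |I|^(1/4) per entry.
    The fourth power matches the loss q^((j+k)/4) of the non-congruent pairs. *)
Lemma congruent_pairs_ge j k : (0 < #|I|)%N -> j = k %[mod 3] ->
  (#|I| ^ (j + k) <= congruent_pairs j k ^ 4)%N.
Proof.
move=> I0; have [m] := ubnP (j + k); elim: m j k => // m IH j k; rewrite ltnS => jkm jk.
have step (j' k' e : nat) : (j' + k' < m)%N -> j' = k' %[mod 3] -> (j + k <= e + (j' + k'))%N ->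
    (e <= 4)%N -> (#|I| * congruent_pairs j' k' <= congruent_pairs j k)%N ->
    (#|I| ^ (j + k) <= congruent_pairs j k ^ 4)%N.
  move=> lt jk' le e4 H; rewrite -(leq_exp2r _ _ (isT : 0 < 4)%N) in H.
  apply: leq_trans H; rewrite expnMn.
  apply: leq_trans (leq_mul (leqnn _) (IH j' k' lt jk')).
  rewrite -expnD leq_pexp2l //; by lia.
case: j jk jkm step => [|j]; case: k => [|k] jk jkm step.
- rewrite expn0 expn_gt0 /congruent_pairs; apply/orP; left; apply/card_gt0P.
  by exists ([tuple], [tuple]); rewrite !inE; apply/forallP.
- move: jk jkm step; case: k => [|[|k]] // jk jkm step.
  have jk' : 0 = k %[mod 3] by rewrite -(modnDr k) addn3.
  have lt : (0 + k < m)%N by lia.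
  have le : (0 + k.+3 <= 3 + (0 + k))%N by lia.
  exact: step lt jk' le isT (congruent_pairs3r _ _).
- move: jk jkm step; case: j => [|[|j]] // jk jkm step.
  have jk' : j = 0 %[mod 3] by rewrite -(modnDr j) addn3.
  have lt : (j + 0 < m)%N by lia.
  have le : (j.+3 + 0 <= 3 + (j + 0))%N by lia.
  exact: step lt jk' le isT (congruent_pairs3l _ _).
- have jk' : j = k %[mod 3] by apply/eqP; rewrite -(eqn_modDr 1) !addn1; apply/eqP.
  have lt : (j + k < m)%N by lia.
  have le : (j.+1 + k.+1 <= 2 + (j + k))%N by lia.
  exact: step lt jk' le isT (congruent_pairsSS _ _).
Qed.

End Expansion.

Lemma conj_cube_root (R : realType) (w : R[i]) : w ^+ 3 = 1 -> w^*%C = w ^+ 2.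
Proof.
move=> w3; have c1 : cmod w = 1.
  apply/eqP; rewrite -(@pexpr_eq1 _ _ 3) ?cmod_ge0 // -cmodX w3 cmod1 //.
have w0 : w != 0 by rewrite -cmod_eq0 c1 oner_eq0.
have H : w * w^*%C = 1 by rewrite -sqr_normc -cmodE c1 expr1n.
by apply: (mulfI w0); rewrite H -exprS w3.
Qed.

Lemma local_monomial_cube_root (R : realType) (w : R[i]) a b : w ^+ 3 = 1 ->
  local_monomial a b w = w ^+ (a + 2 * b).
Proof. by move=> w3; rewrite /local_monomial conj_cube_root // -exprM -exprD. Qed.

Lemma dvd3_congr a b : (3 %| a + 2 * b)%N = (a == b %[mod 3]).
Proof.
rewrite -(eqn_modDr (2 * b)) -[X in _ == X %[mod 3]](_ : b * 3 = b + 2 * b)%N ?modnMl //.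
by lia.
Qed.

(** * The random moment as a sum of products of local moments *)

Section RandomMoment.
Variables (R : realType) (F : finFieldType) (omega : R[i]).
Hypothesis omega_prim : 3.-primitive_root omega.
Local Notation q := (#|F|%:R : R).

(** The expectation of X^a times the conjugate of X to the power b for one variable; when a = b = 0
    the value X = 0 also contributes. *)
Definition local_moment a b : R :=
  if (a == 0%N) && (b == 0%N) then 1 else if a == b %[mod 3] then q / (q + 2) else 0.

Lemma sum_local_monomial a b :
  \sum_(m : option 'I_3) local_monomial a b (trigonal_value omega m) * (@trigonal_prob R #|F| m)%:C =
  (local_moment a b)%:C.
Proof.
have q0 : 0 <= q by exact: ler0n.
rewrite /local_moment; case: ifPn => [/andP[/eqP -> /eqP ->]|ab].
  under eq_bigr do rewrite /local_monomial !expr0 !mul1r.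
  by rewrite -rmorph_sum sum_trigonal_prob.
rewrite big_option /=.
have -> : local_monomial a b 0 = 0 :> R[i].
  rewrite /local_monomial conjc0 !expr0n; move: ab.
  by case: (a == 0%N); case: (b == 0%N); rewrite ?mulr0 ?mul0r.
rewrite mul0r add0r -mulr_suml.
have w3 : omega ^+ 3 = 1 by exact: prim_expr_order.
have E (i : 'I_3) : local_monomial a b (omega ^+ i) = (omega ^+ (a + 2 * b)) ^+ i.
  have wi3 : (omega ^+ i) ^+ 3 = 1 by rewrite -exprM mulnC exprM w3 expr1n.
  by rewrite (local_monomial_cube_root a b wi3) -!exprM mulnC.
under eq_bigr do rewrite E.
rewrite -dvd3_congr (prim_order_dvd omega_prim).
rewrite !big_ord_recl big_ord0 /= expr0 expr1 addr0.
have W3 : (omega ^+ (a + 2 * b)) ^+ 3 = 1 by rewrite exprAC w3 expr1n.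
case: eqVneq => [->|W1].
  rewrite !expr1n.
  rewrite (_ : 1 + (1 + 1) = 3%:R%:C) -?realcM; last by rewrite natrC; ring.
  by congr (_%:C); field; lra.
have -> : 1 + (omega ^+ (a + 2 * b) + (omega ^+ (a + 2 * b)) ^+ 2) = 0.
  move: W3 W1; move: (omega ^+ _) => W W3 W1; apply/eqP.
  have /eqP : (W - 1) * (1 + (W + W ^+ 2)) = 0.
    have -> : (W - 1) * (1 + (W + W ^+ 2)) = W ^+ 3 - 1 by ring.
    by rewrite W3 subrr.
  by rewrite mulf_eq0 subr_eq0 (negbTE W1).
by rewrite mul0r rmorph0.
Qed.

Definition pair_density (t u : seq (option F)) : R :=
  \prod_x local_moment (count_mem x t) (count_mem x u).

Lemma random_moment_expand d (T : measurableType d) (P : probability T R) (X : 'I_#|F|.+1 -> T -> R[i]) j k :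
  iid_trigonal P omega X ->
  random_moment P j k X = (sqrt_q1 R F)^-1 ^+ (j + k) *
    \sum_(t : j.-tuple (option F)) \sum_(u : k.-tuple (option F)) (pair_density t u)%:C.
Proof.
move=> hX; rewrite (random_momentE omega_prim hX).
have card : #|{: option F}| = #|F|.+1 by rewrite card_option.
(* The q + 1 variables are relabelled by the points of the projective line, to compare term by term
   with the curve side. *)
pose h (i : 'I_#|F|.+1) : option F := enum_val (cast_ord (esym card) i).
pose h' (x : option F) := cast_ord card (enum_rank x).
have hK : cancel h h' by move=> i; rewrite /h /h' enum_valK cast_ordKV.
have hK' : cancel h' h by move=> x; rewrite /h /h' cast_ordK enum_rankK.
rewrite (reindex (fun w : {ffun option F -> option 'I_3} => [ffun i => w (h i)])) /=; last first.
  exists (fun v : {ffun 'I_#|F|.+1 -> option 'I_3} => [ffun x => v (h' x)]) => [v _|v _].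
    by apply/ffunP => x; rewrite !ffunE hK'.
  by apply/ffunP => x; rewrite !ffunE hK.
have hb : {on predT, bijective h} by exists h' => x _; [exact: hK|exact: hK'].
have S (g : option F -> R[i]) : \sum_i g (h i) = \sum_x g x by rewrite [RHS](reindex h hb).
have Pr (g : option F -> R) : \prod_i g (h i) = \prod_x g x by rewrite [RHS](reindex h hb).
under eq_bigr => w _.
  under eq_bigr do rewrite ffunE.
  under [X in _ * (_ * X) ^+ k]eq_bigr do rewrite ffunE.
  under [X in _ * X%:C]eq_bigr do rewrite ffunE.
  rewrite (S (fun x => trigonal_value omega (w x))) (S (fun x => (trigonal_value omega (w x))^*%C)).
  rewrite (Pr (fun x => @trigonal_prob R #|F| (w x))).
  rewrite expand_moment -mulrA mulr_suml.
  over.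
rewrite -mulr_sumr; congr (_ * _).
rewrite exchange_big /=; apply: eq_bigr => t _.
under eq_bigr do rewrite mulr_suml.
rewrite exchange_big /=; apply: eq_bigr => u _.
rewrite /pair_density rmorph_prod -(eq_bigr _ (fun x _ => sum_local_monomial _ _)).
rewrite bigA_distr_bigA /=; apply: eq_bigr => w _.
by rewrite rmorph_prod -big_split.
Qed.

Lemma pair_density_bad t u : ~~ congruent_counts t u -> pair_density t u = 0.
Proof.
move=> /forallPn[x nx]; rewrite /pair_density (bigD1 x) //=.
suff -> : local_moment (count_mem x t) (count_mem x u) = 0 by rewrite mul0r.
rewrite /local_moment (negbTE nx); case: ifP => // /andP[/eqP e1 /eqP e2].
by move: nx; rewrite e1 e2 eqxx.
Qed.

Definition marked (t u : seq (option F)) : {set option F} := [set x | (x \in t) || (x \in u)]%SET.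

Lemma count_mem_eq0 (s : seq (option F)) x : (count_mem x s == 0%N) = (x \notin s).
Proof. by rewrite -[_ \notin _]negbK negbK -has_pred1 has_count lt0n negbK. Qed.

Lemma pair_density_good t u : congruent_counts t u ->
  pair_density t u = (q / (q + 2)) ^+ #|marked t u|.
Proof.
move=> /forallP H; rewrite /pair_density -prodr_const [RHS]big_mkcond /=.
apply: eq_bigr => x _; rewrite /local_moment (H x) inE !count_mem_eq0 -negb_or.
by case: (_ || _).
Qed.

Lemma card_marked t u : (#|marked t u| <= size t + size u)%N.
Proof.
rewrite -size_cat; apply: leq_trans (card_size _); apply: subset_leq_card.
by apply/fintype.subsetP => x; rewrite inE mem_cat.
Qed.

End RandomMoment.

(** * Comparison of the two moments *)

Section Family.
Variables (R : realType) (F : finFieldType) (chi : F -> R[i]).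
Hypothesis chi_cubic : cubic_character chi.
Implicit Types (t u : seq (option F)) (f g w : {poly F}).

Definition local_factor a b (z : F) : R[i] := local_monomial a b (chi z).

Lemma chi_root z : z != 0 -> chi z ^+ 3 = 1.
Proof. by have [_ _ _ + _] := chi_cubic; apply. Qed.

Lemma cmod_chi z : z != 0 -> cmod (chi z) = 1.
Proof.
move=> z0; apply/eqP; rewrite -(@pexpr_eq1 _ _ 3) ?cmod_ge0 // -cmodX.
by rewrite chi_root // cmod1.
Qed.

Lemma local_factor_1 a b : local_factor a b 1 = 1.
Proof.
have [_ c1 _ _ _] := chi_cubic.
by rewrite /local_factor /local_monomial c1 conjc1 !expr1n mulr1.
Qed.

Lemma local_factorM a b : {morph local_factor a b : x y / x * y}.
Proof.
have [_ _ cM _ _] := chi_cubic; move=> x y.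
by rewrite /local_factor /local_monomial cM rmorphM /= !exprMn mulrACA.
Qed.

Lemma local_factor00 z : local_factor 0 0 z = 1.
Proof. by rewrite /local_factor /local_monomial !expr0 mulr1. Qed.

Lemma local_factor_0 a b : local_factor a b 0 = ((a == 0%N) && (b == 0%N))%:R.
Proof.
have [c0 _ _ _ _] := chi_cubic; rewrite /local_factor /local_monomial c0 conjc0 !expr0n.
by case: (a == 0%N); case: (b == 0%N); rewrite ?mulr0 ?mul0r ?mulr1.
Qed.

Lemma cmod_local_factor a b z : z != 0 -> cmod (local_factor a b z) = 1.
Proof.
by move=> z0; rewrite /local_factor /local_monomial cmodM !cmodX cmod_conj cmod_chi // !expr1n mulr1.
Qed.

Lemma cmod_local_factor_le a b z : cmod (local_factor a b z) <= 1.
Proof.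
have [->|z0] := eqVneq z 0; last by rewrite cmod_local_factor.
by rewrite local_factor_0; case: (_ && _); rewrite ?cmod1 ?cmod0.
Qed.

Lemma local_factorE a b z : z != 0 -> local_factor a b z = chi z ^+ (a + 2 * b).
Proof. by move=> z0; exact: local_monomial_cube_root (chi_root z0). Qed.

Lemma local_factor_congr a b z : a = b %[mod 3] -> z != 0 -> local_factor a b z = 1.
Proof.
move=> /eqP; rewrite -dvd3_congr => /dvdnP[e eE] z0.
by rewrite local_factorE // eE mulnC exprM chi_root // expr1n.
Qed.

Lemma local_factor_local a b : local_character (local_factor a b).
Proof.
by split; [exact: local_factor_1|exact: local_factorM|move=> z; exact: cmod_local_factor].
Qed.

Lemma local_factor_nontrivial a b : a != b %[mod 3] -> nontrivial_character (local_factor a b).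
Proof.
move=> ab; split; first exact: local_factor_local.
  rewrite local_factor_0; case: (boolP (_ && _)) => // /andP[/eqP a0 /eqP b0].
  by rewrite a0 b0 eqxx in ab.
have [_ _ _ _ [x x0 cx]] := chi_cubic; exists x => //.
rewrite local_factorE //.
have prim : 3.-primitive_root (chi x).
  have [m pm m3] := prim_order_exists (isT : (0 < 3)%N) (chi_root x0).
  have /primeP[_ /(_ m m3) /orP[/eqP m1|/eqP <- //]] : prime 3 by [].
  by have := prim_expr_order pm; rewrite m1 expr1 => c1; rewrite c1 eqxx in cx.
by rewrite -(prim_order_dvd prim) dvd3_congr.
Qed.

Lemma sum_local_factor j k :
  \sum_(x | x != 0) local_factor j k x = if j == k %[mod 3] then (#|F|.-1)%:R else 0.
Proof.
case: ifPn => [/eqP jk|jk].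
  rewrite (eq_bigr (fun=> 1)) => [|x x0]; last exact: local_factor_congr.
  by rewrite sumr_const cardC1.
have H := nontrivial_sum0 (local_factor_nontrivial jk).
have [_ f0 _] := local_factor_nontrivial jk.
by move: H; rewrite (bigD1 0) //= f0 add0r.
Qed.

Definition point_factor t u (x : option F) : F -> R[i] :=
  local_factor (count_mem x t) (count_mem x u).

Definition poly_factor t u g : R[i] := \prod_(x : F) point_factor t u (Some x) g.[x].

(** The value v at infinity is a separate argument, being the leading coefficient in the first
    family and 0 in the other two. *)
Definition value_factor t u v g : R[i] := point_factor t u None v * poly_factor t u g.

Lemma poly_factorM t u : {morph poly_factor t u : g w / g * w}.
Proof.
move=> g w; rewrite /poly_factor -big_split /=; apply: eq_bigr => x _.
by rewrite hornerM; exact: local_factorM.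
Qed.

Lemma prod_point_factor t u z : z != 0 ->
  \prod_(x : option F) point_factor t u x z = local_factor (size t) (size u) z.
Proof.
move=> z0; rewrite /point_factor /local_factor /local_monomial big_split /=.
by rewrite !prodrXr !sum_count_mem.
Qed.

Lemma poly_factor_scale t u z g :
  poly_factor t u (z *: g) = (\prod_(x : F) point_factor t u (Some x) z) * poly_factor t u g.
Proof.
rewrite /poly_factor -big_split /=; apply: eq_bigr => x _.
by rewrite hornerZ; exact: local_factorM.
Qed.

(** The leading coefficient z multiplies the value at every point, infinity included, so it factors
    out with exponents the lengths of the tuples. *)
Lemma value_factor_main t u z g w : z != 0 ->
  value_factor t u z (z *: (g * w ^+ 2)) =
  local_factor (size t) (size u) z * (poly_factor t u g * poly_factor t u w ^+ 2).
Proof.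
move=> z0; rewrite /value_factor poly_factor_scale poly_factorM expr2 poly_factorM -expr2.
by rewrite mulrA -(prod_point_factor t u z0) big_option.
Qed.

Definition infinity_factor t u : R[i] := point_factor t u None 0.

Lemma value_factor_zero t u z g w : z != 0 ->
  value_factor t u 0 (z *: (g * w ^+ 2)) = infinity_factor t u *
  (local_factor (size t) (size u) z * (poly_factor t u g * poly_factor t u w ^+ 2)).
Proof.
move=> z0; rewrite -value_factor_main // /value_factor mulrA; congr (_ * _).
rewrite /infinity_factor /point_factor local_factor_0.
case: (boolP (_ && _)) => [/andP[/eqP -> /eqP ->]|_]; last by rewrite !mul0r.
by rewrite local_factor00 mulr1.
Qed.

Definition square_factor t u g : R[i] := poly_factor t u g ^+ 2.

Lemma sum_value_factor (main : bool) t u a b :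
  \sum_(f <- Fhat_seq F a b) value_factor t u (if main then lead_coef f else 0) f =
  (if main then 1 else infinity_factor t u) *
  (\sum_(x | x != 0) local_factor (size t) (size u) x) *
  coprime_sum (poly_factor t u) (square_factor t u) a b.
Proof.
rewrite sum_Fhat_seq -mulrA mulr_suml mulr_sumr; apply: eq_bigr => z z0.
rewrite /coprime_sum !mulr_sumr big_seq_cond [RHS]big_seq_cond.
apply: eq_bigr => g /andP[/monicsP[gm _] _].
rewrite !mulr_sumr big_seq_cond [RHS]big_seq_cond.
apply: eq_bigr => w /andP[/monicsP[wm _] _].
have lc : lead_coef (z *: (g * w ^+ 2)) = z.
  by rewrite lead_coefZ lead_coefM (monicP gm) mul1r lead_coef_exp (monicP wm) expr1n mulr1.
case: main; first by rewrite lc value_factor_main // mul1r.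
by rewrite value_factor_zero.
Qed.

Definition pair_value d1 d2 t u f : R[i] :=
  \prod_(x : option F) point_factor t u x (value_P1 d1 d2 f x).

Lemma pair_valueE d1 d2 t u f :
  pair_value d1 d2 t u f = value_factor t u (value_P1 d1 d2 f None) f.
Proof. by rewrite /pair_value big_option. Qed.

(** The sum over the three families once the leading coefficient is factored out. The two smaller
    ones take the value 0 at infinity and survive only if that point is unmarked. *)
Definition family_sum d1 d2 t u : R[i] :=
  coprime_sum (poly_factor t u) (square_factor t u) d1 d2 + infinity_factor t u *
  ((if (0 < d1)%N then coprime_sum (poly_factor t u) (square_factor t u) d1.-1 d2 else 0) +
   (if (0 < d2)%N then coprime_sum (poly_factor t u) (square_factor t u) d1 d2.-1 else 0)).

Lemma sum_pair_value d1 d2 t u :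
  \sum_(f <- all_models F d1 d2) pair_value d1 d2 t u f =
  (\sum_(x | x != 0) local_factor (size t) (size u) x) * family_sum d1 d2 t u.
Proof.
set S := \sum_(x | _) _; set G := poly_factor t u; set G2 := square_factor t u.
have main : \sum_(f <- Fhat_seq F d1 d2) pair_value d1 d2 t u f = S * coprime_sum G G2 d1 d2.
  rewrite -[S]mul1r -(sum_value_factor true).
  rewrite big_seq [RHS]big_seq; apply: eq_bigr => f /Fhat_seqP hf.
  by rewrite pair_valueE /value_P1 mem_set.
have other a b : (a + 2 * b != d1 + 2 * d2)%N ->
    \sum_(f <- Fhat_seq F a b) pair_value d1 d2 t u f =
    infinity_factor t u * S * coprime_sum G G2 a b.
  move=> ab; rewrite -(sum_value_factor false).
  rewrite big_seq [RHS]big_seq; apply: eq_bigr => f /Fhat_seqP /Fhat_size sf.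
  rewrite pair_valueE /value_P1 memNset // => /Fhat_size; rewrite sf => -[] E.
  by rewrite E eqxx in ab.
rewrite sum_all_models main /family_sum mulrDr -addrA; congr (_ + _).
rewrite mulrA [S * _]mulrC mulrDr; congr (_ + _).
  by case: ifP => d; rewrite ?mulr0 // other //; move: d; clear; lia.
by case: ifP => d; rewrite ?mulr0 // other //; move: d; clear; lia.
Qed.

Lemma size_all_models d1 d2 :
  (size (all_models F d1 d2))%:R = (#|F|.-1)%:R * family_sum d1 d2 [::] [::].
Proof.
have := sum_pair_value d1 d2 [::] [::]; rewrite sum_local_factor eqxx => <-.
rewrite (eq_bigr (fun=> 1)) => [|f _].
  by rewrite big_const_seq count_predT iter_addr_0.
by rewrite /pair_value big1 // => x _; exact: local_factor00.
Qed.

(** The case distinction reflects the sum over leading coefficients, which vanishes unless the two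
    lengths agree mod 3. *)
Definition pair_average d1 d2 t u : R[i] :=
  if size t == size u %[mod 3] then family_sum d1 d2 t u / family_sum d1 d2 [::] [::] else 0.

Lemma moment_expand (zeta : F) d1 d2 n j k : 3.-primitive_root zeta -> (d1 + 2 * d2 = n * 3)%N ->
  (1 < #|F|)%N ->
  moment zeta chi d1 d2 j k = (sqrt_q1 R F)^-1 ^+ (j + k) *
    \sum_(t : j.-tuple (option F)) \sum_(u : k.-tuple (option F)) pair_average d1 d2 t u.
Proof.
move=> zp deg3n F1; rewrite (moment_trace_sum zp deg3n chi_cubic).
have E f : (trace_sum chi d1 d2 f / sqrt_q1 R F) ^+ j * ((trace_sum chi d1 d2 f)^*%C / sqrt_q1 R F) ^+ k =
    (sqrt_q1 R F)^-1 ^+ (j + k) *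
    \sum_(t : j.-tuple (option F)) \sum_(u : k.-tuple (option F)) pair_value d1 d2 t u f.
  rewrite ![_ / sqrt_q1 R F]mulrC /trace_sum.
  have -> : (\sum_(x : option F) chi (value_P1 d1 d2 f x))^*%C =
      \sum_(x : option F) (chi (value_P1 d1 d2 f x))^*%C by exact: rmorph_sum.
  exact: expand_moment.
under eq_bigr do rewrite E.
rewrite -mulr_sumr mulrCA; congr (_ * _).
rewrite exchange_big mulr_sumr; apply: eq_bigr => t _.
rewrite exchange_big mulr_sumr; apply: eq_bigr => u _.
have q1 : (#|F|.-1)%:R != 0 :> R[i] by rewrite pnatr_eq0; lia.
rewrite sum_pair_value sum_local_factor size_all_models /pair_average.
case: ifP => _; last by rewrite mul0r mulr0.
by rewrite invfM mulrACA mulVf // mul1r mulrC.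
Qed.

End Family.

Lemma card_sum_pred (T : finType) (p : pred T) : #|p| = (\sum_i p i)%N.
Proof.
by rewrite -sum1_card big_mkcond; apply: eq_bigr => i _; rewrite unfold_in; case: (p i).
Qed.

(** * Estimates for the family sums of congruent and non-congruent pairs *)

Section FamilyBounds.
Variables (R : realType) (F : finFieldType) (chi : F -> R[i]).
Local Notation q := (#|F|%:R : R).
Hypothesis chi_cubic : cubic_character chi.
Hypothesis q4 : 4 <= q.
Implicit Types (t u : seq (option F)) (g w : {poly F}).

Let q1 : 1 < q. Proof. by apply: lt_le_trans q4; rewrite ltr1n. Qed.
Let q0 : 0 < q. Proof. exact: lt_trans ltr01 q1. Qed.
Let qX0 n : 0 <= q ^+ n. Proof. by rewrite exprn_ge0 ?(ltW q0). Qed.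

Lemma coprime_sum_le (f h : {poly F} -> R[i]) d1 d2 : bounded_character f -> bounded_character h ->
  cmod (coprime_sum f h d1 d2) <= q ^+ (d1 + d2).
Proof.
move=> [_ f1] [_ h1]; rewrite exprD -!natrX -!size_monics.
apply: le_trans (_ : \sum_(g <- monics F d1) \sum_(w <- monics F d2) 1 <= _); last first.
  by rewrite !big_const_seq !count_predT !iter_addr_0 -mulrnA mulnC natrM -natrM.
apply: le_trans (cmod_sum _ _ _) _; rewrite big_mkcond /=; apply: ler_sum => g _.
case: ifP => _; last by rewrite sumr_ge0.
apply: le_trans (cmod_sum _ _ _) _; rewrite big_mkcond /=; apply: ler_sum => w _.
by case: ifP => // _; rewrite cmodM mulr_ile1 ?cmod_ge0.
Qed.

Definition finite_marked t u : {set F} := [set x | (Some x \in t) || (Some x \in u)]%SET.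

Lemma card_marked_finite t u : #|marked t u| = (#|finite_marked t u| + (None \in marked t u))%N.
Proof.
rewrite -!sum1_card big_mkcond /= big_option /= addnC; congr (_ + _)%N.
  by rewrite [RHS]big_mkcond; apply: eq_bigr => x _; rewrite !inE.
Qed.

Lemma unmarked_count t u x : x \notin marked t u -> count_mem x t = 0%N /\ count_mem x u = 0%N.
Proof.
by rewrite inE negb_or -!count_mem_eq0 => /andP[/eqP -> /eqP ->].
Qed.

Lemma poly_factor_marked t u g :
  poly_factor chi t u g = \prod_(x in finite_marked t u) point_factor chi t u (Some x) g.[x].
Proof.
rewrite [RHS]big_mkcond; apply: eq_bigr => x _; case: ifPn => // nx.
have [|a0 b0] := @unmarked_count t u (Some x); first by move: nx; rewrite !inE.
by rewrite /point_factor a0 b0 local_factor00.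
Qed.

Lemma infinity_factorE t u : infinity_factor chi t u = (None \notin marked t u)%:R.
Proof.
rewrite /infinity_factor /point_factor (local_factor_0 chi_cubic).
by rewrite !count_mem_eq0 inE negb_or.
Qed.

Lemma point_factor_congruent t u x z : congruent_counts t u -> x \in marked t u ->
  point_factor chi t u x z = (z != 0)%:R.
Proof.
move=> /forallP /(_ x) /eqP H; rewrite inE => xm.
have [->|z0] := eqVneq z 0; last by rewrite /point_factor (local_factor_congr chi_cubic).
rewrite /point_factor (local_factor_0 chi_cubic) !count_mem_eq0 -negb_or xm //.
Qed.

Lemma poly_factor_congruent t u : congruent_counts t u ->
  poly_factor chi t u = nonvanishing R (finite_marked t u).
Proof.
move=> H; apply/funext => g; rewrite poly_factor_marked; apply: eq_bigr => x xm.
by apply: point_factor_congruent => //; move: xm; rewrite !inE.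
Qed.

Lemma square_factor_congruent t u : congruent_counts t u ->
  square_factor chi t u = nonvanishing R (finite_marked t u).
Proof.
move=> H; apply/funext => g; rewrite /square_factor poly_factor_congruent //.
rewrite /nonvanishing -prodrXl; apply: eq_bigr => x _.
by case: (_ != _); rewrite ?expr1n ?expr0n.
Qed.

Lemma density_le1 : 0 <= q / (q + 2) <= 1.
Proof.
have q2 : 0 < q + 2 by rewrite addr_gt0.
by rewrite divr_ge0 ?(ltW q0) ?(ltW q2) //= ler_pdivrMr // mul1r lerDl.
Qed.

Lemma density_ge : 2 / 3 <= q / (q + 2).
Proof.
have q2 : 0 < q + 2 by rewrite addr_gt0.
by rewrite ler_pdivlMr //; have := q4; move: (q) => z z4; lra.
Qed.

Section Congruent.
Variables (J : nat) (y0 y : R).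
Hypotheses (y01 : 1 < y0) (y0y : y0 <= y) (yq : y <= q).

Let y1 : 1 < y. Proof. exact: lt_le_trans y01 y0y. Qed.
Let y_gt0 : 0 < y. Proof. exact: lt_trans ltr01 y1. Qed.

(** The loss y0 / (y0 - 1) per marked point is raised to the power [J], which bounds the number of
    marked points, so that one constant serves all pairs. *)
Definition error_const : R := euler_const y0 * (y0 / (y0 - 1)) ^+ J.

Let ratio_ge1 : 1 <= y0 / (y0 - 1).
Proof. by rewrite ler_pdivlMr ?subr_gt0 // mul1r gerBl. Qed.

Lemma error_const_ge0 : 0 <= error_const.
Proof.
by rewrite /error_const mulr_ge0 ?(ltW (euler_const_gt0 _)) ?exprn_ge0 // (le_trans ler01).
Qed.

Definition error_term d1 d2 : R := y ^+ d1 * q ^+ d2 + q ^+ d1 * y ^+ d2.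

Lemma error_term_ge0 d1 d2 : 0 <= error_term d1 d2.
Proof. by rewrite /error_term addr_ge0 ?mulr_ge0 ?exprn_ge0 ?(ltW q0) ?(ltW y_gt0). Qed.

Lemma nonvanishing_count_le (S : {set F}) N d1 d2 : (#|S| <= J)%N -> (d1 <= N)%N -> (0 < N)%N ->
  cmod (coprime_sum (nonvanishing R S) (nonvanishing R S) d1 d2 -
        ((q / (q + 2)) ^+ #|S|)%:C * sqf_coprime_density R F N * (q ^+ (d1 + d2))%:C)
   <= error_const * error_term d1 d2.
Proof.
move=> SJ d1N N0; apply: le_trans (nonvanishing_count q4 S d2 y01 y0y yq N0 d1N) _.
rewrite ler_wpM2r ?error_term_ge0 // /error_const ler_wpM2l ?(ltW (euler_const_gt0 _)) //.
by rewrite ler_weXn2l.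
Qed.

Lemma cmod_sqf_coprime_density N : (0 < N)%N ->
  cmod (sqf_coprime_density R F N) <= 1 + 2 * error_const.
Proof.
move=> N0; have S0 : (#|finset.set0 : {set F}| <= J)%N by rewrite finset.cards0.
have := @nonvanishing_count_le finset.set0 N 0 0 S0 (leq0n _) N0.
have b := nonvanishing_bounded R (finset.set0 : {set F}).
have := coprime_sum_le 0 0 b b.
set A := coprime_sum _ _ _ _; rewrite finset.cards0 /error_term !expr0 !mulr1 mul1r.
set D := sqf_coprime_density _ _ _ => A1 AD.
have := cmodB A (A - D); rewrite subKr => H; apply: le_trans H _.
by rewrite lerD // (le_trans AD) // mulrC.
Qed.

(* When a degree is zero, the error term already dominates the missing main term. *)
Lemma missing_count (S : {set F}) N d1 d2 : (0 < N)%N -> q ^+ (d1 + d2) <= error_term d1 d2 ->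
  cmod (0 - ((q / (q + 2)) ^+ #|S|)%:C * sqf_coprime_density R F N * (q ^+ (d1 + d2) / q)%:C)
   <= (1 + 2 * error_const) * error_term d1 d2.
Proof.
move=> N0 Qe; have := cmod_sqf_coprime_density N0.
move: (sqf_coprime_density R F N) => D DC; have /andP[r0 r1] := density_le1.
have Q0 : 0 <= q ^+ (d1 + d2) / q by rewrite divr_ge0 ?qX0 ?(ltW q0).
rewrite sub0r cmodN !cmodM !cmod_real (ger0_norm (exprn_ge0 _ r0)) (ger0_norm Q0).
apply: ler_pM; [by rewrite mulr_ge0 ?cmod_ge0 ?exprn_ge0|exact: Q0| |].
  by apply: le_trans DC; rewrite -[leRHS]mul1r ler_wpM2r ?cmod_ge0 // exprn_ile1.
by apply: le_trans Qe; rewrite ler_pdivrMr // -[leLHS]mulr1 ler_wpM2l // ltW.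
Qed.

(** Lowering the total degree by one divides the main term by q, while the density of the pairs
    stays the same. *)
Lemma shifted_count (S : {set F}) N d1 d2 e1 e2 : (#|S| <= J)%N -> (e1 <= N)%N -> (0 < N)%N ->
  (d1 + d2 = (e1 + e2).+1)%N -> error_term e1 e2 <= error_term d1 d2 ->
  cmod (coprime_sum (nonvanishing R S) (nonvanishing R S) e1 e2 -
        ((q / (q + 2)) ^+ #|S|)%:C * sqf_coprime_density R F N * (q ^+ (d1 + d2) / q)%:C)
   <= (1 + 2 * error_const) * error_term d1 d2.
Proof.
move=> SJ e1N N0 -> le_e; have C0 := error_const_ge0.
rewrite exprSr mulfK ?gt_eqF //; apply: le_trans (nonvanishing_count_le e2 SJ e1N N0) _.
apply: ler_pM => //; first exact: error_term_ge0.
by rewrite ler_wpDl // mulr_natl mulr2n lerDl.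
Qed.

Lemma shifted_count_left (S : {set F}) N d1 d2 : (#|S| <= J)%N -> (d1 <= N)%N -> (0 < N)%N ->
  cmod ((if (0 < d1)%N then coprime_sum (nonvanishing R S) (nonvanishing R S) d1.-1 d2 else 0) -
        ((q / (q + 2)) ^+ #|S|)%:C * sqf_coprime_density R F N * (q ^+ (d1 + d2) / q)%:C)
   <= (1 + 2 * error_const) * error_term d1 d2.
Proof.
move=> SJ d1N N0; case: d1 d1N => [|d1] d1N /=.
  by apply: missing_count; rewrite // /error_term !expr0 !mul1r lerDl exprn_ge0 // ltW.
apply: shifted_count => //; first exact: ltnW.
rewrite /error_term !exprS -!mulrA lerD // ler_peMl ?(ltW y1) ?(ltW q1) //.
  by rewrite mulr_ge0 ?exprn_ge0 ?(ltW y_gt0).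
by rewrite mulr_ge0 ?exprn_ge0 ?(ltW y_gt0).
Qed.

Lemma shifted_count_right (S : {set F}) N d1 d2 : (#|S| <= J)%N -> (d1 <= N)%N -> (0 < N)%N ->
  cmod ((if (0 < d2)%N then coprime_sum (nonvanishing R S) (nonvanishing R S) d1 d2.-1 else 0) -
        ((q / (q + 2)) ^+ #|S|)%:C * sqf_coprime_density R F N * (q ^+ (d1 + d2) / q)%:C)
   <= (1 + 2 * error_const) * error_term d1 d2.
Proof.
move=> SJ d1N N0; case: d2 => [|d2] /=.
  by apply: missing_count; rewrite // /error_term addn0 !expr0 !mulr1 lerDr exprn_ge0 // ltW.
apply: shifted_count; rewrite ?addnS //.
rewrite /error_term !exprS ![_ ^+ d1 * (_ * _)]mulrCA lerD // ler_peMl ?(ltW y1) ?(ltW q1) //.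
  by rewrite mulr_ge0 ?exprn_ge0 ?(ltW y_gt0).
by rewrite mulr_ge0 ?exprn_ge0 ?(ltW y_gt0).
Qed.

(* A marked point at infinity kills the two smaller families, and leaves the same
   main term since (q / (q + 2)) (1 + 2 / q) = 1. *)
Lemma family_sum_congruent t u d1 d2 : congruent_counts t u -> (size t + size u <= J)%N ->
  cmod (family_sum chi d1 d2 t u - (pair_density R t u)%:C *
     (sqf_coprime_density R F d1.+1 * (q ^+ (d1 + d2) * (1 + 2 / q))%:C))
   <= (3 + 5 * error_const) * error_term d1 d2.
Proof.
move=> good tuJ; have C0 := error_const_ge0; have E0 := error_term_ge0 d1 d2.
rewrite /family_sum (poly_factor_congruent good) (square_factor_congruent good).
rewrite (pair_density_good R good) infinity_factorE card_marked_finite.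
set S := finite_marked t u; have SJ : (#|S| <= J)%N.
  apply: leq_trans tuJ; apply: leq_trans (card_marked t u).
  by rewrite card_marked_finite leq_addr.
(* The cap [d1.+1] is positive even for d1 = 0 and serves all three families, so that they share one
   density. *)
have H0 := @nonvanishing_count_le S d1.+1 d1 d2 SJ (leqnSn _) (ltn0Sn _).
have H1 := @shifted_count_left S d1.+1 d1 d2 SJ (leqnSn _) (ltn0Sn _).
have H2 := @shifted_count_right S d1.+1 d1 d2 SJ (leqnSn _) (ltn0Sn _).
move: H0 H1 H2; set A0 := coprime_sum _ _ d1 d2; set A1 := (if (0 < d1)%N then _ else _).
set A2 := (if (0 < d2)%N then _ else _); set D := sqf_coprime_density _ _ _.
set Q := q ^+ (d1 + d2); set r := q / (q + 2) => H0 H1 H2.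
case: (boolP (None \in marked t u)) => _ /=.
  rewrite mul0r addr0 addn1.
  have -> : (r ^+ #|S|.+1)%:C * (D * (Q * (1 + 2 / q))%:C) = (r ^+ #|S|)%:C * D * Q%:C.
    have rr : r * (1 + 2 / q) = 1 
      by rewrite /r; have := q4; move: (q) => z z4; field; rewrite ?gt_eqF //; lra.
    rewrite exprSr [(_ * r)%:C]realcM [(Q * _)%:C]realcM.
    have : r%:C * (1 + 2 / q)%:C = 1 by rewrite -realcM rr.
    move: (1 + 2 / q)%:C (r%:C) => a b ab.
    have -> : (r ^+ #|S|)%:C * b * (D * (Q%:C * a)) = (r ^+ #|S|)%:C * D * Q%:C * (b * a) by ring.
    by rewrite ab mulr1.
  apply: le_trans H0 _; apply: ler_wpM2r => //.
  by apply: le_trans (_ : 5 * error_const <= _); [rewrite ler_peMl // ler1n | rewrite lerDr].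
rewrite mul1r addn0.
have -> : A0 + (A1 + A2) - (r ^+ #|S|)%:C * (D * (Q * (1 + 2 / q))%:C) =
    (A0 - (r ^+ #|S|)%:C * D * Q%:C) + ((A1 - (r ^+ #|S|)%:C * D * (Q / q)%:C) +
    (A2 - (r ^+ #|S|)%:C * D * (Q / q)%:C)).
  have -> : Q * (1 + 2 / q) = Q + (Q / q + Q / q) by field; rewrite gt_eqF.
  rewrite !realcD; move: ((Q / q)%:C) => Qq; ring.
apply: le_trans (cmodD _ _) _; apply: le_trans (lerD H0 (le_trans (cmodD _ _) (lerD H1 H2))) _.
rewrite -!mulrDl ler_wpM2r //; lra.
Qed.

End Congruent.

Section NotCongruent.
Variables (h k : R) (J : nat).
Hypotheses (h0 : 0 <= h) (k0 : 0 <= k) (hq : h ^+ 2 = q) (kh : k ^+ 2 = h).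

Let h2 : 2 <= h.
Proof. by rewrite -(ler_pXn2r (n := 2)) ?nnegrE // hq (le_trans _ q4) // -natrX ler_nat. Qed.

(** All the saving comes from the first polynomial, whose sums have main term 0 and rate [h]; the
    second is bounded trivially, at rate q. As q >= 4, [h] is at least 2, which is the fixed lower
    bound for the rates. *)
Lemma family_sum_not_congruent t u d1 d2 : ~~ congruent_counts t u ->
  size t = size u %[mod 3] -> (size t + size u <= J)%N ->
  cmod (family_sum chi d1 d2 t u) <=
  3 * (euler_const 2 * (J%:R * 2 ^+ J * k ^+ J) * (h ^+ d1 * q ^+ d2)).
Proof.
move=> bad tu tuJ; set S := finite_marked t u.
pose x (i : 'I_#|S|) : F := enum_val i.
pose phi i := point_factor chi t u (Some (x i)).
pose nt : pred 'I_#|S| := fun i => count_mem (Some (x i)) t != count_mem (Some (x i)) u %[mod 3].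
have x_inj : injective x by exact: enum_val_inj.
have phi_loc i : local_character (phi i) by exact: local_factor_local.
have phi_le i z : cmod (phi i z) <= 1 by exact: cmod_local_factor_le.
have phi_nt i : nt i -> nontrivial_character (phi i) by move=> H; exact: local_factor_nontrivial.
have fE : poly_factor chi t u = poly_character x phi.
  by apply/funext => g; rewrite poly_factor_marked big_enum_val.
(* Counts that are congruent mod 3 and not both 0 have sum at least 2, so a trivial marked point
   uses up two entries. *)
have Jsize : (2 * #|[predC nt]| + #|nt| <= J)%N.
  apply: leq_trans tuJ; rewrite -!sum_count_mem -big_split big_option /=.
  apply: leq_trans (leq_addl _ _).
  apply: (@leq_trans (\sum_(y in S) (count_mem (Some y) t + count_mem (Some y) u))); last first.
    by rewrite [leqRHS](bigID (mem S)) /= leq_addr.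
  rewrite (card_sum_pred nt) (card_sum_pred [predC nt]) /=.
  have -> : (\sum_(y in S) (count_mem (Some y) t + count_mem (Some y) u) =
      \sum_(i < #|S|) (count_mem (Some (x i)) t + count_mem (Some (x i)) u))%N.
    by rewrite big_enum_val.
  rewrite big_distrr -big_split /=; apply: leq_sum => i _.
  have : (0 < count_mem (Some (x i)) t + count_mem (Some (x i)) u)%N.
    have := enum_valP i; rewrite inE addn_gt0 !lt0n -[_ \in t]negbK -[_ \in u]negbK -!count_mem_eq0.
    by [].
  rewrite -[X in (2 * X + _)%N]/(nat_of_bool (~~ nt i)) /nt; move: (count_mem _ t) (count_mem _ u) => a b.
  case: eqP => /= [ab|_] ab0; lia.
(* If all finite points were congruent, the congruence of the two lengths would force it at infinity
   too, against [bad]. *)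
have ex_nt : exists i, nt i.
  apply/existsP; apply: contraNT bad; rewrite negb_exists => /forallP no.
  have H y : count_mem (Some y) t = count_mem (Some y) u %[mod 3].
    have [yS|yS] := boolP (y \in S).
      have := no (enum_rank_in yS y); rewrite negbK /x enum_rankK_in //.
      by move/eqP.
    have [|-> -> //] := @unmarked_count t u (Some y).
    by move: yS; rewrite !inE.
  apply/forallP => -[y|]; first by rewrite H.
  have SS : \sum_y count_mem (Some y) t = \sum_y count_mem (Some y) u %[mod 3].
    by elim/big_rec2: _ => // y a b _ IH; rewrite -modnDm IH H modnDm.
  move: tu; rewrite -!sum_count_mem !big_option /= => /eqP.
  by rewrite -[in X in X == _]modnDmr SS modnDmr eqn_modDr.
have hb := poly_character_bounded x phi_loc phi_le; rewrite -fE in hb.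
have hb2 : bounded_character (square_factor chi t u).
  case: hb => hM h1; split=> [g w|g]; first by rewrite /square_factor hM exprMn.
  by rewrite /square_factor cmodX exprn_ile1 ?cmod_ge0.
set A := J%:R * 2 ^+ J * k ^+ J.
have A0 : 0 <= A by rewrite !mulr_ge0 ?exprn_ge0.
have H n : cmod (sqf_sum (poly_factor chi t u) n - 0 * (q ^+ n)%:C) <= A * h ^+ n.
  rewrite mul0r subr0 fE.
  exact: (sqf_sum_nontrivial x_inj phi_loc phi_le phi_nt h0 k0 hq kh Jsize n ex_nt).
have H2 n : cmod (sqf_sum (square_factor chi t u) n - 0 * (q ^+ n)%:C) <= 1 * q ^+ n.
  by rewrite mul0r subr0 mul1r; exact: sqf_sum_le.
have hq' : h <= q.
  by rewrite -hq expr2 ler_peMl // (le_trans _ h2) // ler1n.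
have B e1 e2 : cmod (coprime_sum (poly_factor chi t u) (square_factor chi t u) e1 e2) <=
    euler_const 2 * A * (h ^+ e1 * q ^+ e2).
  have z1 : cmod (0 : R[i]) <= A by rewrite cmod0.
  have z2 : cmod (0 : R[i]) <= 1 by rewrite cmod0.
  have l2 : (1 : R) < 2 by rewrite ltr1n.
  have r1 : 2 <= h <= q by rewrite h2.
  have r2 : 2 <= q <= q by rewrite lexx (le_trans _ q4) // ler_nat.
  have := coprime_sum_approx q4 e2 hb hb2 l2 r1 r2 z1 z2 H H2 (leqnn e1).
  by rewrite !mul0r subr0 cmod0 !mul0r addr0 !mulrA.
have E0 : 0 <= euler_const 2 * A by rewrite mulr_ge0 // ltW // euler_const_gt0.
have h1 : 1 <= h by rewrite (le_trans _ h2) // ler1n.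
have B1 : cmod (if (0 < d1)%N then coprime_sum (poly_factor chi t u) (square_factor chi t u) d1.-1 d2 else 0)
    <= euler_const 2 * A * (h ^+ d1 * q ^+ d2).
  case: ifP => d; last by rewrite cmod0 mulr_ge0 // mulr_ge0 // exprn_ge0.
  apply: le_trans (B _ _) _; rewrite ler_wpM2l // ler_wpM2r //.
  by rewrite ler_weXn2l // leq_pred.
have B2 : cmod (if (0 < d2)%N then coprime_sum (poly_factor chi t u) (square_factor chi t u) d1 d2.-1 else 0)
    <= euler_const 2 * A * (h ^+ d1 * q ^+ d2).
  case: ifP => d; last by rewrite cmod0 mulr_ge0 // mulr_ge0 // exprn_ge0.
  apply: le_trans (B _ _) _; rewrite ler_wpM2l // ler_wpM2l ?exprn_ge0 //.
  by rewrite ler_weXn2l ?leq_pred ?(ltW q1).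
apply: le_trans (cmodD _ _) _.
set Z := euler_const 2 * A * _; rewrite (_ : 3 * Z = Z + (Z + Z)); last by ring.
apply: lerD; first exact: B.
rewrite cmodM -[leRHS]mul1r; apply: ler_pM; rewrite ?cmod_ge0 //.
  exact: cmod_local_factor_le.
by apply: le_trans (cmodD _ _) _; apply: lerD.
Qed.

End NotCongruent.

Lemma family_sum_nil_ge d1 d2 : 11 / 48 * q ^+ (d1 + d2) <= cmod (family_sum chi d1 d2 [::] [::]).
Proof.
have f1 : poly_factor chi [::] [::] = fun=> 1.
  by apply/funext => g; rewrite /poly_factor big1 // => x _; exact: local_factor00.
have s1 : square_factor chi [::] [::] = fun=> 1.
  by apply/funext => g; rewrite /square_factor f1 expr1n.
rewrite /family_sum f1 s1 /infinity_factor /point_factor local_factor00 mul1r.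
have H e1 e2 := coprime_count_ge q4 e1 e2 : 11 / 48 * q ^+ (e1 + e2) <= _.
have Rez (z : R[i]) : complex.Re z <= cmod z.
  by apply: le_trans (ler_norm _) _; rewrite -lecR cmodE; exact: normc_ge_Re.
apply: le_trans (Rez _); rewrite !raddfD /=.
apply: le_trans (H _ _) _; rewrite lerDl addr_ge0 //.
  by case: ifP => // _; apply: le_trans (H _ _); rewrite mulr_ge0 // divr_ge0.
by case: ifP => // _; apply: le_trans (H _ _); rewrite mulr_ge0 // divr_ge0.
Qed.

End FamilyBounds.

Lemma leq_exp_base m n : (m ^ n <= m.+1 ^ n)%N.
Proof. by case: n => [|n]; rewrite ?expn0 // leq_exp2r. Qed.

(** * From individual pairs of tuples to the ratio of the two moments *)

Section Averages.
Variables (R : realType) (F : finFieldType) (chi : F -> R[i]).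
Local Notation q := (#|F|%:R : R).
Hypothesis chi_cubic : cubic_character chi.
Hypothesis q4 : 4 <= q.
Implicit Types t u : seq (option F).

Let q1 : 1 < q. Proof. by apply: lt_le_trans q4; rewrite ltr1n. Qed.
Let q0 : 0 < q. Proof. exact: lt_trans ltr01 q1. Qed.

Lemma pair_density_bounds J t u : congruent_counts t u -> (size t + size u <= J)%N ->
  (2 / 3) ^+ J <= pair_density R t u <= 1.
Proof.
move=> good tuJ; rewrite (pair_density_good R good).
have /andP[r0 r1] := density_le1 q4; have r2 := density_ge q4.
rewrite exprn_ile1 // andbT.
have mJ : (#|marked t u| <= J)%N := leq_trans (card_marked t u) tuJ.
have z0 : 0 <= 2 / 3 :> R by rewrite divr_ge0.
apply: le_trans (_ : (2 / 3) ^+ #|marked t u| <= _).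
  by rewrite ler_wiXn2l // ler_pdivrMr // mul1r ler_nat.
by rewrite lerXn2r // nnegrE.
Qed.

Lemma pair_density_ge0 t u : 0 <= pair_density R t u.
Proof.
have [good|bad] := boolP (congruent_counts t u); last by rewrite pair_density_bad.
have /andP[+ _] := pair_density_bounds good (leqnn _).
by apply: le_trans; rewrite exprn_ge0 // divr_ge0.
Qed.

(** Here 48/11 comes from the lower bound for the size of the family, and (3/2)^J from the lower
    bound (2/3)^J for the density, which turns the error into one relative to that density. *)
Lemma pair_average_congruent J (y0 y : R) t u d1 d2 : 1 < y0 -> y0 <= y -> y <= q ->
  congruent_counts t u -> (size t + size u <= J)%N ->
  cmod (pair_average chi d1 d2 t u - (pair_density R t u)%:C) <=
  2 * (3 + 5 * error_const J y0) * (48 / 11) * (3 / 2) ^+ J *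
    ((y / q) ^+ d1 + (y / q) ^+ d2) * pair_density R t u.
Proof.
move=> y01 y0y yq good tuJ.
have C0 := error_const_ge0 J y01; set c := 3 + 5 * error_const J y0.
have c0 : 0 <= c by rewrite addr_ge0 // mulr_ge0.
have y_gt0 : 0 < y by rewrite (lt_le_trans _ y0y) // (lt_trans ltr01).
have nil_good : congruent_counts ([::] : seq (option F)) [::] by apply/forallP.
have H := family_sum_congruent chi_cubic q4 y01 y0y yq d1 d2 good tuJ.
have H0 := @family_sum_congruent R F chi chi_cubic q4 J y0 y y01 y0y yq [::] [::] d1 d2 nil_good (leq0n _).
have E1 : pair_density R ([::] : seq (option F)) [::] = 1 by rewrite /pair_density big1.
rewrite E1 mul1r in H0.
have N0 := family_sum_nil_ge chi q4 d1 d2.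
rewrite /pair_average (congruent_counts_size good) eqxx.
have /andP[x0 x1] := pair_density_bounds good tuJ; have xg := pair_density_ge0 t u.
move: H H0 N0 x0 x1 xg; rewrite -/c; set xi := pair_density R t u.
set W := sqf_coprime_density _ _ _ * _; set NN := family_sum chi d1 d2 t u.
set N := family_sum chi d1 d2 _ _ => H H0 N0 x0 x1 xg.
set B := error_term F y d1 d2 in H H0.
have Q0 : 0 < q ^+ (d1 + d2) by rewrite exprn_gt0.
have Npos : 0 < cmod N by apply: lt_le_trans N0; rewrite mulr_gt0 // divr_gt0.
have Nn0 : N != 0 by rewrite -cmod_eq0 gt_eqF.
have eta : B = q ^+ (d1 + d2) * ((y / q) ^+ d1 + (y / q) ^+ d2).
  rewrite /B /error_term !expr_div_n exprD; field.
  by rewrite !expf_neq0 // gt_eqF.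
set et := (y / q) ^+ d1 + (y / q) ^+ d2 in eta *.
have et0 : 0 <= et by rewrite addr_ge0 // exprn_ge0 // divr_ge0 // ltW.
have D : cmod (NN - xi%:C * N) <= 2 * c * B.
  (* The common main term [W] contains the unevaluated density and cancels; numerator and
     denominator each contribute an error, hence the factor 2. *)
  have -> : NN - xi%:C * N = (NN - xi%:C * W) + xi%:C * (W - N) by ring.
  apply: le_trans (cmodD _ _) _; rewrite -mulrA mulr_natl mulr2n lerD //.
  rewrite cmodM cmod_real ger0_norm // cmodBC -[leRHS]mul1r.
  by rewrite ler_pM ?cmod_ge0.
have -> : NN / N - xi%:C = (NN - xi%:C * N) / N by rewrite mulrBl mulfK.
rewrite cmodM cmodV ler_pdivrMr //; apply: le_trans D _.
have ge1 : 1 <= (3 / 2) ^+ J * xi.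
  apply: le_trans (_ : (3 / 2) ^+ J * (2 / 3) ^+ J <= _); last first.
    by rewrite ler_wpM2l // exprn_ge0 // divr_ge0.
  by rewrite -exprMn (_ : 3 / 2 * (2 / 3) = 1 :> R) ?expr1n //; field.
rewrite eta.
have -> : 2 * c * (48 / 11) * (3 / 2) ^+ J * et * xi * cmod N =
    2 * c * et * (((3 / 2) ^+ J * xi) * (48 / 11 * cmod N)) by ring.
have -> : 2 * c * (q ^+ (d1 + d2) * et) = 2 * c * et * q ^+ (d1 + d2) by ring.
rewrite ler_wpM2l ?mulr_ge0 // -[leLHS]mul1r ler_pM ?(ltW Q0) //.
apply: le_trans (_ : 48 / 11 * (11 / 48 * q ^+ (d1 + d2)) <= _).
  by rewrite mulrA (_ : 48 / 11 * (11 / 48) = 1 :> R) ?mul1r //; field.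
by rewrite ler_wpM2l // divr_ge0.
Qed.

Lemma pair_average_not_congruent J (h k : R) t u d1 d2 : 0 <= h -> 0 <= k ->
  h ^+ 2 = q -> k ^+ 2 = h -> ~~ congruent_counts t u -> (size t + size u <= J)%N ->
  cmod (pair_average chi d1 d2 t u) <=
  48 / 11 * (3 * (euler_const 2 * (J%:R * 2 ^+ J))) * (k ^+ J * h^-1 ^+ d1).
Proof.
move=> h0 k0 hq kh bad tuJ; rewrite /pair_average.
have E0 : 0 <= euler_const 2 :> R by exact: ltW (euler_const_gt0 _).
case: eqP => [tu|_]; last by rewrite cmod0 !mulr_ge0 ?exprn_ge0 ?invr_ge0.
have H := family_sum_not_congruent chi_cubic q4 h0 k0 hq kh d1 d2 bad tu tuJ.
have N0 := family_sum_nil_ge chi q4 d1 d2.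
move: H N0; set N := family_sum chi d1 d2 [::] [::] => H N0.
have Q0 : 0 < q ^+ (d1 + d2) by rewrite exprn_gt0.
have Npos : 0 < cmod N by apply: lt_le_trans N0; rewrite mulr_gt0 // divr_gt0.
rewrite cmodM cmodV ler_pdivrMr //; apply: le_trans H _.
have hn0 : h != 0 by apply: contraTneq q0 => h00; rewrite -hq h00 expr0n ltxx.
have hd : h ^+ d1 * q ^+ d2 = h^-1 ^+ d1 * q ^+ (d1 + d2).
  by rewrite exprD mulrA -hq -exprMn expr2 mulrA mulVf // mul1r.
rewrite hd.
have -> : 3 * (euler_const 2 * (J%:R * 2 ^+ J * k ^+ J) * (h^-1 ^+ d1 * q ^+ (d1 + d2))) =
   (3 * (euler_const 2 * (J%:R * 2 ^+ J))) * (k ^+ J * h^-1 ^+ d1) * q ^+ (d1 + d2) by ring.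
have -> : 48 / 11 * (3 * (euler_const 2 * (J%:R * 2 ^+ J))) * (k ^+ J * h^-1 ^+ d1) * cmod N =
   (3 * (euler_const 2 * (J%:R * 2 ^+ J))) * (k ^+ J * h^-1 ^+ d1) * (48 / 11 * cmod N) by ring.
rewrite ler_wpM2l ?mulr_ge0 ?exprn_ge0 ?invr_ge0 //.
apply: le_trans (_ : 48 / 11 * (11 / 48 * q ^+ (d1 + d2)) <= _).
  by rewrite mulrA (_ : 48 / 11 * (11 / 48) = 1 :> R) ?mul1r //; field.
by rewrite ler_wpM2l // divr_ge0.
Qed.

Variables (omega : R[i]) (j k : nat).
Local Notation J := (j + k)%N.
Local Notation e := (\sum_(t : j.-tuple (option F)) \sum_(u : k.-tuple (option F)) pair_density R t u).

(** Densities are nonnegative, and each congruent pair contributes at least (2/3)^J; there are at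
    least kap^J such pairs. *)
Lemma sum_pair_density_ge (h kap : R) : 0 <= h -> 0 <= kap -> h ^+ 2 = q -> kap ^+ 2 = h ->
  j = k %[mod 3] -> (2 / 3) ^+ J * kap ^+ J <= e.
Proof.
move=> h0 kap0 hq kh jk.
have card : #|{: option F}| = #|F|.+1 by rewrite card_option.
have I0 : (0 < #|{: option F}|)%N by rewrite card.
have N4 := congruent_pairs_ge I0 jk.
apply: le_trans (_ : (2 / 3) ^+ J * (congruent_pairs (option F) j k)%:R <= _).
  rewrite ler_wpM2l ?exprn_ge0 ?divr_ge0 //.
  rewrite -(ler_pXn2r (n := 4)) ?nnegrE ?exprn_ge0 ?ler0n //.
  rewrite -exprM mulnC exprM (_ : kap ^+ 4 = q); last by rewrite (exprM kap 2 2) kh.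
  rewrite -!natrX ler_nat (leq_trans _ N4) // card; exact: leq_exp_base.
rewrite /congruent_pairs -sum1_card natr_sum mulr_sumr pair_bigA /=.
rewrite [leRHS](bigID (fun p : j.-tuple (option F) * k.-tuple (option F) => congruent_counts p.1 p.2)) /=.
apply: le_trans (_ : \sum_(p : j.-tuple (option F) * k.-tuple (option F) | congruent_counts p.1 p.2)
    pair_density R p.1 p.2 <= _); last first.
  by rewrite lerDl sumr_ge0 // => p _; exact: pair_density_ge0.
rewrite (eq_bigl (fun p : j.-tuple (option F) * k.-tuple (option F) => congruent_counts p.1 p.2)); last first.
  by move=> p; rewrite inE.
apply: ler_sum => p good; rewrite mulr1.
have pJ : (size p.1 + size p.2 <= J)%N by rewrite !size_tuple.
by have /andP[] := pair_density_bounds good pJ.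
Qed.

Lemma sum_average_density (y0 y h kap : R) d1 d2 : 1 < y0 -> y0 <= y -> y <= q ->
  0 <= h -> 0 <= kap -> h ^+ 2 = q -> kap ^+ 2 = h -> j = k %[mod 3] ->
  cmod (\sum_(t : j.-tuple (option F)) \sum_(u : k.-tuple (option F)) pair_average chi d1 d2 t u - e%:C) <=
  (2 * (3 + 5 * error_const J y0) * (48 / 11) * (3 / 2) ^+ J * ((y / q) ^+ d1 + (y / q) ^+ d2) +
   48 / 11 * (3 * (euler_const 2 * (J%:R * 2 ^+ J))) * 3 ^+ J * (q ^+ J * h^-1 ^+ d1)) * e.
Proof.
move=> y01 y0y yq h0 kap0 hq kh jk.
set C5 := 2 * _ * _ * _; set et := (y / q) ^+ d1 + (y / q) ^+ d2; set C4 := 48 / 11 * _.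
have E0 : 0 <= euler_const 2 :> R by exact: ltW (euler_const_gt0 _).
have y_gt0 : 0 < y by rewrite (lt_le_trans _ y0y) // (lt_trans ltr01).
have C50 : 0 <= C5.
  by rewrite /C5 !mulr_ge0 ?exprn_ge0 ?divr_ge0 // addr_ge0 // mulr_ge0 // error_const_ge0.
have C40 : 0 <= C4 by rewrite /C4 !mulr_ge0 ?exprn_ge0 ?divr_ge0.
have et0 : 0 <= et by rewrite /et addr_ge0 // exprn_ge0 // divr_ge0 // ltW.
have term t u : (size t + size u <= J)%N ->
    cmod (pair_average chi d1 d2 t u - (pair_density R t u)%:C) <=
    C5 * et * pair_density R t u + C4 * (kap ^+ J * h^-1 ^+ d1).
  move=> tuJ; have [good|bad] := boolP (congruent_counts t u).
    apply: le_trans (pair_average_congruent d1 d2 y01 y0y yq good tuJ) _.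
    by rewrite lerDl !mulr_ge0 ?exprn_ge0 ?invr_ge0.
  rewrite pair_density_bad // subr0 mulr0 add0r.
  exact: pair_average_not_congruent.
apply: le_trans (_ : \sum_(t : j.-tuple (option F)) \sum_(u : k.-tuple (option F))
    (C5 * et * pair_density R t u + C4 * (kap ^+ J * h^-1 ^+ d1)) <= _).
  have -> : e%:C = \sum_(t : j.-tuple (option F)) \sum_(u : k.-tuple (option F)) (pair_density R t u)%:C.
    by rewrite rmorph_sum; apply: eq_bigr => t _; rewrite rmorph_sum.
  rewrite -sumrB; apply: le_trans (cmod_sum _ _ _) _; apply: ler_sum => t _.
  rewrite -sumrB; apply: le_trans (cmod_sum _ _ _) _; apply: ler_sum => u _.
  by apply: term; rewrite !size_tuple.
under eq_bigr do rewrite big_split /= -mulr_sumr sumr_const.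
rewrite big_split /= -mulr_sumr sumr_const -mulrnA mulrDl lerD2l.
rewrite !card_tuple card_option -expnD [(k + j)%N]addnC -[leLHS]mulr_natr.
(* The (q+1)^J pairs, each with error of order kap^J h^(-d1), are compared with [e], which is at
   least (2/3)^J kap^J. The factor 3^J suffices because q + 1 <= 3 (2/3) q. *)
have el := sum_pair_density_ge h0 kap0 hq kh jk.
apply: le_trans (_ : C4 * 3 ^+ J * (q ^+ J * h^-1 ^+ d1) * ((2 / 3) ^+ J * kap ^+ J) <= _); last first.
  by rewrite ler_wpM2l // !mulr_ge0 ?exprn_ge0 ?invr_ge0 ?(ltW q0).
have -> : C4 * 3 ^+ J * (q ^+ J * h^-1 ^+ d1) * ((2 / 3) ^+ J * kap ^+ J) =
    C4 * (kap ^+ J * h^-1 ^+ d1) * ((3 * (2 / 3)) * q) ^+ J by rewrite !exprMn; ring.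
have A0 : 0 <= 3 * (2 / 3) * q by rewrite mulr_ge0 ?(ltW q0) // mulr_ge0 // divr_ge0.
rewrite ler_wpM2l ?mulr_ge0 ?exprn_ge0 ?invr_ge0 // natrX lerXn2r ?nnegrE ?ler0n //.
by rewrite -natr1; have := q1; move: (q) => z z1; lra.
Qed.

Lemma moment_ratio (zeta : F) d (T : measurableType d) (P : probability T R)
  (X : 'I_#|F|.+1 -> T -> R[i]) (y0 y h kap : R) d1 d2 n :
  3.-primitive_root omega -> 3.-primitive_root zeta -> (d1 + 2 * d2 = n * 3)%N ->
  iid_trigonal P omega X ->
  1 < y0 -> y0 <= y -> y <= q -> 0 <= h -> 0 <= kap -> h ^+ 2 = q -> kap ^+ 2 = h ->
  exists2 r : R[i], moment zeta chi d1 d2 j k = random_moment P j k X * (1 + r) &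
  cmod r <= 2 * (3 + 5 * error_const J y0) * (48 / 11) * (3 / 2) ^+ J * ((y / q) ^+ d1 + (y / q) ^+ d2) +
   48 / 11 * (3 * (euler_const 2 * (J%:R * 2 ^+ J))) * 3 ^+ J * (q ^+ J * h^-1 ^+ d1).
Proof.
move=> op zp deg3n hX y01 y0y yq h0 kap0 hq kh.
have F1 : (1 < #|F|)%N by rewrite -(ltr_nat R).
rewrite (moment_expand chi_cubic j k zp deg3n F1) (random_moment_expand op j k hX).
set bound := _ + _.
have y_gt0 : 0 < y by rewrite (lt_le_trans _ y0y) // (lt_trans ltr01).
have b0 : 0 <= bound.
  have E0 : 0 <= euler_const 2 :> R by exact: ltW (euler_const_gt0 _).
  have C0 := error_const_ge0 J y01.
  have c0 : 0 <= 3 + 5 * error_const J y0 by rewrite addr_ge0 // mulr_ge0.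
  have et0 : 0 <= (y / q) ^+ d1 + (y / q) ^+ d2.
    by rewrite addr_ge0 // exprn_ge0 // divr_ge0 // ltW.
  by rewrite /bound addr_ge0 // !mulr_ge0 ?exprn_ge0 ?divr_ge0 ?invr_ge0 ?(ltW q0).
set s := (sqrt_q1 R F)^-1 ^+ _.
have eE : \sum_(t : j.-tuple (option F)) \sum_(u : k.-tuple (option F)) (pair_density R t u)%:C = e%:C.
  by rewrite rmorph_sum; apply: eq_bigr => t _; rewrite rmorph_sum.
(* When j and k differ mod 3 both sides vanish pair by pair and r = 0; otherwise [e] is positive and
   r is the relative difference. *)
rewrite eE; case: (eqVneq (j %% 3) (k %% 3))%N => [jk|jk]; last first.
  exists 0; last by rewrite cmod0.
  rewrite addr0 mulr1; congr (_ * _); rewrite -eE.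
  apply: eq_bigr => t _; apply: eq_bigr => u _.
  rewrite /pair_average !size_tuple (negbTE jk) pair_density_bad ?rmorph0 //.
  by apply: contra jk => /congruent_counts_size; rewrite !size_tuple => ->.
have H := sum_average_density d1 d2 y01 y0y yq h0 kap0 hq kh jk.
have el := sum_pair_density_ge h0 kap0 hq kh jk.
have h00 : 0 < h by rewrite lt0r h0 andbT; apply: contraTneq q0 => hz; rewrite -hq hz expr0n ltxx.
have k00 : 0 < kap by rewrite lt0r kap0 andbT; apply: contraTneq h00 => hz; rewrite -kh hz expr0n ltxx.
have e0 : 0 < e by apply: lt_le_trans el; rewrite mulr_gt0 ?exprn_gt0 // divr_gt0.
move: H e0; set A := \sum_t _; set ee := \sum_t _ => H e0.
have ec : ee%:C != 0 :> R[i] by rewrite -cmod_eq0 cmod_real gt_eqF // normr_gt0 gt_eqF.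
exists ((A - ee%:C) / ee%:C).
  by rewrite -mulrA; congr (_ * _); rewrite mulrDr mulr1 mulrC divfK // addrC subrK.
by rewrite cmodM cmodV cmod_real (gtr0_norm e0) ler_pdivrMr.
Qed.

End Averages.

Theorem theorem1p3 (R : realType) (omega : R[i]) (eps : R) (j k : nat) :
  3.-primitive_root omega -> 0 < eps < 1 -> (0 < j)%N -> (0 < k)%N ->
  exists K : R,
  forall (Fq : finFieldType) (zeta : Fq) (chi : Fq -> R[i]) (d1 d2 : nat),
    let q := #|Fq| in
    (q %% 3 = 1)%N -> 3.-primitive_root zeta -> cubic_character chi ->
    (3 %| d1 + 2 * d2)%N ->
  forall (d : measure_display) (T : measurableType d) (P : probability T R)
         (X : 'I_q.+1 -> T -> R[i]),
    iid_trigonal P omega X ->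
  exists r : R[i],
    moment zeta chi d1 d2 j k = random_moment P j k X * (1 + r) /\
    `|r| <= (K * (q%:R `^ (- (1 - eps) * d2%:R + eps * (j + k)%:R)
                  + q%:R `^ (- d1%:R / 2 + (j + k)%:R)))%:C.
Proof.
move=> op /andP[e0 e1] _ _.
(* The bound by eps gives the exponent of d2; the bound by 1/2 makes the d1 error no larger than
   q^(-d1/2). *)
pose th : R := Num.min eps (1 / 2).
have th_eps : th <= eps by rewrite ge_min lexx.
have th_half : th <= 1 / 2 by rewrite ge_min lexx orbT.
have th0 : 0 < th by rewrite lt_min e0 divr_gt0.
(* This is the value of q^th at the least possible q, so the constants built from it depend only on
   eps, j and k. *)
pose y0 : R := 4 `^ th.
have y01 : 1 < y0.
  rewrite /y0 /powR (negbTE (_ : 4 != 0 :> R)) ?pnatr_eq0 // expR_gt1 mulr_gt0 // ln_gt0 //.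
  by rewrite ltr1n.
pose C5 : R := 2 * (3 + 5 * error_const (j + k) y0) * (48 / 11) * (3 / 2) ^+ (j + k).
pose C4 : R := 48 / 11 * (3 * (euler_const 2 * ((j + k)%:R * 2 ^+ (j + k)))) * 3 ^+ (j + k).
have E0 : 0 <= euler_const 2 :> R by exact: ltW (euler_const_gt0 _).
have C50 : 0 <= C5.
  by rewrite /C5 !mulr_ge0 ?exprn_ge0 ?divr_ge0 // addr_ge0 // mulr_ge0 // error_const_ge0.
have C40 : 0 <= C4 by rewrite /C4 !mulr_ge0 ?exprn_ge0 ?divr_ge0.
exists (C5 + C4) => Fq zeta chi d1 d2 q q3 zp chic d3 d T P X hX.
have [n deg3n] : exists n, (d1 + 2 * d2 = n * 3)%N by exact/dvdnP.
have q1 : (1 < q)%N by apply: card_finNzRing_gt1.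
(* A number greater than 1 and congruent to 1 mod 3 is at least 4. *)
have q4 : 4 <= q%:R :> R.
  by rewrite ler_nat; move: q3 q1; rewrite -/q; clear; move: q => m; lia.
have qp : 0 < q%:R :> R by apply: lt_le_trans q4.
have qn0 : q%:R != 0 :> R by rewrite gt_eqF.
have qge1 : 1 <= q%:R :> R by apply: le_trans q4; rewrite ler1n.
pose y : R := q%:R `^ th; pose h : R := q%:R `^ (1 / 2); pose kap : R := q%:R `^ (1 / 4).
have y0y : y0 <= y by rewrite /y0 /y ge0_ler_powR ?nnegrE ?(ltW th0) ?(ltW qp).
have yq : y <= q%:R.
  rewrite -[leRHS]powRr1 ?(ltW qp) //; apply: ler_powR => //.
  by apply: le_trans th_half _; lra.
have hq : h ^+ 2 = q%:R.
  by rewrite -powR_mulrn ?powR_ge0 // -powRrM (_ : 1 / 2 * 2 = 1 :> R) ?powRr1 ?(ltW qp) //; field.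
have kh : kap ^+ 2 = h.
  by rewrite -powR_mulrn ?powR_ge0 // -powRrM; congr (_ `^ _); field.
have [r Er rb] := moment_ratio chic q4 j k op zp deg3n hX y01 y0y yq
   (powR_ge0 _ _) (powR_ge0 _ _) hq kh.
exists r; split; first exact: Er.
rewrite -cmodE lecR; apply: le_trans rb _; rewrite -/C5 -/C4.
have yE m : (y / q%:R) ^+ m = q%:R `^ (- (1 - th) * m%:R).
  rewrite powRrM powR_mulrn ?powR_ge0 //; congr (_ ^+ _).
  by rewrite -powR_inv1 ?(ltW qp) // -powRD ?qn0 ?implybT //; congr (_ `^ _); ring.
have hE : q%:R ^+ (j + k) * h^-1 ^+ d1 = q%:R `^ (- d1%:R / 2 + (j + k)%:R).
  rewrite powRD ?qn0 ?implybT // powR_mulrn ?(ltW qp) // mulrC; congr (_ * _).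
  rewrite exprVn -powR_mulrn ?powR_ge0 // -powRrM -powR_inv1 ?powR_ge0 // -powRrM.
  by congr (_ `^ _); field.
have J0 : 0 <= (j + k)%:R :> R by exact: ler0n.
have D2 : 0 <= d2%:R :> R by exact: ler0n.
have D1 : 0 <= d1%:R :> R by exact: ler0n.
set P2 := q%:R `^ (- (1 - eps) * d2%:R + _); set P1 := q%:R `^ (- d1%:R / 2 + _) in hE *.
(* The additional exponent eps (j + k) is nonnegative and only enlarges the right side. *)
have B2 : (y / q%:R) ^+ d2 <= P2.
  rewrite yE; apply: ler_powR => //.
  have := ler_wpM2r D2 th_eps; have := mulr_ge0 (ltW e0) J0; clear; lra.
(* Since th <= 1/2, the exponent -(1 - th) d1 is at most -d1/2, so the d1 error of the congruent
   pairs joins that of the others. *)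
have B1 : (y / q%:R) ^+ d1 <= P1.
  rewrite yE; apply: ler_powR => //.
  have := ler_wpM2r D1 th_half; move: J0; clear; lra.
have P20 : 0 <= P2 by exact: powR_ge0.
rewrite hE mulrDl lerD //.
  by rewrite ler_wpM2l // addrC lerD.
by rewrite ler_wpM2l // lerDr.
Qed.
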